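(* Suppose there is a changepoint $\tau^\ast=\lfloor\rho n\rfloor$ for some constant $0<\rho<1$, i.e. $(\boldsymbol\mu_i,\boldsymbol\Sigma_i)=(\boldsymbol\mu_1,\boldsymbol\Sigma_1)$ for $i\le\tau^\ast$ and $(\boldsymbol\mu_i,\boldsymbol\Sigma_i)=(\boldsymbol\mu_n,\boldsymbol\Sigma_n)$ for $i>\tau^\ast$, with $(\boldsymbol\mu_1,\boldsymbol\Sigma_1)\ne(\boldsymbol\mu_n,\boldsymbol\Sigma_n)$. Assume that, as $n,p\to\infty$ and uniformly in $i\in\{1,\ldots,n\}$: (1) $\mathrm{tr}(\boldsymbol\Sigma_i^4)=o\{\mathrm{tr}^2(\boldsymbol\Sigma_i^2)\}$; (2) there is a constant $C$ independent of $n,p$ such that $\sum_{l_1,\ldots,l_h=1}^{p}\mathrm{cum}^2(y_{il_1},\ldots,y_{il_h})\le C\,\mathrm{tr}^{h/2}(\boldsymbol\Sigma_i^2)$ for $h=2,3,4$; (3) there is a constant $C$ independent of $n,p$ such that $\sum_{l_1,\ldots,l_h=1}^{p}\mathrm{cum}^2(y_{il_1},\ldots,y_{il_h})\le C\,\mathrm{tr}^{h/2}(\boldsymbol\Sigma_i^2)$ for $h=5,\ldots,8$, and moreover $\sum_{l_1,\ldots,l_4=1}^{p}\mathrm{cum}^2(y_{il_1},\ldots,y_{il_4})=o\{\mathrm{tr}^2(\boldsymbol\Sigma_i^2)\}$. Then, as $n,p\to\infty$: (i) If $n\|\boldsymbol\mu_1-\boldsymbol\mu_n\|^2/\sqrt{\mathrm{tr}\{(\boldsymbol\Sigma_1+\boldsymbol\Sigma_n)^2\}}\to\infty$,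 then $p_{M_n}\to0$ and $T_n\to\infty$ in probability. (ii) If $n\|\boldsymbol\mu_1-\boldsymbol\mu_n\|^2/\sqrt{\mathrm{tr}\{(\boldsymbol\Sigma_1+\boldsymbol\Sigma_n)^2\}}=O(1)$ and $n\,\mathrm{tr}\{(\boldsymbol\Sigma_1-\boldsymbol\Sigma_n)^2\}/\mathrm{tr}\{(\boldsymbol\Sigma_1+\boldsymbol\Sigma_n)^2\}\to\infty$, then $p_{V_n}\to0$ and $T_n\to\infty$ in probability.
   Context: For each $n$ (with dimension $p=p_n$), $\boldsymbol x_1,\ldots,\boldsymbol x_n$ are independent random vectors in $\mathbb R^p$ with means $\boldsymbol\mu_i=\mathbb E(\boldsymbol x_i)$ and covariance matrices $\boldsymbol\Sigma_i=\mathrm{cov}(\boldsymbol x_i)$; $\boldsymbol y_i=(y_{i1},\ldots,y_{ip})^\top=\boldsymbol x_i-\boldsymbol\mu_i$. Asymptotics are along sequences with both $n\to\infty$ and $p\to\infty$, with no relation between their rates required. $\mathrm{cum}(\cdot)$ is the joint cumulant, $\Phi$ the standard normal distribution function, $\|\cdot\|$ the Euclidean norm, $\mathrm{tr}^a(\cdot)=\{\mathrm{tr}(\cdot)\}^a$, $P_m^k=m!/(m-k)!$, and $\sum^{\ast}$ denotes summation over mutually distinct indices. Mean statistic: for $2\le\tau\le n-2$, $$M_n(\tau)=\frac{1}{\tau(\tau-1)(n-\tau)(n-\tau-1)}\sum_{1\le i_1,i_2\le\tau}^{\ast}\ \sum_{\tau+1\le j_1,j_2\le n}^{\ast}(\boldsymbol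 x_{i_1}-\boldsymbol x_{j_1})^\top(\boldsymbol x_{i_2}-\boldsymbol x_{j_2}),\qquad M_n=\sum_{\tau=2}^{n-2}\frac{\tau(n-\tau)}{n}M_n(\tau).$$ Covariance statistic: with $H(\boldsymbol x_i,\boldsymbol x_j,\boldsymbol x_k,\boldsymbol x_l)=\{(\boldsymbol x_i-\boldsymbol x_j)^\top(\boldsymbol x_k-\boldsymbol x_l)\}^2/4$, for $4\le\tau\le n-4$, $$V_n(\tau)=\frac{1}{P_\tau^4}\sum_{1\le i,j,k,l\le\tau}^{\ast}H(\boldsymbol x_i,\boldsymbol x_j,\boldsymbol x_k,\boldsymbol x_l)+\frac{1}{P_{n-\tau}^4}\sum_{\tau+1\le i,j,k,l\le n}^{\ast}H(\boldsymbol x_i,\boldsymbol x_j,\boldsymbol x_k,\boldsymbol x_l)-\frac{2}{P_\tau^2P_{n-\tau}^2}\sum_{1\le i,j\le\tau}^{\ast}\ \sum_{\tau+1\le k,l\le n}^{\ast}H(\boldsymbol x_i,\boldsymbol x_j,\boldsymbol x_k,\boldsymbol x_l),$$ $$V_n=\sum_{\tau=4}^{n-4}\frac{\tau(n-\tau)}{n}V_n(\tau).$$ Scale estimators: $$\widehat{\mathrm{tr}(\boldsymbol\Sigma_1^2)}=\frac{1}{4(n-3)}\sum_{i=1}^{n-3}\left\{(\boldsymbol x_i-\boldsymbol x_{i+1})^\top(\boldsymbol x_{i+2}-\boldsymbol x_{i+3})\right\}^2,$$ $\widehat\sigma_1^2=\frac{2\pi^2-18}{3}n^2\,\widehat{\mathrm{tr}(\boldsymbol\Sigma_1^2)}$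 and $\widehat\sigma_2^2=\frac{4\pi^2-36}{3}n^2\,\{\widehat{\mathrm{tr}(\boldsymbol\Sigma_1^2)}\}^2$, with $\widehat\sigma_1,\widehat\sigma_2$ the nonnegative square roots. P-values and combined statistic: $p_{M_n}=1-\Phi(\widehat\sigma_1^{-1}M_n)$, $p_{V_n}=1-\Phi(\widehat\sigma_2^{-1}V_n)$, $T_n=-2\log(p_{M_n})-2\log(p_{V_n})$. *)

(* Defs.v *)
From HB Require Import structures.
From mathcomp Require Import all_boot all_order all_algebra.
From mathcomp Require Import all_classical all_reals all_analysis.

Set Implicit Arguments.
Unset Strict Implicit.
Unset Printing Implicit Defensive.

Import Order.TTheory GRing.Theory Num.Theory.
Import numFieldNormedType.Exports.

Local Open Scope classical_set_scope.
Local Open Scope ring_scope.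

(* Observations are numbered from 1, as [x i] with [x] indexed by all of [nat];
   only the indices 1 <= i <= n are meaningful for a sample of size n. *)

(* The library norm on matrices is the sup norm, hence the definition of the
   Euclidean one. *)
Definition dotv {R : realType} {p : nat} (u v : 'cV[R]_p) : R :=
  \sum_(l < p) u l 0 * v l 0.

Definition enorm {R : realType} {p : nat} (u : 'cV[R]_p) : R :=
  Num.sqrt (dotv u u).

Definition mean_stat_at {R : realType} {p : nat} (n : nat)
    (x : nat -> 'cV[R]_p) (tau : nat) : R :=
  (tau * (tau - 1) * (n - tau) * (n - tau - 1))%:R^-1 *
  \sum_(1 <= i1 < tau.+1) \sum_(1 <= i2 < tau.+1 | i1 != i2)
  \sum_(tau.+1 <= j1 < n.+1) \sum_(tau.+1 <= j2 < n.+1 | j1 != j2)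
    dotv (x i1 - x j1) (x i2 - x j2).

Definition mean_stat {R : realType} {p : nat} (n : nat)
    (x : nat -> 'cV[R]_p) : R :=
  \sum_(2 <= tau < (n - 2).+1)
    (tau * (n - tau))%:R / n%:R * mean_stat_at n x tau.

Definition cov_kernel {R : realType} {p : nat} (x : nat -> 'cV[R]_p)
    (i j k l : nat) : R :=
  dotv (x i - x j) (x k - x l) ^+ 2 / 4.

Definition cov_stat_at {R : realType} {p : nat} (n : nat)
    (x : nat -> 'cV[R]_p) (tau : nat) : R :=
  (tau ^_ 4)%:R^-1 *
    (\sum_(1 <= i < tau.+1) \sum_(1 <= j < tau.+1)
     \sum_(1 <= k < tau.+1) \sum_(1 <= l < tau.+1 | uniq [:: i; j; k; l])
       cov_kernel x i j k l)
  + ((n - tau) ^_ 4)%:R^-1 *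
    (\sum_(tau.+1 <= i < n.+1) \sum_(tau.+1 <= j < n.+1)
     \sum_(tau.+1 <= k < n.+1)
     \sum_(tau.+1 <= l < n.+1 | uniq [:: i; j; k; l])
       cov_kernel x i j k l)
  - 2 / (tau ^_ 2 * (n - tau) ^_ 2)%:R *
    (\sum_(1 <= i < tau.+1) \sum_(1 <= j < tau.+1 | i != j)
     \sum_(tau.+1 <= k < n.+1) \sum_(tau.+1 <= l < n.+1 | k != l)
       cov_kernel x i j k l).

Definition cov_stat {R : realType} {p : nat} (n : nat)
    (x : nat -> 'cV[R]_p) : R :=
  \sum_(4 <= tau < (n - 4).+1)
    (tau * (n - tau))%:R / n%:R * cov_stat_at n x tau.

Definition tr_sigma2_hat {R : realType} {p : nat} (n : nat)
    (x : nat -> 'cV[R]_p) : R :=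
  (4 * (n - 3))%:R^-1 *
  \sum_(1 <= i < (n - 3).+1)
    dotv (x i - x i.+1) (x i.+2 - x i.+3) ^+ 2.

Definition sigma1_hat {R : realType} {p : nat} (n : nat)
    (x : nat -> 'cV[R]_p) : R :=
  Num.sqrt ((2 * pi ^+ 2 - 18) / 3 * n%:R ^+ 2 * tr_sigma2_hat n x).

Definition sigma2_hat {R : realType} {p : nat} (n : nat)
    (x : nat -> 'cV[R]_p) : R :=
  Num.sqrt ((4 * pi ^+ 2 - 36) / 3 * n%:R ^+ 2 * tr_sigma2_hat n x ^+ 2).

Definition std_normal_cdf {R : realType} (t : R) : R :=
  fine (normal_prob 0 1 `]-oo, t]).

(* On the event that the scale estimator vanishes, 0^-1 = 0 makes the p-value
   equal to 1/2. *)
Definition pval_mean {R : realType} {p : nat} (n : nat)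
    (x : nat -> 'cV[R]_p) : R :=
  1 - std_normal_cdf ((sigma1_hat n x)^-1 * mean_stat n x).

Definition pval_cov {R : realType} {p : nat} (n : nat)
    (x : nat -> 'cV[R]_p) : R :=
  1 - std_normal_cdf ((sigma2_hat n x)^-1 * cov_stat n x).

Definition combined_stat {R : realType} {p : nat} (n : nat)
    (x : nat -> 'cV[R]_p) : R :=
  - 2 * ln (pval_mean n x) - 2 * ln (pval_cov n x).

(* A random vector of R^p is given by its p coordinates; its sigma-algebra is
   the one generated by them. *)

Definition realized_sample d (T : measurableType d) (R : realType)
    (P : probability T R) (p : nat) (X : nat -> 'I_p -> {RV P >-> R})
    (w : T) : nat -> 'cV[R]_p :=
  fun i => \col_l X i l w.

Definition mean_vec d (T : measurableType d) (R : realType)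
    (P : probability T R) (p : nat) (X : 'I_p -> {RV P >-> R}) : 'cV[R]_p :=
  \col_l fine 'E_P[X l].

Definition cov_mx d (T : measurableType d) (R : realType)
    (P : probability T R) (p : nat) (X : 'I_p -> {RV P >-> R}) : 'M[R]_p :=
  \matrix_(k, l) fine (covariance P (X k) (X l)).

Definition centered d (T : measurableType d) (R : realType)
    (P : probability T R) (p : nat) (X : 'I_p -> {RV P >-> R}) :
    'I_p -> T -> R :=
  fun l w => X l w - mean_vec X l 0.

(* Independence of X 1, ..., X n.  Subfamilies are covered by taking A i to be
   the whole space. *)
Definition independent_vectors d (T : measurableType d) (R : realType)
    (P : probability T R) (p n : nat) (X : nat -> 'I_p -> {RV P >-> R}) :
    Prop :=
  forall A : nat -> set T,
    (forall i, (1 <= i <= n)%N ->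
       g_sigma_preimage (fun l => X i l : T -> R) (A i)) ->
    P (\bigcap_(i in [set k | (1 <= k <= n)%N]) A i) =
    (\prod_(1 <= i < n.+1) fine (P (A i)))%:E.

(* Leonov-Shiryaev formula, over the set partitions of the index set. *)
Definition joint_cumulant d (T : measurableType d) (R : realType)
    (P : probability T R) (h : nat) (Y : 'I_h -> T -> R) : R :=
  \sum_(s : {set {set 'I_h}} | finset.partition s [set: 'I_h]%SET)
    (-1) ^+ (#|s| - 1) * ((#|s| - 1)`!)%:R *
    \prod_(B in s) fine 'E_P[fun w => \prod_(a in B) Y a w].

Definition sum_cumulant2 d (T : measurableType d) (R : realType)
    (P : probability T R) (p h : nat) (X : 'I_p -> {RV P >-> R}) : R :=
  \sum_(l : {ffun 'I_h -> 'I_p})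
    joint_cumulant P (fun a => centered X (l a)) ^+ 2.

Definition mean_signal {R : realType} {p : nat} (n : nat)
    (mu1 mun : 'cV[R]_p) (S1 Sn : 'M[R]_p) : R :=
  n%:R * enorm (mu1 - mun) ^+ 2 / Num.sqrt (\tr ((S1 + Sn) ^+ 2)).

Definition cov_signal {R : realType} {p : nat} (n : nat)
    (S1 Sn : 'M[R]_p) : R :=
  n%:R * \tr ((S1 - Sn) ^+ 2) / \tr ((S1 + Sn) ^+ 2).

(* Convergence in probability of variables living on different spaces. *)
Definition cvg_in_probability (R : realType) (d : nat -> measure_display)
    (T : forall n, measurableType (d n)) (P : forall n, probability (T n) R)
    (Y : forall n, T n -> R) (c : R) : Prop :=
  forall eps : R, 0 < eps ->
    P n [set w | eps <= `|Y n w - c|] @[n --> \oo] --> 0%E.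

Definition cvg_pinfty_in_probability (R : realType)
    (d : nat -> measure_display)
    (T : forall n, measurableType (d n)) (P : forall n, probability (T n) R)
    (Y : forall n, T n -> R) : Prop :=
  forall A : R, P n [set w | Y n w <= A] @[n --> \oo] --> 0%E.

(* Main.v *)
Require Import Defs.
From HB Require Import structures.
From mathcomp Require Import all_boot all_order all_algebra.
From mathcomp Require Import all_classical all_reals all_analysis.
From mathcomp Require Import measurable_realfun.
From mathcomp Require Import ring lra zify.

(* Everything is a second moment computation.  Put K = tr S1^2 + tr Sn^2 and
   d2 = |mu1 - mun|^2.  For independent random tensors E <u, v>^2 is the inner
   product of the Gram matrices of u and v, so squared Gram norms bound the
   variance of a U-statistic built from inner products of tensors attached to
   pairs of observations: terms whose noisy pairs do not meet are uncorrelated.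
   With the tensors x_i - x_j, the mean statistic has expectation at least
   c n^2 d2 and variance O(n^2 (K + n sqrt(K) d2)).  The covariance statistic is
   unchanged when the tensors (x_i - x_j)(x_i - x_j)^T are shifted by a constant
   matrix; shifting by twice the covariance of one segment, it has expectation
   at least n^2 (c tr (S1 - Sn)^2 - 3/2 d2^2) and variance
   O(n^2 (k^2 + n k (tr (S1 - Sn)^2 + d2^2))) with k = K + d2^2.  The bound on
   fourth order cumulants enters only through the Gram norm of y y^T.
   The estimator of tr S1^2 has expectation at most 32 k, and it vanishes with
   small probability, by Chebyshev over disjoint blocks of four observations in
   one segment.  Hence Chebyshev and Markov show that each studentized statistic
   exceeds any fixed level with probability tending to one, and it only remains
   to use Phi < 1 (which excludes the junk value ln 0 = 0) and Phi(t) -> 1. *)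

Set Implicit Arguments.
Unset Strict Implicit.
Unset Printing Implicit Defensive.

Import Order.TTheory GRing.Theory Num.Theory.
Import numFieldNormedType.Exports.

Local Open Scope classical_set_scope.
Local Open Scope ring_scope.

(** * Independence and moments *)

(** Eighth moments match the degree count: the covariance statistic pairs two quadratic tensors, so
    its terms have degree four in the data and their squares degree eight; the squared cross
    products of the trace estimator reach the same degree. The predicate [poly I k] does this
    book-keeping and records at the same time which observations a variable depends on. The shift of
    the covariance statistic is essential. Unshifted, the mean of an outer square is about twice a
    covariance matrix, and noise paired with it would be bounded only by n^3 k^2, which the squared
    signal (n^2 tr (S1 - Sn)^2)^2 need not dominate when n tr (S1 - Sn)^2 is only a slowly growing
    multiple of k. After the shift the mean has the size of the jumps. The shift may depend on tau,
    because invariance holds at each tau separately. Sums over tau are handled by Cauchy-Schwarz; no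
    decorrelation between different tau is used. Every probability bound is brought to the shape
    constant / N, where N is a level that the signal ratio eventually exceeds, so no limit law of
    the statistics enters. *)

Section Independence.
Context d (T : measurableType d) (R : realType) (P : probability T R).

(** For fixed [B] the measurable sets satisfying the product formula form a lambda-system, so
    checking a pi-system is enough; complements are where the finiteness of [P] enters. *)
Lemma indep_sigmaL (C : set (set T)) (B : set T) :
  setI_closed C -> C `<=` measurable -> measurable B ->
  (forall A, C A -> P (A `&` B) = P A * P B)%E ->
  forall A, <<s C >> A -> P (A `&` B) = (P A * P B)%E.
Proof.
move=> CI Cm mB CB A sA.
suff : <<s C >> `<=` [set A | measurable A /\ P (A `&` B) = (P A * P B)%E].
  by move=> /(_ _ sA)[].
apply: lambda_system_subset => //; last first.
  by move=> E CE; split; [exact: Cm | exact: CB].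
apply/dynkin_lambda_system; split.
- by split=> //; rewrite setTI probability_setT mul1e.
- move=> E [mE PE]; split; first exact: measurableC.
  rewrite setIC -setDE measureD//; last by rewrite -ge0_fin_numE ?fin_num_measure.
  transitivity (P B - P E * P B)%E; first by rewrite -PE setIC.
  rewrite probability_setC//.
  have [fB fE] : P B \is a fin_num /\ P E \is a fin_num.
    by rewrite !fin_num_measure.
  rewrite -(fineK fB) -(fineK fE).
  rewrite -EFinM -EFinB; congr EFin; ring.
- move=> F tF FP; have mF n : measurable (F n) by have [] := FP n.
  split; first exact: bigcup_measurable.
  rewrite setI_bigcupl measure_bigcup//; last 2 first.
    by move=> n _; exact: measurableI.
    apply/trivIsetP => i j _ _ ij; rewrite setIACA setIid.
    by move/trivIsetP : tF => /(_ _ _ I I ij) ->; rewrite set0I.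
  have fB : P B \is a fin_num by rewrite fin_num_measure.
  rewrite measure_bigcup// muleC -(fineK fB) -nneseriesZl// fineK//.
  by apply: eq_eseriesr => n _; exact: etrans (proj2 (FP n)) (muleC _ _).
Qed.

Lemma indep_sigma (C1 C2 : set (set T)) :
  setI_closed C1 -> setI_closed C2 ->
  C1 `<=` measurable -> C2 `<=` measurable ->
  (forall A B, C1 A -> C2 B -> P (A `&` B) = P A * P B)%E ->
  forall A B, <<s C1 >> A -> <<s C2 >> B -> P (A `&` B) = (P A * P B)%E.
Proof.
move=> I1 I2 m1 m2 C12 A B s1 s2.
have sm2 : <<s C2 >> `<=` measurable.
  by apply: smallest_sub => //; exact: sigma_algebra_measurable.
apply: indep_sigmaL s1 => //; first exact: sm2.
move=> E CE; rewrite setIC muleC; apply: indep_sigmaL s2 => //; first exact: m1.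
by move=> F CF; rewrite setIC muleC; exact: C12.
Qed.

(** By uniqueness of product measures the joint law of f and g is the product of their laws, and
    Fubini applied to the map (x, y) -> x y gives the formula. Independence is asked on preimages,
    the form that generated sigma-algebras supply. *)
Lemma indep_expectationM (f g : T -> R) :
  measurable_fun setT f -> measurable_fun setT g ->
  P.-integrable setT (EFin \o f) -> P.-integrable setT (EFin \o g) ->
  P.-integrable setT (EFin \o (f \* g)) ->
  (forall A B, measurable A -> measurable B ->
    P (f @^-1` A `&` g @^-1` B) = P (f @^-1` A) * P (g @^-1` B))%E ->
  ('E_P[f \* g] = 'E_P[f] * 'E_P[g])%E.
Proof.
move=> mf mg intf intg intfg ind.
pose Xf : {mfun T >-> R} := mfun_Sub (mem_set mf).
pose Xg : {mfun T >-> R} := mfun_Sub (mem_set mg).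
have mfg : measurable_fun setT (fun w => (f w, g w)) by exact: measurable_fun_pair.
pose Xfg : {mfun T >-> (R * R)%type} := mfun_Sub (mem_set mfg).
pose m1 := distribution P Xf; pose m2 := distribution P Xg.
pose m12 := distribution P Xfg.
have mm z : measurable z -> (m1 \x m2)%E z = m12 z.
  apply: product_measure_unique => A B mA mB.
  by rewrite -[RHS]ind.
pose h0 : R * R -> R := fun z => z.1 * z.2.
pose h := EFin \o h0.
have mprod : measurable_fun setT h.
  apply/measurable_EFinP.
  by apply: measurable_funM; [exact: measurable_fst|exact: measurable_snd].
have int12 : (m1 \x m2)%E.-integrable setT h.
  apply/integrableP; split => //.
  rewrite (eq_measure_integral m12)//; last by move=> A mA _; exact: mm.
  rewrite ge0_integral_distribution//; last by exact: measurableT_comp.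
  by move/integrableP : intfg => [_]; apply: le_lt_trans.
rewrite unlock.
transitivity (\int[m12]_z h z)%E.
  by rewrite integral_distribution.
transitivity (\int[m1 \x m2]_z h z)%E.
  by apply: eq_measure_integral => A mA _; apply/esym; exact: mm.
rewrite -integral12_prod_meas1// /fubini_F/=.
have -> : (\int[P]_w (f w)%:E)%E = (\int[m1]_x x%:E)%E.
  by rewrite integral_distribution//; exact/measurable_EFinP.
have -> : (\int[P]_w (g w)%:E)%E = (\int[m2]_x x%:E)%E.
  by rewrite integral_distribution//; exact/measurable_EFinP.
have int1 : m1.-integrable setT (@EFin R).
  by apply: integrable_pushforward => //; exact/measurable_EFinP.
have int2 : m2.-integrable setT (@EFin R).
  by apply: integrable_pushforward => //; exact/measurable_EFinP.
under eq_integral => x _.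
  under eq_integral => y _ do rewrite /h /h0 /= EFinM.
  rewrite integralZl//; over.
have er : (\int[m2]_x x%:E = (fine (\int[m2]_x x%:E))%:E)%E.
  by rewrite fineK//; exact: integrable_fin_num.
transitivity (\int[m1]_x (x%:E * (fine (\int[m2]_x x%:E))%:E))%E.
  by apply: eq_integral => x _; rewrite -er.
by rewrite integralZr// er.
Qed.

End Independence.

Local Notation moments8 P n X :=
  (forall i l, (1 <= i <= n)%N -> (X i l : _ -> _) \in Lfun P 8%:E).

(** * Variables of polynomial growth carried by a given set of observations *)

Section Polynomials.
Context d (T : measurableType d) (R : realType) (P : probability T R)
  (n p : nat) (X : nat -> 'I_p -> {RV P >-> R}).
Hypothesis indX : independent_vectors n X.
Hypothesis X8 : moments8 P n X.

Let sX i := g_sigma_preimage (fun l => X i l : T -> R).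

(** Rectangles that constrain only the observations in [I]. Filling in [setT] elsewhere keeps all
    [n] factors, so [independent_vectors] applies as it stands; the family is a pi-system generating
    the sigma-algebra of the observations in [I]. *)
Definition cylinders (I : pred nat) : set (set T) :=
  [set A | exists2 F : nat -> set T,
    (forall i, (1 <= i <= n)%N -> sX i (F i) /\ (~~ I i -> F i = setT)) &
    A = \bigcap_(i in [set k | (1 <= k <= n)%N]) F i].

Lemma coord_sigma_measurable i A : sX i A -> measurable A.
Proof.
apply: smallest_sub; first exact: sigma_algebra_measurable.
apply: (big_ind (fun G : set (set T) => G `<=` measurable)).
- by [].
- by move=> G H mG mH B [/mG|/mH].
- by move=> l _ B [C mC <-]; exact: measurable_funPT.
Qed.

Lemma coord_sigma_setI i A B : sX i A -> sX i B -> sX i (A `&` B).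
Proof.
rewrite /sX /g_sigma_preimage; set G := (X in <<s X >>).
exact: (@measurableI _ (g_sigma_algebraType G)).
Qed.

Lemma coord_sigma_setT i : sX i setT.
Proof.
rewrite /sX /g_sigma_preimage; set G := (X in <<s X >>).
exact: (@measurableT _ (g_sigma_algebraType G)).
Qed.

Lemma cylinders_setI I : setI_closed (cylinders I).
Proof.
move=> A B [F HF ->] [G HG ->]; exists (fun i => F i `&` G i).
  move=> i ni; have [sF F1] := HF i ni; have [sG G1] := HG i ni.
  split; first exact: coord_sigma_setI.
  by move=> nI; rewrite F1// G1// setTI.
by rewrite bigcapI.
Qed.

Lemma cylinders_measurable I : cylinders I `<=` measurable.
Proof.
move=> A [F HF ->]; rewrite -[X in measurable X]setCK setC_bigcap.
apply: measurableC; apply: bigcup_measurable => i ni.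
by apply: measurableC; apply: coord_sigma_measurable; exact: (HF i ni).1.
Qed.

Lemma cylinders_mono (I J : pred nat) : {subset I <= J} ->
  cylinders I `<=` cylinders J.
Proof.
move=> IJ A [F HF ->]; exists F => // i ni; have [? F1] := HF i ni.
by split => // nJ; apply: F1; apply: contra nJ; exact: IJ.
Qed.

(** At every index one of the two factors is [setT], so the product formula for the intersected
    factors splits index by index. *)
Lemma cylinders_indep (I J : pred nat) A B : (forall i, ~~ (I i && J i)) ->
  cylinders I A -> cylinders J B -> P (A `&` B) = (P A * P B)%E.
Proof.
move=> IJ [F HF ->] [G HG ->]; rewrite -bigcapI !indX.
- rewrite -EFinM -big_split/= !big_nat; congr EFin; apply: eq_bigr => i ni.
  have [sF F1] := HF i ni; have [sG G1] := HG i ni.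
  have : ~~ I i || ~~ J i by rewrite -negb_and.
  case/orP => [/F1 ->|/G1 ->].
    by rewrite setTI probability_setT mul1r.
  by rewrite setIT probability_setT mulr1.
- by move=> i /HG[].
- by move=> i /HF[].
- by move=> i ni; apply: coord_sigma_setI; [have [] := HF i ni|have [] := HG i ni].
Qed.

Definition total_size (w : T) : R := \sum_(1 <= i < n.+1) \sum_(l < p) `|X i l w|.

(** A growth condition instead of syntactic polynomials: it is stable under sums, degrees add under
    products, and degree eight is integrable under the moment hypothesis. Measurability for the
    generated sigma-algebra confines the dependence to the observations in [I]. *)
Definition poly (I : pred nat) (k : nat) (f : T -> R) : Prop :=
  measurable_fun setT (f : g_sigma_algebraType (cylinders I) -> R) /\
  exists C : R, forall w, `|f w| <= C * (1 + total_size w) ^+ k.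

Lemma total_size_ge0 w : 0 <= total_size w.
Proof. by apply: sumr_ge0 => i _; apply: sumr_ge0. Qed.

Lemma poly_preimage I k f A : poly I k f -> measurable A ->
  <<s cylinders I >> (f @^-1` A).
Proof. by move=> [mf _] mA; have := mf measurableT A mA; rewrite setTI. Qed.

Lemma poly_measurable I k f : poly I k f -> measurable_fun setT f.
Proof.
move=> [mf _] _ A mA; rewrite setTI.
have := mf measurableT A mA; rewrite setTI.
apply: smallest_sub; [exact: sigma_algebra_measurable|exact: cylinders_measurable].
Qed.

Lemma poly_weaken (I J : pred nat) k m f : {subset I <= J} -> (k <= m)%N ->
  poly I k f -> poly J m f.
Proof.
move=> IJ km [mf [C fC]]; split.
  move=> _ A mA; rewrite setTI; have := mf measurableT A mA; rewrite setTI.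
  apply: smallest_sub; first exact: smallest_sigma_algebra.
  by move=> B /(cylinders_mono IJ) ?; exact: sub_sigma_algebra.
exists `|C| => w; apply: (le_trans (fC w)).
have s0 := total_size_ge0 w.
apply: (@le_trans _ _ (`|C| * (1 + total_size w) ^+ k)).
  by rewrite ler_wpM2r ?ler_norm// exprn_ge0// addr_ge0.
by rewrite ler_wpM2l// ler_weXn2l// lerDl.
Qed.

Lemma poly_cst I k c : poly I k (fun=> c).
Proof.
split; first exact: measurable_cst.
exists `|c| => w; rewrite ler_peMr// exprn_ege1// lerDl.
exact: total_size_ge0.
Qed.

Lemma poly_coord i l : (1 <= i <= n)%N -> poly (pred1 i) 1 (X i l).
Proof.
move=> ni; split.
  move=> _ A mA; rewrite setTI; apply: sub_sigma_algebra.
  exists (fun j => if j == i then X i l @^-1` A else setT).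
    move=> j nj; split; last by rewrite /=; case: eqP.
    case: eqP => [->|_]; last exact: coord_sigma_setT.
    rewrite /sX /g_sigma_preimage; apply: sub_sigma_algebra.
    rewrite (bigD1 l)//=; left; exists A => //.
    by rewrite setTI.
  apply/seteqP; split => w /=.
    by move=> Aw j nj; case: eqP.
  by move=> /(_ i ni); rewrite eqxx.
exists 1 => w; rewrite mul1r expr1.
rewrite /total_size (bigD1_seq i)//=; last 2 first.
  by rewrite mem_index_iota.
  exact: iota_uniq.
rewrite (bigD1 l)//=.
have b0 : 0 <= \sum_(m < p | m != l) `|X i m w| by apply: sumr_ge0.
have c0 : 0 <= \sum_(1 <= j < n.+1 | j != i) \sum_(m < p) `|X j m w|.
  by apply: sumr_ge0 => j _; apply: sumr_ge0.
by lra.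
Qed.

Lemma polyD I k f g : poly I k f -> poly I k g -> poly I k (fun w => f w + g w).
Proof.
move=> [mf [C fC]] [mg [D gD]]; split; first exact: measurable_funD.
exists (C + D) => w; rewrite mulrDl (le_trans (ler_normD _ _))//.
by rewrite lerD.
Qed.

Lemma polyM I k m f g : poly I k f -> poly I m g ->
  poly I (k + m) (fun w => f w * g w).
Proof.
move=> [mf [C fC]] [mg [D gD]]; split; first exact: measurable_funM.
exists (C * D) => w; rewrite normrM exprD mulrACA.
by rewrite ler_pM.
Qed.

Lemma polyZ I k c f : poly I k f -> poly I k (fun w => c * f w).
Proof. by move=> pf; apply: (@polyM I 0 k) => //; exact: poly_cst. Qed.

Lemma polyN I k f : poly I k f -> poly I k (fun w => - f w).
Proof.
move=> pf; rewrite (_ : (fun w => _) = (fun w => -1 * f w)).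
  exact: polyZ.
by apply/funext => w; rewrite mulN1r.
Qed.

Lemma polyB I k f g : poly I k f -> poly I k g -> poly I k (fun w => f w - g w).
Proof. by move=> pf pg; apply: polyD => //; exact: polyN. Qed.

Lemma poly_sum I k (J : Type) (r : seq J) (Q : pred J) (F : J -> T -> R) :
  (forall j, Q j -> poly I k (F j)) -> poly I k (fun w => \sum_(j <- r | Q j) F j w).
Proof.
move=> H; elim: r => [|j r IH].
  rewrite (_ : (fun w => _) = fun=> 0); first exact: poly_cst.
  by apply/funext => w; rewrite big_nil.
have [Qj|Qj] := boolP (Q j).
  rewrite (_ : (fun w => _) = (fun w => F j w + \sum_(j <- r | Q j) F j w)).
    by apply: polyD => //; exact: H.
  by apply/funext => w; rewrite big_cons Qj.
rewrite (_ : (fun w => _) = (fun w => \sum_(j <- r | Q j) F j w))//.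
by apply/funext => w; rewrite big_cons (negbTE Qj).
Qed.

Let int8 (f : T -> R) := [/\ measurable_fun setT f, (forall w, 0 <= f w) &
  P.-integrable setT (EFin \o (fun w => f w ^+ 8))].

Let int8D f g : int8 f -> int8 g -> int8 (fun w => f w + g w).
Proof.
move=> [mf f0 intf] [mg g0 intg]; split.
- exact: measurable_funD.
- by move=> w; rewrite addr_ge0.
(* 256 = 2^8, since f + g is at most twice the larger of the two. *)
pose h := fun w => 256 * (f w ^+ 8 + g w ^+ 8).
have inth : P.-integrable setT (EFin \o h).
  rewrite (_ : _ \o _ = fun w => (256%:E * ((f w ^+ 8)%:E + (g w ^+ 8)%:E))%E)//.
  by apply: integrableZl => //; exact: integrableD.
apply: le_integrable inth => //.
  by apply/measurable_EFinP; apply: measurable_funX; exact: measurable_funD.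
move=> w _ /=; rewrite lee_fin !ger0_norm ?exprn_ge0 ?addr_ge0//; last first.
  by rewrite mulr_ge0// addr_ge0// exprn_ge0.
have a0 := f0 w; have b0 := g0 w; rewrite /h.
have [ab|/ltW ba] := leP (f w) (g w).
  apply: (@le_trans _ _ ((2 * g w) ^+ 8)).
    by rewrite lerXn2r ?nnegrE ?addr_ge0 ?mulr_ge0//; lra.
  by have := exprn_ge0 8 a0; rewrite exprMn; lra.
apply: (@le_trans _ _ ((2 * f w) ^+ 8)).
  by rewrite lerXn2r ?nnegrE ?addr_ge0 ?mulr_ge0//; lra.
by have := exprn_ge0 8 b0; rewrite exprMn; lra.
Qed.

Let int8_cst c : 0 <= c -> int8 (fun=> c).
Proof.
move=> c0; split => //.
by apply: finite_measure_integrable_cst.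
Qed.

Let int8_sum (J : Type) (r : seq J) (Q : pred J) (F : J -> T -> R) :
  (forall j, Q j -> int8 (F j)) -> int8 (fun w => \sum_(j <- r | Q j) F j w).
Proof.
move=> H; elim: r => [|j r IH].
  rewrite (_ : (fun w => _) = fun=> 0); first exact: int8_cst.
  by apply/funext => w; rewrite big_nil.
have [Qj|Qj] := boolP (Q j).
  rewrite (_ : (fun w => _) = (fun w => F j w + \sum_(j <- r | Q j) F j w)).
    by apply: int8D => //; exact: H.
  by apply/funext => w; rewrite big_cons Qj.
rewrite (_ : (fun w => _) = (fun w => \sum_(j <- r | Q j) F j w))//.
by apply/funext => w; rewrite big_cons (negbTE Qj).
Qed.

Let int8_size : int8 (fun w => 1 + total_size w).
Proof.
apply: int8D; first exact: int8_cst.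
rewrite /total_size; under eq_fun do rewrite big_nat.
apply: int8_sum => i ni; apply: int8_sum => l _; split => //.
  exact: measurableT_comp.
have : P.-integrable setT (fun w => (`|X i l w| `^ 8)%:E).
  by apply: (Lfun_integrable _ (X8 l ni)); lra.
by apply: eq_integrable => // w _ /=; rewrite -powR_mulrn.
Qed.

Lemma poly_integrable I k f : (k <= 8)%N -> poly I k f ->
  P.-integrable setT (EFin \o f).
Proof.
move=> k8 /(poly_weaken (fun i => id) k8) pf; have mf := poly_measurable pf.
have [_ [C fC]] := pf; have [_ _ intS] := int8_size.
have : P.-integrable setT (fun w => (C%:E * ((1 + total_size w) ^+ 8)%:E)%E).
  exact: integrableZl.
apply: le_integrable => //; first exact/measurable_EFinP.
by move=> w _; rewrite -EFinM /= lee_fin (le_trans (fC w))// ler_norm.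
Qed.

End Polynomials.

Local Opaque poly.

(** * Expectations and second-moment matrices of random tensors *)

Section Expectation.
Context d (T : measurableType d) (R : realType) (P : probability T R)
  (n p : nat) (X : nat -> 'I_p -> {RV P >-> R}).
Hypothesis indX : independent_vectors n X.
Hypothesis X8 : moments8 P n X.
Local Notation poly := (poly n X).
Local Notation nice := (poly xpredT 8).

(** [fine] sends infinite values to 0, which is why the linearity lemmas below carry [nice]
    hypotheses. *)
Definition Ex (f : T -> R) : R := fine 'E_P[f].

Lemma poly_nice I k f : (k <= 8)%N -> poly I k f -> nice f.
Proof. by move=> k8; exact: poly_weaken. Qed.

Let nice_int f : nice f -> P.-integrable setT (EFin \o f).
Proof. exact: (poly_integrable X8). Qed.

Lemma ExE f : nice f -> ('E_P[f] = (Ex f)%:E)%E.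
Proof.
move=> nf; rewrite /Ex fineK//; apply: expectation_fin_num.
exact/Lfun1_integrable/nice_int.
Qed.

Lemma ExD f g : nice f -> nice g -> Ex (fun w => f w + g w) = Ex f + Ex g.
Proof.
move=> nf ng; apply: EFin_inj; rewrite EFinD -!ExE//; last exact: polyD.
by rewrite -expectationD//; exact/Lfun1_integrable/nice_int.
Qed.

Lemma ExZ c f : nice f -> Ex (fun w => c * f w) = c * Ex f.
Proof.
move=> nf; apply: EFin_inj; rewrite EFinM -!ExE//; last exact: polyZ.
rewrite -expectationZl//; last exact/Lfun1_integrable/nice_int.
by congr expectation; apply/funext => w /=; rewrite mulrC.
Qed.

Lemma Ex_cst c : Ex (fun=> c) = c.
Proof. by rewrite /Ex expectation_cst. Qed.

Lemma ExN f : nice f -> Ex (fun w => - f w) = - Ex f.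
Proof.
move=> nf; rewrite -mulN1r -ExZ//.
by congr Ex; apply/funext => w; rewrite mulN1r.
Qed.

Lemma ExB f g : nice f -> nice g -> Ex (fun w => f w - g w) = Ex f - Ex g.
Proof. by move=> nf ng; rewrite ExD ?ExN//; exact: polyN. Qed.

Lemma Ex_sum (J : Type) (r : seq J) (Q : pred J) (F : J -> T -> R) :
  (forall j, Q j -> nice (F j)) ->
  Ex (fun w => \sum_(j <- r | Q j) F j w) = \sum_(j <- r | Q j) Ex (F j).
Proof.
move=> H; elim: r => [|j r IH].
  by rewrite big_nil; under [X in Ex X]eq_fun do rewrite big_nil; rewrite Ex_cst.
rewrite big_cons; under [X in Ex X]eq_fun do rewrite big_cons.
case: ifP => Qj; rewrite -IH// ExD//; first exact: H.
exact: poly_sum.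
Qed.

Lemma Ex_ge0 f : (forall w, 0 <= f w) -> 0 <= Ex f.
Proof. by move=> f0; rewrite /Ex fine_ge0// expectation_ge0. Qed.

Lemma Ex_le f g : nice f -> nice g -> (forall w, f w <= g w) -> Ex f <= Ex g.
Proof.
move=> nf ng fg; rewrite -subr_ge0 -ExB//; apply: Ex_ge0 => w.
by rewrite subr_ge0.
Qed.

(** Disjoint index sets have independent cylinders, hence independent generated sigma-algebras; the
    bound on [k + m] makes the product integrable. *)
Lemma Ex_indepM (I J : pred nat) k m f g : (forall i, ~~ (I i && J i)) ->
  (k + m <= 8)%N -> poly I k f -> poly J m g ->
  Ex (fun w => f w * g w) = Ex f * Ex g.
Proof.
move=> IJ km pf pg.
have nf : nice f by apply: poly_nice pf; lia.
have ng : nice g by apply: poly_nice pg; lia.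
have nfg : nice (fun w => f w * g w).
  apply: (poly_nice km); apply: polyM; first exact: poly_weaken pf.
  exact: poly_weaken pg.
apply: EFin_inj; rewrite EFinM -!ExE//; apply: indep_expectationM => //.
- exact: (poly_measurable nf).
- exact: (poly_measurable ng).
- exact: nice_int.
- exact: nice_int.
- exact: nice_int.
move=> A B mA mB; apply: (@indep_sigma _ _ _ P (cylinders n X I) (cylinders n X J)).
- exact: cylinders_setI.
- exact: cylinders_setI.
- exact: cylinders_measurable.
- exact: cylinders_measurable.
- by move=> ? ?; apply: cylinders_indep.
- exact: poly_preimage pf mA.
- exact: poly_preimage pg mB.
Qed.

Lemma Ex_markov f (c : R) : nice f -> (forall w, 0 <= f w) -> 0 < c ->
  fine (P [set w | c <= f w]) <= Ex f / c.
Proof.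
move=> nf f0 c0; have mf := poly_measurable nf.
have mA : measurable [set w | c <= f w].
  rewrite -[X in measurable X]setTI; apply: (measurable_fun_ler _ _ measurableT) => //.
pose X0 : {RV P >-> R} := mfun_Sub (mem_set mf).
have := @markov _ _ _ P X0 id c c0 (@measurable_id _ _ _) (fun r r0 => r0) (fun x y _ _ xy => xy).
rewrite (_ : [set x | _] = [set w | c <= f w]); last first.
  by apply/seteqP; split => w /=; rewrite lee_fin ger0_norm.
rewrite (_ : _ \o _ = f); last by apply/funext => w /=; rewrite ger0_norm.
have fA : P [set w | c <= f w] \is a fin_num by rewrite fin_num_measure.
by rewrite ExE// -(fineK fA) -EFinM lee_fin /= ler_pdivlMr// mulrC.
Qed.

Section Gram.
Variable K : finType.
Implicit Types Q : K -> T -> R.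

Definition gram Q a b : R := Ex (fun w => Q a w * Q b w).
(** Squared Frobenius norm of the uncentred second-moment matrix: tr Sigma^2 for a centred
    observation, and the sum of all squared fourth moments for its outer square. *)
Definition gram_norm2 Q : R := \sum_a \sum_b gram Q a b ^+ 2.
Definition dotk (u v : K -> R) : R := \sum_a u a * v a.
Definition tensor I k Q := forall a, poly I k (Q a).

Lemma poly_sqrw I k f : poly I k f -> poly I (k + k) (fun w => f w ^+ 2).
Proof. by move=> pf; under eq_fun do rewrite expr2; exact: polyM. Qed.

Lemma polyZr I k c f : poly I k f -> poly I k (fun w => f w * c).
Proof. by move=> pf; under eq_fun do rewrite mulrC; exact: polyZ. Qed.

Lemma nice_mul f g : poly xpredT 4 f -> poly xpredT 4 g -> nice (fun w => f w * g w).
Proof. exact: polyM. Qed.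

Lemma gram_quadratic Q (q : K -> R) : tensor xpredT 4 Q ->
  \sum_a \sum_b q a * q b * gram Q a b = Ex (fun w => dotk q (Q ^~ w) ^+ 2).
Proof.
move=> tQ; transitivity (Ex (fun w => \sum_a \sum_b (q a * q b) * (Q a w * Q b w))).
  rewrite Ex_sum => [|a _]; last first.
    by apply: poly_sum => b _; apply: polyZ; exact: nice_mul.
  apply: eq_bigr => a _; rewrite Ex_sum => [|b _]; last first.
    by apply: polyZ; exact: nice_mul.
  by apply: eq_bigr => b _; rewrite ExZ//; exact: nice_mul.
congr Ex; apply/funext => w; rewrite expr2 /dotk big_distrlr/=.
by apply: eq_bigr => a _; apply: eq_bigr => b _; ring.
Qed.

Lemma gram_quadratic_ge0 Q (q : K -> R) : tensor xpredT 4 Q ->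
  0 <= \sum_a \sum_b q a * q b * gram Q a b.
Proof. by move=> tQ; rewrite gram_quadratic//; apply: Ex_ge0 => w; exact: sqr_ge0. Qed.

Lemma gram_dotE Q Q' : tensor xpredT 4 Q ->
  \sum_a \sum_b gram Q a b * gram Q' a b =
  Ex (fun w => \sum_a \sum_b Q a w * Q b w * gram Q' a b).
Proof.
move=> tQ; rewrite Ex_sum => [|a _]; last first.
  by apply: poly_sum => b _; apply: polyZr; exact: nice_mul.
apply: eq_bigr => a _; rewrite Ex_sum => [|b _]; last first.
  by apply: polyZr; exact: nice_mul.
apply: eq_bigr => b _; under [X in Ex X]eq_fun do rewrite mulrC.
by rewrite ExZ; [exact: mulrC|exact: nice_mul].
Qed.

(** Both matrices are positive semidefinite: writing one as an expectation of rank-one matrices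
    turns the inner product into an expected quadratic form of the other. *)
Lemma gram_dot_ge0 Q Q' : tensor xpredT 4 Q -> tensor xpredT 4 Q' ->
  0 <= \sum_a \sum_b gram Q a b * gram Q' a b.
Proof.
move=> tQ tQ'; rewrite gram_dotE//; apply: Ex_ge0 => w.
exact: gram_quadratic_ge0.
Qed.

Lemma gram_norm2_ge0 Q : 0 <= gram_norm2 Q.
Proof. by apply: sumr_ge0 => a _; apply: sumr_ge0 => b _; exact: sqr_ge0. Qed.

(* The Gram matrices of Q + Q' and Q - Q' have nonnegative inner product and sum
   to twice the sum of those of Q and Q'. *)
Lemma gram_norm2D Q Q' : tensor xpredT 4 Q -> tensor xpredT 4 Q' ->
  gram_norm2 (fun a w => Q a w + Q' a w) <= 8 * (gram_norm2 Q + gram_norm2 Q').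
Proof.
move=> tQ tQ'; set S := (X in gram_norm2 X); pose D a w := Q a w - Q' a w.
have tS : tensor xpredT 4 S by move=> a; exact: polyD.
have tD : tensor xpredT 4 D by move=> a; exact: polyB.
have SD a b : gram S a b + gram D a b = 2 * gram Q a b + 2 * gram Q' a b.
  rewrite /gram -!ExZ; [|exact: nice_mul..].
  rewrite -!ExD; try (by [exact: nice_mul|apply: polyZ; exact: nice_mul]).
  by congr Ex; apply/funext => w; rewrite /S /D; ring.
have := gram_dot_ge0 tS tD => SD0.
have : gram_norm2 S + 2 * (\sum_a \sum_b gram S a b * gram D a b) + gram_norm2 D
   <= 8 * (gram_norm2 Q + gram_norm2 Q').
  rewrite /gram_norm2 !mulrDr !big_distrr/= -!big_split/=; apply: ler_sum => a _.
  rewrite !big_distrr/= -!big_split/=; apply: ler_sum => b _.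
  have -> : gram S a b ^+ 2 + 2 * (gram S a b * gram D a b) + gram D a b ^+ 2 =
    (gram S a b + gram D a b) ^+ 2 by ring.
  rewrite SD; have := sqr_ge0 (gram Q a b - gram Q' a b); lra.
have := gram_norm2_ge0 D; lra.
Qed.

(** The second-moment matrix of [Q] is that of the centred tensor plus m m^T, with m the mean; the
    cross term in the squared norm is twice a quadratic form of a positive semidefinite matrix at
    m. *)
Lemma gram_norm2_center Q : tensor xpredT 4 Q ->
  gram_norm2 (fun a w => Q a w - Ex (Q a)) <= gram_norm2 Q.
Proof.
move=> tQ; pose m a := Ex (Q a); set C := (X in gram_norm2 X).
have tC : tensor xpredT 4 C by move=> a; apply: polyB => //; exact: poly_cst.
have nQ a : nice (Q a) by exact: poly_nice (tQ a).
have QE a b : gram Q a b = gram C a b + m a * m b.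
  have nQQ : nice (fun w => Q a w * Q b w) by exact: nice_mul.
  rewrite /gram /C (_ : (fun w => (_ - _) * (_ - _)) = fun w =>
    (Q a w * Q b w - m a * Q b w) - (m b * Q a w - m a * m b)); last first.
    by apply/funext => w; rewrite /m; ring.
  rewrite !ExB ?ExZ ?Ex_cst//; try (by repeat apply: polyB => //; [exact: polyZ|exact: poly_cst]);
    try exact: polyZ; try exact: poly_cst; last by apply: polyB => //; exact: polyZ.
  by rewrite /m; ring.
have := gram_quadratic_ge0 m tC => mC.
have : gram_norm2 C + 2 * (\sum_a \sum_b m a * m b * gram C a b) <= gram_norm2 Q.
  rewrite /gram_norm2 !big_distrr/= -!big_split/=; apply: ler_sum => a _.
  rewrite !big_distrr/= -!big_split/=; apply: ler_sum => b _.
  rewrite QE; have := sqr_ge0 (m a * m b); lra.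
lra.
Qed.

(** The operator norm of a second-moment matrix is at most its Frobenius norm. Cauchy-Schwarz for
    the double sum is obtained by summing 2 t x y <= t^2 x^2 + y^2 with a free parameter t. *)
Lemma Ex_sqr_dotk_cst Q (m : K -> R) (c : R) : tensor xpredT 4 Q -> 0 <= c ->
  gram_norm2 Q <= c ^+ 2 -> Ex (fun w => dotk m (Q ^~ w) ^+ 2) <= c * dotk m m.
Proof.
move=> tQ c0 Qc; rewrite -gram_quadratic//.
set s := dotk m m; have s0 : 0 <= s by apply: sumr_ge0 => a _; rewrite -expr2 sqr_ge0.
set A := \sum_a _; have sE : s ^+ 2 = \sum_a \sum_b (m a * m b) ^+ 2.
  rewrite expr2 /s /dotk big_distrlr/=; apply: eq_bigr => a _.
  by apply: eq_bigr => b _; ring.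
have key (t : R) : 0 <= t -> 2 * t * A <= t ^+ 2 * s ^+ 2 + c ^+ 2.
  move=> t0; apply: (@le_trans _ _ (t ^+ 2 * s ^+ 2 + gram_norm2 Q)); last by rewrite lerD2l.
  rewrite sE /gram_norm2 /A !big_distrr/= -!big_split/=; apply: ler_sum => a _.
  rewrite !big_distrr/= -!big_split/=; apply: ler_sum => b _.
  have := sqr_ge0 (t * (m a * m b) - gram Q a b); lra.
have [s_eq0|sN0] := eqVneq s 0.
  have m0 a : m a = 0.
    have /eqP := s_eq0; rewrite /s /dotk psumr_eq0 => [/allP/(_ a)|b _].
      by rewrite mem_index_enum => /(_ isT); rewrite mulf_eq0 orbb => /eqP.
    by rewrite -expr2 sqr_ge0.
  rewrite s_eq0 mulr0 /A big1// => a _; rewrite big1// => b _.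
  by rewrite m0 !mul0r.
have s_gt0 : 0 < s by rewrite lt_def sN0.
have [c_eq0|cN0] := eqVneq c 0; last first.
  have c_gt0 : 0 < c by rewrite lt_def cN0.
  (* The value t = c / s makes both terms on the right of [key] equal to c^2. *)
  have := key (c / s) (divr_ge0 c0 s0).
  have -> : (c / s) ^+ 2 * s ^+ 2 = c ^+ 2 by field.
  have -> : 2 * (c / s) * A = 2 * c * (A / s) by ring.
  move=> h; have {}h : A / s <= c.
    by rewrite -(ler_pM2l c_gt0); lra.
  by move: h; rewrite ler_pdivrMr.
rewrite c_eq0 mul0r leNgt; apply/negP => A0.
(* For c = 0 the bound reads 2 t A <= t^2 s^2, and t = A / s^2 contradicts A > 0. *)
have := key (A / s ^+ 2) (divr_ge0 (ltW A0) (sqr_ge0 s)).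
rewrite c_eq0 expr0n/= addr0.
have -> : 2 * (A / s ^+ 2) * A = 2 * (A ^+ 2 / s ^+ 2) by ring.
have -> : (A / s ^+ 2) ^+ 2 * s ^+ 2 = A ^+ 2 / s ^+ 2.
  by field.
have : 0 < A ^+ 2 / s ^+ 2 by rewrite divr_gt0// exprn_gt0.
lra.
Qed.

Lemma Ex_sqr_dotk_indep (I J : pred nat) Q Q' : (forall i, ~~ (I i && J i)) ->
  tensor I 2 Q -> tensor J 2 Q' ->
  Ex (fun w => dotk (Q ^~ w) (Q' ^~ w) ^+ 2) =
  \sum_a \sum_b gram Q a b * gram Q' a b.
Proof.
move=> IJ tQ tQ'.
have pQ a b : poly I 4 (fun w => Q a w * Q b w) by exact: polyM (tQ a) (tQ b).
have pQ' a b : poly J 4 (fun w => Q' a w * Q' b w) by exact: polyM (tQ' a) (tQ' b).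
have nn a b : nice (fun w => (Q a w * Q b w) * (Q' a w * Q' b w)).
  by apply: nice_mul; [apply: poly_weaken (pQ a b)|apply: poly_weaken (pQ' a b)].
transitivity (Ex (fun w => \sum_a \sum_b (Q a w * Q b w) * (Q' a w * Q' b w))).
  congr Ex; apply/funext => w; rewrite expr2 /dotk big_distrlr/=.
  by apply: eq_bigr => a _; apply: eq_bigr => b _; ring.
rewrite Ex_sum => [|a _]; last by apply: poly_sum.
apply: eq_bigr => a _; rewrite Ex_sum => //; apply: eq_bigr => b _.
by rewrite (Ex_indepM IJ _ (pQ a b) (pQ' a b)).
Qed.

Lemma Ex_sqr_dotk_le (I J : pred nat) Q Q' c : (forall i, ~~ (I i && J i)) ->
  tensor I 2 Q -> tensor J 2 Q' -> gram_norm2 Q <= c -> gram_norm2 Q' <= c ->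
  Ex (fun w => dotk (Q ^~ w) (Q' ^~ w) ^+ 2) <= c.
Proof.
move=> IJ tQ tQ' Qc Q'c; rewrite (Ex_sqr_dotk_indep IJ)//.
suff : 2 * (\sum_a \sum_b gram Q a b * gram Q' a b) <= gram_norm2 Q + gram_norm2 Q' by lra.
rewrite /gram_norm2 big_distrr/= -big_split/=; apply: ler_sum => a _.
rewrite big_distrr/= -big_split/=; apply: ler_sum => b _.
have := sqr_ge0 (gram Q a b - gram Q' a b); lra.
Qed.

End Gram.

(** The second-moment matrix of a tensor product of independent tensors is the Kronecker product of
    their second-moment matrices, and Frobenius norms of Kronecker products multiply. *)
Lemma gram_norm2_outer (K L : finType) (I J : pred nat) (u : K -> T -> R)
    (v : L -> T -> R) :
  (forall i, ~~ (I i && J i)) -> tensor I 2 u -> tensor J 2 v ->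
  gram_norm2 (fun (ab : K * L) w => u ab.1 w * v ab.2 w) =
  gram_norm2 u * gram_norm2 v.
Proof.
move=> IJ tu tv; set o := (X in gram_norm2 X).
have oE ab ab' : gram o ab ab' = gram u ab.1 ab'.1 * gram v ab.2 ab'.2.
  rewrite /gram -(Ex_indepM IJ _ (polyM (tu _) (tu _)) (polyM (tv _) (tv _)))//.
  by congr Ex; apply/funext => w; rewrite /o; ring.
rewrite /gram_norm2 big_distrlr/= [RHS]pair_bigA/=; apply: eq_bigr => -[a b] _ /=.
rewrite big_distrlr/= [RHS]pair_bigA/=; apply: eq_bigr => -[a' b'] _ /=.
by rewrite oE exprMn.
Qed.

End Expectation.

Local Close Scope classical_set_scope.

(** * U-statistics over quadruples of indices *)

Section Quadruples.
Variables (N : nat) (r : 'I_4 -> {set 'I_N}).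
Local Notation quad := {ffun 'I_4 -> 'I_N}.

Definition quads : {set quad} :=
  [set q : quad | [forall s, q s \in r s] & injectiveb q].

Lemma card_box (A : 'I_4 -> {set 'I_N}) :
  #|[set q : quad | [forall s, q s \in A s]]| = (\prod_s #|A s|)%N.
Proof.
have -> : [set q : quad | [forall s, q s \in A s]] =
    [set q : quad in family (fun u => mem (A u))].
  by apply: eq_finset => q; apply/forallP/familyP => H u; exact: H.
by rewrite cardsE card_family foldrE big_image.
Qed.

(** Prescribing one slot replaces the factor [#|r s|] by 1; the inequality is multiplied out so as
    to avoid division in [nat]. *)
Lemma card_quads1 s x :
  (#|[set q : quad | [forall s, q s \in r s] & q s == x]| * #|r s|
     <= \prod_s #|r s|)%N.
Proof.
pose r' u := if u == s then [set x]%SET else r u.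
have sub : [set q : quad | [forall s, q s \in r s] & q s == x] \subset
    [set q : quad | [forall s, q s \in r' s]].
  apply/fintype.subsetP => q; rewrite !inE => /andP[/forallP rq /eqP qs].
  apply/forallP => u; rewrite /r'; case: eqP => [->|_]; last exact: rq.
  by rewrite !inE qs eqxx.
have := subset_leq_card sub; rewrite card_box (bigD1 s)//= => h.
rewrite [leqRHS](bigD1 s)//= mulnC; apply: leq_mul => //.
apply: (leq_trans h); rewrite /r' eqxx cards1 mul1n.
by apply: leq_prod => u us; rewrite (negbTE us).
Qed.

Lemma card_quads2 s t x y : s != t ->
  (#|[set q : quad | [forall s, q s \in r s] & (q s == x) && (q t == y)]|
     * (#|r s| * #|r t|) <= \prod_s #|r s|)%N.
Proof.
move=> st.
pose r' u := if u == s then [set x]%SET else if u == t then [set y]%SET else r u.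
have sub : [set q : quad | [forall s, q s \in r s] & (q s == x) && (q t == y)]
   \subset [set q : quad | [forall s, q s \in r' s]].
  apply/fintype.subsetP => q; rewrite !inE => /and3P[/forallP rq /eqP qs /eqP qt].
  apply/forallP => u; rewrite /r'; case: eqP => [->|_]; first by rewrite !inE qs eqxx.
  case: eqP => [->|_]; last exact: rq.
  by rewrite !inE qt eqxx.
have := subset_leq_card sub; rewrite card_box (bigD1 s)//= (bigD1 t) 1?eq_sym//= => h.
rewrite [leqRHS](bigD1 s)//= [X in (_ <= _ * X)%N](bigD1 t) 1?eq_sym//= mulnC -mulnA.
apply: leq_mul => //; apply: leq_mul => //.
apply: (leq_trans h); rewrite /r' eqxx cards1 mul1n eq_sym (negbTE st) eqxx cards1 mul1n.
by apply: leq_prod => u /andP[us ut]; rewrite (negbTE us) (negbTE ut).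
Qed.

Lemma card_quads_le : (#|quads| <= \prod_s #|r s|)%N.
Proof.
rewrite -card_box; apply: subset_leq_card; apply/fintype.subsetP => q.
by rewrite !inE => /andP[].
Qed.

(** Here (u, v) are the slots of a noisy pair of [q]; when this fails, that pair is independent of
    everything built on [q']. *)
Definition meets (q q' : quad) (u v : 'I_4) : bool :=
  [exists s, (q' s == q u) || (q' s == q v)].

Variable m : nat.
Hypothesis rm : forall s, (m <= #|r s|)%N.

(** The factor 8 counts four slots of [q'] times the two values [q u] and [q v]. *)
Lemma card_meets q u v :
  (#|[set q' in quads | meets q q' u v]| * m <= 8 * \prod_s #|r s|)%N.
Proof.
apply: (@leq_trans ((\sum_(s : 'I_4) \sum_(x <- [:: q u; q v])
  #|[set q' : quad | [forall s, q' s \in r s] & q' s == x]|) * m)).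
  rewrite leq_mul2r; apply/orP; right.
  under eq_bigr => s _ do under eq_bigr => x _ do rewrite -sum1_card big_mkcond.
  under eq_bigr => s _ do rewrite exchange_big.
  rewrite exchange_big -sum1_card big_mkcond; apply: leq_sum => q' _.
  case: ifPn => //; rewrite !inE => /andP[/andP[rq' _] /existsP[s qs]].
  rewrite (bigD1 s)//= !big_cons big_nil !inE rq'/=.
  by case/orP: qs => ->; rewrite /=; lia.
rewrite big_distrl/=; apply: (@leq_trans (\sum_(s : 'I_4) 2 * \prod_s #|r s|)%N).
  apply: leq_sum => s _; rewrite !big_cons big_nil.
  have h x : (#|[set q' : quad | [forall s, q' s \in r s] & q' s == x]| * m
      <= \prod_s #|r s|)%N.
    by apply: leq_trans (card_quads1 s x); apply: leq_mul.
  by rewrite addn0 mulnDl mul2n -addnn leq_add.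
by rewrite sum_nat_const card_ord mulnA.
Qed.

(** The two pairs of [q] share no index, so a quadruple meeting both does so in two different slots,
    which saves a factor [m ^ 2] instead of [m]. The 64 bounds the ordered pairs of slots (16) times
    the pairs of values (4). *)
Lemma card_meets2 (q : quad) u v u' v' :
  q u != q u' -> q u != q v' -> q v != q u' -> q v != q v' ->
  (#|[set q' in quads | meets q q' u v && meets q q' u' v']| * m ^ 2
    <= 64 * \prod_s #|r s|)%N.
Proof.
move=> n1 n2 n3 n4.
apply: (@leq_trans ((\sum_(st : 'I_4 * 'I_4 | st.1 != st.2)
  \sum_(xy <- [:: (q u, q u'); (q u, q v'); (q v, q u'); (q v, q v')])
  #|[set q' : quad | [forall s, q' s \in r s] &
      (q' st.1 == xy.1) && (q' st.2 == xy.2)]|) * m ^ 2)).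
  rewrite leq_mul2r; apply/orP; right.
  under eq_bigr => s _ do under eq_bigr => x _ do rewrite -sum1_card big_mkcond.
  under eq_bigr => s _ do rewrite exchange_big.
  rewrite exchange_big -sum1_card big_mkcond; apply: leq_sum => q' _.
  case: ifPn => //; rewrite !inE => /andP[/andP[rq' _]].
  move=> /andP[/existsP[s qs] /existsP[t qt]].
  have st : s != t.
    apply/eqP => st; move: qs qt; rewrite st.
    by case/orP => /eqP ->; rewrite ?(negbTE n1) ?(negbTE n2) ?(negbTE n3) ?(negbTE n4).
  rewrite (bigD1 (s, t))//= !big_cons big_nil !inE rq'/=.
  by case/orP: qs => ->; case/orP: qt => ->; rewrite /=; lia.
rewrite big_distrl/=.
apply: (@leq_trans (\sum_(st : 'I_4 * 'I_4) 4 * \prod_s #|r s|)%N).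
  rewrite big_mkcond; apply: leq_sum => -[s t] _ /=; case: ifPn => // st.
  rewrite !big_cons big_nil/=.
  have h x y : (#|[set q' : quad | [forall s, q' s \in r s] &
      (q' s == x) && (q' t == y)]| * m ^ 2 <= \prod_s #|r s|)%N.
    apply: leq_trans (card_quads2 x y st); apply: leq_mul => //.
    by rewrite -mulnn; apply: leq_mul.
  have four x : (4 * x = x + (x + (x + x)))%N by lia.
  by rewrite addn0 !mulnDl four !leq_add.
by rewrite sum_nat_const card_prod card_ord mulnA.
Qed.

(* Each coincidence q s = q t costs at most a fraction 1 / m of all quadruples,
   whence the threshold on m. *)
Lemma card_quads_ge : (32 <= m)%N -> (\prod_s #|r s| <= 2 * #|quads|)%N.
Proof.
move=> m32; set M := (\prod_s _)%N.
pose all_q := [set q : quad | [forall s, q s \in r s]].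
have cardA : #|all_q| = M by exact: card_box.
pose bad := [set q in all_q | ~~ injectiveb q].
have cardB : (#|all_q| = #|quads| + #|bad|)%N.
  rewrite -(cardsID [set q : quad | injectiveb q] all_q); congr (_ + _)%N.
    by apply: eq_card => q; rewrite !inE.
  by apply: eq_card => q; rewrite !inE andbC.
have pairM (s t : 'I_4) : s != t ->
    (#|[set q : quad | [forall s, q s \in r s] & q s == q t]| * m <= M)%N.
  move=> st; apply: (@leq_trans
    (#|[set q : quad | [forall s, q s \in r s] & q s == q t]| * #|r t|)).
    exact: leq_mul.
  suff : (#|[set q : quad | [forall s, q s \in r s] & q s == q t]| *
      (#|r s| * #|r t|) <= #|r s| * M)%N.
    rewrite [X in (X <= _)%N]mulnCA leq_pmul2l//.
    by apply: leq_trans (rm s); lia.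
  (* Splitting over the common value x of the two slots reduces to quadruples with two prescribed
     slots. *)
  apply: (@leq_trans ((\sum_(x in r s) #|[set q : quad | [forall s, q s \in r s] &
      (q s == x) && (q t == x)]|) * (#|r s| * #|r t|))%N).
    rewrite leq_mul2r; apply/orP; right.
    under eq_bigr => s' _ do rewrite -sum1_card big_mkcond.
    rewrite exchange_big -sum1_card big_mkcond; apply: leq_sum => q _.
    case: ifPn => //; rewrite !inE => /andP[rq qst].
    rewrite (bigD1 (q s))/=; last exact: (forallP rq).
    by rewrite inE rq eqxx eq_sym qst.
  rewrite big_distrl/= -[leqRHS]sum_nat_const; apply: leq_sum => x _.
  exact: card_quads2.
have badm : (#|bad| * m <= 16 * M)%N.
  apply: (@leq_trans ((\sum_(st : 'I_4 * 'I_4 | st.1 != st.2)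
     #|[set q : quad | [forall s, q s \in r s] & q st.1 == q st.2]|) * m)%N).
    rewrite leq_mul2r; apply/orP; right.
    under eq_bigr => s _ do rewrite -sum1_card big_mkcond.
    rewrite exchange_big -sum1_card big_mkcond; apply: leq_sum => q _.
    case: ifPn => //; rewrite !inE => /andP[rq /injectivePn[s [t st qst]]].
    by rewrite (bigD1 (s, t))//= inE rq qst eqxx.
  rewrite big_distrl/=; apply: (@leq_trans (\sum_(st : 'I_4 * 'I_4) M)%N).
    by rewrite big_mkcond; apply: leq_sum => -[s t] _ /=; case: ifPn => // /pairM.
  by rewrite sum_nat_const card_prod card_ord.
by nia.
Qed.
End Quadruples.

Section UStatistics.
Context d (T : measurableType d) (R : realType) (P : probability T R)
  (n p : nat) (X : nat -> 'I_p -> {RV P >-> R}).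
Hypothesis indX : independent_vectors n X.
Hypothesis X8 : moments8 P n X.
Local Notation poly := (poly n X).
Local Notation nice := (poly xpredT 8).
Local Notation tensor := (tensor n X).
Local Notation Ex := (Ex P).
Local Notation gram_norm2 := (gram_norm2 P).

(** Variance by counting: in the expanded square, pairs outside [ov] vanish and every other pair is
    at most [B] by 2 x y <= x^2 + y^2; [cnt] bounds the number of surviving partners of each
    term. *)
Lemma Ex_sqr_sum (J : finType) (F : {set J}) (h : J -> T -> R) (ov : rel J)
    (B cnt : R) :
  (forall q, q \in F -> poly xpredT 4 (h q)) ->
  (forall q, q \in F -> Ex (fun w => h q w ^+ 2) <= B) ->
  (forall q q', q \in F -> q' \in F -> ~~ ov q q' ->
    Ex (fun w => h q w * h q' w) = 0) ->
  (forall q, q \in F -> #|[set q' in F | ov q q']|%:R <= cnt) ->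
  Ex (fun w => (\sum_(q in F) h q w) ^+ 2) <= B * (#|F|%:R * cnt).
Proof.
move=> ph hB h0 hc.
have nhh q q' : q \in F -> q' \in F -> nice (fun w => h q w * h q' w).
  by move=> qF q'F; exact: polyM (ph _ qF) (ph _ q'F).
have -> : (fun w => (\sum_(q in F) h q w) ^+ 2) =
    fun w => \sum_(q in F) \sum_(q' in F) h q w * h q' w.
  by apply/funext => w; rewrite expr2 big_distrlr.
rewrite (Ex_sum X8) => [|q qF]; last by apply: poly_sum => q' q'F; exact: nhh.
have [->|/set0Pn[q0 q0F]] := eqVneq F finset.set0.
  by rewrite big_set0 cards0 mul0r mulr0.
have B0 : 0 <= B.
  by apply: le_trans (hB _ q0F); apply: Ex_ge0 => w; exact: sqr_ge0.
rewrite mulrCA mulr_natl -sumr_const; apply: ler_sum => q qF.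
rewrite (Ex_sum X8) => [|q' q'F]; last exact: nhh.
apply: (@le_trans _ _ (\sum_(q' in F) (ov q q')%:R * B)).
  apply: ler_sum => q' q'F; have [qq'|nqq'] := boolP (ov q q'); last first.
    by rewrite h0// mul0r.
  rewrite mul1r.
  have n1 q1 : q1 \in F -> nice (fun w => h q1 w ^+ 2).
    by move=> q1F; exact: poly_sqrw (ph _ q1F).
  have nh : nice (fun w => 2^-1 * (h q w ^+ 2 + h q' w ^+ 2)).
    by apply: polyZ; apply: polyD; exact: n1.
  apply: (@le_trans _ _ (Ex (fun w => 2^-1 * (h q w ^+ 2 + h q' w ^+ 2)))).
    apply: (Ex_le X8) => //; first exact: nhh.
    by move=> w; have := sqr_ge0 (h q w - h q' w); lra.
  rewrite (ExZ X8) ?(ExD X8)//; [|exact: n1|exact: n1|apply: polyD; exact: n1].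
  by have := hB _ qF; have := hB _ q'F; lra.
rewrite -mulr_suml mulrC ler_wpM2l//; apply: le_trans (hc _ qF).
rewrite -sum1_card natr_sum big_mkcond [leRHS]big_mkcond/=.
apply: ler_sum => q' _; rewrite !inE; case: (q' \in F) => //=.
by case: (ov q q').
Qed.

Variables (K : finType) (Q : nat -> nat -> K -> T -> R) (M : nat -> nat -> K -> R).
Variables (c B : R).
Local Notation in_range i := (1 <= i <= n)%N.
Hypothesis tQ : forall i j, in_range i -> in_range j -> i != j ->
  tensor (pred2 i j) 2 (Q i j).
Hypothesis Q0 : forall i j a, in_range i -> in_range j -> i != j -> Ex (Q i j a) = 0.
Hypotheses (c0 : 0 <= c) (B0 : 0 <= B).
Hypothesis Qc : forall i j, in_range i -> in_range j -> i != j ->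
  gram_norm2 (Q i j) <= c ^+ 2.
Hypothesis MB : forall i j, in_range i -> in_range j -> dotk (M i j) (M i j) <= B.

Variables (r : 'I_4 -> {set 'I_n.+1}) (m : nat).
Hypothesis r1 : forall s i, i \in r s -> (1 <= i)%N.
Hypothesis m0 : (0 < m <= n)%N.
Hypothesis rm : forall s, (m <= #|r s|)%N.

Let i0 : 'I_4 := inord 0.
Let i1 : 'I_4 := inord 1.
Let i2 : 'I_4 := inord 2.
Let i3 : 'I_4 := inord 3.

(** The common kernel of both statistics: slots 0, 1 carry one pair of observations and slots 2, 3
    the other. *)
Definition pairing (u v : nat -> nat -> K -> R) (q : {ffun 'I_4 -> 'I_n.+1}) : R :=
  dotk (u (q i0) (q i1)) (v (q i2) (q i3)).

(** Expanding <Q + M, Q + M> - <M, M> leaves these three noise terms, one quadratic and two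
    linear. *)
Let hQQ q w := pairing (fun i j a => Q i j a w) (fun i j a => Q i j a w) q.
Let hMQ q w := pairing M (fun i j a => Q i j a w) q.
Let hQM q w := pairing (fun i j a => Q i j a w) M q.

Let q_range (q : {ffun 'I_4 -> 'I_n.+1}) s : q \in quads r -> in_range (q s).
Proof.
rewrite inE => /andP[/forallP rq _]; rewrite (r1 (rq s))/=.
by have := ltn_ord (q s).
Qed.

Let q_neq (q : {ffun 'I_4 -> 'I_n.+1}) s t : q \in quads r -> s != t ->
  (q s : nat) != q t.
Proof.
rewrite inE => /andP[_ /injectiveP iq] st.
by apply: contra st => /eqP /val_inj /iq ->.
Qed.

Let ineq : [/\ i0 != i1, i0 != i2, i0 != i3, i1 != i2 & i1 != i3] /\ i2 != i3.
Proof. by rewrite /i0 /i1 /i2 /i3 -!val_eqE /= !inordK. Qed.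

Let weak_tensor i j : in_range i -> in_range j -> i != j ->
  forall J : pred nat, J i -> J j -> tensor J 2 (Q i j).
Proof.
move=> ri rj ij J Ji Jj a; apply: poly_weaken (tQ ri rj ij a) => //.
by move=> x /orP[] /eqP ->.
Qed.

Let nmeets (q q' : {ffun 'I_4 -> 'I_n.+1}) (u v s : 'I_4) : ~~ meets q q' u v ->
  predC (pred2 (q u : nat) (q v : nat)) (q' s).
Proof. by rewrite negb_exists => /forallP/(_ s). Qed.

Local Ltac quad_side := first [exact: q_range|exact: q_neq|exact: nmeets|by []].

Let tQ01 q : q \in quads r -> tensor (pred2 (q i0 : nat) (q i1 : nat)) 2 (Q (q i0) (q i1)).
Proof.
have [[n01 _ _ _ _] _] := ineq.
by move=> qr; apply: tQ; quad_side.
Qed.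

Let tQ23 q : q \in quads r -> tensor (pred2 (q i2 : nat) (q i3 : nat)) 2 (Q (q i2) (q i3)).
Proof.
have [_ n23] := ineq.
by move=> qr; apply: tQ; quad_side.
Qed.

Let poly_dotk (I : pred nat) k k' (u v : K -> T -> R) : tensor I k u -> tensor I k' v ->
  poly I (k + k') (fun w => dotk (u ^~ w) (v ^~ w)).
Proof. by move=> tu tv; apply: poly_sum => a _; exact: polyM (tu a) (tv a). Qed.

Let poly_dotk_cst (I : pred nat) k (u : K -> R) (v : K -> T -> R) : tensor I k v ->
  poly I k (fun w => dotk u (v ^~ w)).
Proof. by move=> tv; apply: poly_sum => a _; exact: polyZ (tv a). Qed.

Let dotkC (u v : K -> R) : dotk u v = dotk v u.
Proof. by apply: eq_bigr => a _; rewrite mulrC. Qed.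

(* E <u, v> g = 0 when the centred tensor u is independent of (v, g). *)
Let Ex_dotk0 (I : pred nat) k (u v : K -> T -> R) g :
  tensor I 2 u -> (forall a, Ex (u a) = 0) -> tensor (predC I) k v ->
  (2 + k <= 4)%N -> poly (predC I) 4 g ->
  Ex (fun w => dotk (u ^~ w) (v ^~ w) * g w) = 0.
Proof.
move=> tu u0 tv k2 pg.
have IC i : ~~ (I i && predC I i) by rewrite /= andbN.
have pvg a : poly (predC I) (k + 4) (fun w => v a w * g w) by exact: polyM.
have nn a : nice (fun w => u a w * (v a w * g w)).
  apply: (@poly_weaken _ _ _ _ n p X xpredT _ (2 + (k + 4))) => //; first by lia.
  by apply: polyM; [apply: poly_weaken (tu a)|apply: poly_weaken (pvg a)].
transitivity (Ex (fun w => \sum_a u a w * (v a w * g w))).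
  congr (Ex _); apply/funext => w; rewrite /dotk mulr_suml.
  by apply: eq_bigr => a _; rewrite mulrA.
rewrite (Ex_sum X8)// big1// => a _.
by rewrite (Ex_indepM indX X8 IC _ (tu a) (pvg a)) ?u0 ?mul0r//; lia.
Qed.

Let pT k f I : poly I k f -> (k <= 4)%N -> poly xpredT 4 f.
Proof. by move=> pf k4; apply: poly_weaken pf. Qed.

Let pQQ q : q \in quads r -> poly xpredT 4 (hQQ q).
Proof.
move=> qr; apply: (@poly_dotk xpredT 2 2) => a.
  by apply: poly_weaken (tQ01 qr a).
by apply: poly_weaken (tQ23 qr a).
Qed.

Let qq_disjoint q : q \in quads r ->
  predC (pred2 (q i0 : nat) (q i1 : nat)) (q i2) /\
  predC (pred2 (q i0 : nat) (q i1 : nat)) (q i3).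
Proof.
move=> qr; have [[n01 n02 n03 n12 n13] n23] := ineq; rewrite /= !negb_or.
by split; apply/andP; split; apply: q_neq; rewrite // eq_sym.
Qed.

Let qq_disjoint' q : q \in quads r ->
  predC (pred2 (q i2 : nat) (q i3 : nat)) (q i0) /\
  predC (pred2 (q i2 : nat) (q i3 : nat)) (q i1).
Proof.
move=> qr; have [[n01 n02 n03 n12 n13] n23] := ineq; rewrite /= !negb_or.
by split; apply/andP; split; apply: q_neq; rewrite // eq_sym.
Qed.

Let pQQ_off (q q' : {ffun 'I_4 -> 'I_n.+1}) (u v : 'I_4) : q' \in quads r -> ~~ meets q q' u v ->
  poly (predC (pred2 (q u : nat) (q v : nat))) 4 (hQQ q').
Proof.
have [[n01 _ _ _ _] n23] := ineq.
move=> q'r nm; apply: (@poly_dotk _ 2 2).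
  by apply: weak_tensor; quad_side.
by apply: weak_tensor; quad_side.
Qed.

Let prodr : R := (\prod_s #|r s|)%N%:R.

Let cardr : #|quads r|%:R <= prodr.
Proof. by rewrite ler_nat; exact: card_quads_le. Qed.

Let mR : 0 < m%:R :> R. Proof. by rewrite ltr0n; case/andP: m0. Qed.

(** If [q'] misses one of the two pairs of [q], that centred pair is independent of the other pair
    and of all of [q']. A surviving term must therefore meet both pairs, which is the situation
    counted by [card_meets2]. *)
Let Ex_QQ0 q q' : q \in quads r -> q' \in quads r ->
  ~~ (meets q q' i0 i1 && meets q q' i2 i3) ->
  Ex (fun w => hQQ q w * hQQ q' w) = 0.
Proof.
move=> qr q'r; have [[n01 _ _ _ _] n23] := ineq.
have [d2 d3] := qq_disjoint qr; have [d0 d1] := qq_disjoint' qr.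
rewrite negb_and => /orP[nm|nm].
- apply: (@Ex_dotk0 (pred2 (q i0 : nat) (q i1 : nat)) 2) => //.
  + exact: tQ01.
  + by move=> a; apply: Q0; quad_side.
  + by apply: weak_tensor; quad_side.
  + exact: pQQ_off.
- rewrite /hQQ /pairing; under [X in Ex X]eq_fun do rewrite [X in X * _]dotkC.
  apply: (@Ex_dotk0 (pred2 (q i2 : nat) (q i3 : nat)) 2) => //.
  + exact: tQ23.
  + by move=> a; apply: Q0; quad_side.
  + by apply: weak_tensor; quad_side.
  + exact: pQQ_off.
Qed.

Let Ex_sum_QQ : Ex (fun w => (\sum_(q in quads r) hQQ q w) ^+ 2) <=
  64 * c ^+ 2 * (prodr / m%:R) ^+ 2.
Proof.
have [[n01 n02 n03 n12 n13] n23] := ineq.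
apply: (@le_trans _ _ (c ^+ 2 * (#|quads r|%:R * (64 * prodr / m%:R ^+ 2)))).
  apply: (@Ex_sqr_sum _ _ _ (fun q q' => meets q q' i0 i1 && meets q q' i2 i3)) => //.
  - move=> q qr; have [d2 d3] := qq_disjoint qr.
    apply: (@Ex_sqr_dotk_le _ _ _ _ _ _ _ indX X8 _ (pred2 (q i0 : nat) (q i1 : nat))
      (predC (pred2 (q i0 : nat) (q i1 : nat)))).
    + by move=> i; rewrite /= andbN.
    + exact: tQ01.
    + by apply: weak_tensor; quad_side.
    + by apply: Qc; quad_side.
    + by apply: Qc; quad_side.
  - move=> q qr; rewrite ler_pdivlMr ?exprn_gt0//.
    have := @card_meets2 _ r m rm q i0 i1 i2 i3.
    rewrite -!(inj_eq val_inj) !q_neq// => /(_ isT isT isT isT).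
    by rewrite -(ler_nat R) !natrM expr2.
have -> : c ^+ 2 * (#|quads r|%:R * (64 * prodr / m%:R ^+ 2)) =
  (64 * c ^+ 2 * (prodr / m%:R ^+ 2)) * #|quads r|%:R by field; rewrite gt_eqF.
have -> : 64 * c ^+ 2 * (prodr / m%:R) ^+ 2 = (64 * c ^+ 2 * (prodr / m%:R ^+ 2)) * prodr
  by field; rewrite gt_eqF.
by rewrite ler_wpM2l// !mulr_ge0// ?sqr_ge0// ?ler0n// invr_ge0.
Qed.

Let dotk_center0 (I : pred nat) (u : K -> R) (v : K -> T -> R) g :
  tensor I 2 v -> (forall a, Ex (v a) = 0) -> poly (predC I) 2 g ->
  Ex (fun w => dotk u (v ^~ w) * g w) = 0.
Proof.
move=> tv v0 pg; under [X in Ex X]eq_fun do rewrite dotkC.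
apply: (@Ex_dotk0 I 0 v (fun a w => u a)) => //.
  by move=> a; exact: poly_cst.
by apply: poly_weaken pg.
Qed.

Let Ex_MQ0 q q' : q \in quads r -> q' \in quads r ->
  ~~ meets q q' i2 i3 -> Ex (fun w => hMQ q w * hMQ q' w) = 0.
Proof.
move=> qr q'r nm; have [[n01 _ _ _ _] n23] := ineq.
apply: (@dotk_center0 (pred2 (q i2 : nat) (q i3 : nat))).
- exact: tQ23.
- by move=> a; apply: Q0; quad_side.
- apply: poly_dotk_cst.
  by apply: weak_tensor; quad_side.
Qed.

Let Ex_QM0 q q' : q \in quads r -> q' \in quads r ->
  ~~ meets q q' i0 i1 -> Ex (fun w => hQM q w * hQM q' w) = 0.
Proof.
move=> qr q'r nm; have [[n01 _ _ _ _] n23] := ineq.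
rewrite /hQM /pairing.
under [X in Ex X]eq_fun do rewrite [X in X * _]dotkC [X in _ * X]dotkC.
apply: (@dotk_center0 (pred2 (q i0 : nat) (q i1 : nat))).
- exact: tQ01.
- by move=> a; apply: Q0; quad_side.
- apply: poly_dotk_cst.
  by apply: weak_tensor; quad_side.
Qed.

Let pMQ q : q \in quads r -> poly xpredT 2 (hMQ q).
Proof.
by move=> qr; apply: poly_dotk_cst => a; apply: poly_weaken (tQ23 qr a).
Qed.

Let pQM q : q \in quads r -> poly xpredT 2 (hQM q).
Proof.
move=> qr; rewrite (_ : hQM q = fun w => dotk (M (q i2) (q i3)) (Q (q i0) (q i1) ^~ w)).
  2: by apply/funext => w; exact: dotkC.
by apply: poly_dotk_cst => a; apply: poly_weaken (tQ01 qr a).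
Qed.

(** A linear term has only one noisy pair, so a single coincidence lets a product survive and only
    one factor [m] is gained. *)
Let linear_bound (h : {ffun 'I_4 -> 'I_n.+1} -> T -> R) u v :
  (forall q, q \in quads r -> poly xpredT 2 (h q)) ->
  (forall q, q \in quads r -> Ex (fun w => h q w ^+ 2) <= c * B) ->
  (forall q q', q \in quads r -> q' \in quads r -> ~~ meets q q' u v ->
    Ex (fun w => h q w * h q' w) = 0) ->
  Ex (fun w => (\sum_(q in quads r) h q w) ^+ 2) <= 8 * (c * B) * (prodr ^+ 2 / m%:R).
Proof.
move=> ph hB h0.
apply: (@le_trans _ _ (c * B * (#|quads r|%:R * (8 * prodr / m%:R)))).
  apply: (@Ex_sqr_sum _ _ _ (fun q q' => meets q q' u v)) => //.
  - by move=> q qr; apply: poly_weaken (ph q qr).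
  - move=> q qr; rewrite ler_pdivlMr//.
    by have := @card_meets _ r m rm q u v; rewrite -(ler_nat R) !natrM.
have -> : c * B * (#|quads r|%:R * (8 * prodr / m%:R)) =
  (8 * (c * B) * (prodr / m%:R)) * #|quads r|%:R by field; rewrite gt_eqF.
have -> : 8 * (c * B) * (prodr ^+ 2 / m%:R) = (8 * (c * B) * (prodr / m%:R)) * prodr
  by field; rewrite gt_eqF.
by rewrite ler_wpM2l// !mulr_ge0// ?ler0n// invr_ge0.
Qed.

(** [e] is a weighted normalisation, and the second hypothesis says that the total mass of the
    quadruples is at most [a * m]. The quadratic noise then costs (a m)^2 c^2 / m^2 and the linear
    noise (a m)^2 c B / m with m <= n. The constant is 192 = 3 * 64, the 3 coming from the square of
    a sum of three terms. *)
Lemma Ex_sqr_pairing (e a : R) : 0 <= e -> e * prodr <= a * m%:R ->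
  Ex (fun w => (e * \sum_(q in quads r)
     (pairing (fun i j k => Q i j k w + M i j k) (fun i j k => Q i j k w + M i j k) q
      - pairing M M q)) ^+ 2) <= 192 * a ^+ 2 * (c ^+ 2 + n%:R * (c * B)).
Proof.
move=> e0 ea.
have a0 : 0 <= a by rewrite -(pmulr_lge0 _ mR); apply: le_trans ea; rewrite mulr_ge0// ler0n.
pose SQQ w := \sum_(q in quads r) hQQ q w.
pose SMQ w := \sum_(q in quads r) hMQ q w.
pose SQM w := \sum_(q in quads r) hQM q w.
have n2 I k f : poly I k f -> (k <= 4)%N -> nice (fun w => f w ^+ 2).
  by move=> pf k4; apply: (@poly_sqrw _ _ _ _ _ _ _ _ 4); exact: poly_weaken pf.
have pSQQ : poly xpredT 4 SQQ by apply: poly_sum => q; exact: pQQ.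
have pSMQ : poly xpredT 2 SMQ by apply: poly_sum => q; exact: pMQ.
have pSQM : poly xpredT 2 SQM by apply: poly_sum => q; exact: pQM.
have -> : (fun w => (e * \sum_(q in quads r)
     (pairing (fun i j k => Q i j k w + M i j k) (fun i j k => Q i j k w + M i j k) q
      - pairing M M q)) ^+ 2) = (fun w => (e * (SQQ w + SMQ w + SQM w)) ^+ 2).
  apply/funext => w; congr ((_ * _) ^+ 2); rewrite /SQQ /SMQ /SQM -!big_split/=.
  apply: eq_bigr => q _; rewrite /hQQ /hMQ /hQM /pairing /dotk -!big_split/= -sumrB.
  by apply: eq_bigr => k _; ring.
have e20 : 0 <= e ^+ 2 by exact: sqr_ge0.
have nSQQ := n2 _ _ _ pSQQ isT.
have nSMQ := n2 _ _ _ pSMQ isT.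
have nSQM := n2 _ _ _ pSQM isT.
apply: (@le_trans _ _ (Ex (fun w => 3 * e ^+ 2 * (SQQ w ^+ 2 + SMQ w ^+ 2 + SQM w ^+ 2)))).
  apply: (Ex_le X8).
  - apply: (n2 xpredT 4) => //; apply: polyZ; apply: polyD.
      by apply: polyD => //; exact: poly_weaken pSMQ.
    exact: poly_weaken pSQM.
  - by apply: polyZ; apply: polyD => //; exact: polyD.
  - move=> w; set x := SQQ w; set y := SMQ w; set z := SQM w.
    have -> : 3 * e ^+ 2 * (x ^+ 2 + y ^+ 2 + z ^+ 2) =
      e ^+ 2 * (3 * (x ^+ 2 + y ^+ 2 + z ^+ 2)) by ring.
    rewrite exprMn; apply: ler_wpM2l => //.
    have := sqr_ge0 (x - y); have := sqr_ge0 (x - z).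
    by have := sqr_ge0 (y - z); lra.
rewrite (ExZ X8); last by apply: polyD => //; exact: polyD.
rewrite (ExD X8)//; last exact: polyD.
rewrite (ExD X8)//.
have BQQ : Ex (fun w => SQQ w ^+ 2) <= _ := Ex_sum_QQ.
have [[n01 n02 n03 n12 n13] n23] := ineq.
have BMQ : Ex (fun w => SMQ w ^+ 2) <= 8 * (c * B) * (prodr ^+ 2 / m%:R).
  apply: (@linear_bound hMQ i2 i3) => //.
    move=> q qr; apply: le_trans (_ : c * dotk (M (q i0) (q i1)) (M (q i0) (q i1)) <= _).
      apply: (Ex_sqr_dotk_cst X8) => //.
        by move=> k; apply: poly_weaken (tQ23 qr k).
      by apply: Qc; quad_side.
    by rewrite ler_wpM2l// MB//; exact: q_range.
have BQM : Ex (fun w => SQM w ^+ 2) <= 8 * (c * B) * (prodr ^+ 2 / m%:R).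
  apply: (@linear_bound hQM i0 i1) => //.
    move=> q qr; rewrite /hQM /pairing; under [X in Ex X]eq_fun do rewrite dotkC.
    apply: le_trans (_ : c * dotk (M (q i2) (q i3)) (M (q i2) (q i3)) <= _).
      apply: (Ex_sqr_dotk_cst X8) => //.
        by move=> k; apply: poly_weaken (tQ01 qr k).
      by apply: Qc; quad_side.
    by rewrite ler_wpM2l// MB//; exact: q_range.
set x := prodr / m%:R.
have ex : e * x <= a by rewrite /x mulrA ler_pdivrMr.
have x0 : 0 <= x by rewrite divr_ge0 ?ler0n.
have ex2 : (e * x) ^+ 2 <= a ^+ 2 by rewrite lerXn2r ?nnegrE// mulr_ge0.
have xm : prodr ^+ 2 / m%:R = x ^+ 2 * m%:R by rewrite /x; field; rewrite gt_eqF.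
have mn : m%:R <= n%:R :> R by rewrite ler_nat; case/andP: m0.
have cB0 : 0 <= c * B by exact: mulr_ge0.
apply: (@le_trans _ _ (3 * e ^+ 2 * (64 * c ^+ 2 * x ^+ 2 + 8 * (c * B) * (x ^+ 2 * m%:R)
    + 8 * (c * B) * (x ^+ 2 * m%:R)))).
  rewrite ler_wpM2l//; first by rewrite mulr_ge0.
  by rewrite -xm !lerD.
have -> : 3 * e ^+ 2 * (64 * c ^+ 2 * x ^+ 2 + 8 * (c * B) * (x ^+ 2 * m%:R)
    + 8 * (c * B) * (x ^+ 2 * m%:R)) =
  (e * x) ^+ 2 * (192 * c ^+ 2 + 48 * ((c * B) * m%:R)) by ring.
apply: (@le_trans _ _ (a ^+ 2 * (192 * c ^+ 2 + 48 * ((c * B) * m%:R)))).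
  by rewrite ler_wpM2r// addr_ge0// ?mulr_ge0// ?sqr_ge0// ler0n.
have -> : 192 * a ^+ 2 * (c ^+ 2 + n%:R * (c * B)) =
  a ^+ 2 * (192 * (c ^+ 2 + n%:R * (c * B))) by ring.
apply: ler_wpM2l; first exact: sqr_ge0.
have : c * B * m%:R <= c * B * n%:R by rewrite ler_wpM2l.
have : 0 <= c * B * m%:R by rewrite mulr_ge0// ler0n.
lra.
Qed.

End UStatistics.

(** * The statistics as sums over quadruples *)

Section QuadSums.
Variables (R : realType) (N : nat).
Local Notation I := 'I_N.
Local Notation quad := {ffun 'I_4 -> I}.
Local Notation i0 := (inord 0 : 'I_4).
Local Notation i1 := (inord 1 : 'I_4).
Local Notation i2 := (inord 2 : 'I_4).
Local Notation i3 := (inord 3 : 'I_4).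

Definition ranges (A B C D : {set I}) (s : 'I_4) : {set I} := nth A [:: A; B; C; D] s.

Lemma enum_ord4 : enum 'I_4 = [:: i0; i1; i2; i3].
Proof. by apply: (inj_map val_inj); rewrite val_enum_ord /= !inordK. Qed.

Lemma mem_quads A B C D (q : quad) : (q \in quads (ranges A B C D)) =
  [&& q i0 \in A, q i1 \in B, q i2 \in C, q i3 \in D
    & uniq [:: q i0; q i1; q i2; q i3]].
Proof.
rewrite inE /injectiveb /dinjectiveb enum_ord4 /=.
have -> : [forall s, q s \in ranges A B C D s] =
  all (fun s => q s \in ranges A B C D s) (enum 'I_4).
  by apply/forallP/allP => [H s _|H s]; apply: H; rewrite ?mem_enum.
by rewrite enum_ord4 /= /ranges !inordK//= andbT -!andbA.
Qed.

Lemma prod_ranges A B C D :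
  (\prod_s #|ranges A B C D s| = #|A| * #|B| * #|C| * #|D|)%N.
Proof. by rewrite !big_ord_recl big_ord0 muln1 /ranges /= !mulnA. Qed.

Definition quad_cond (A B C D : {set I}) (u v : I * I) : bool :=
  [&& u.1 \in A, u.2 \in B, v.1 \in C, v.2 \in D & uniq [:: u.1; u.2; v.1; v.2]].

Lemma sum_quads_pairs A B C D (F : I -> I -> I -> I -> R) :
  \sum_(q in quads (ranges A B C D)) F (q i0) (q i1) (q i2) (q i3) =
  \sum_(u : I * I) \sum_(v : I * I | quad_cond A B C D u v) F u.1 u.2 v.1 v.2.
Proof.
under [RHS]eq_bigr => u _ do rewrite big_mkcond.
rewrite pair_bigA/= -big_mkcond/=.
pose f (q : quad) := ((q i0, q i1), (q i2, q i3)).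
pose g (z : (I * I) * (I * I)) : quad :=
  [ffun s : 'I_4 => nth z.1.1 [:: z.1.1; z.1.2; z.2.1; z.2.2] s].
have fg : cancel f g.
  move=> q; apply/ffunP => s; rewrite ffunE /f /=.
  have : s \in enum 'I_4 by rewrite mem_enum.
  by rewrite enum_ord4 !inE => /or4P[] /eqP ->; rewrite inordK.
have gf : cancel g f.
  by move=> [[a b] [c e]]; rewrite /f /g !ffunE !inordK.
rewrite (reindex f)/=; last by apply: onW_bij; exists g.
by apply: eq_bigl => q; rewrite mem_quads.
Qed.

Lemma sum_quads_nested A B C D (F : I -> I -> I -> I -> R) :
  \sum_(q in quads (ranges A B C D)) F (q i0) (q i1) (q i2) (q i3) =
  \sum_(i in A) \sum_(j in B) \sum_(k in C) \sum_(l in D | uniq [:: i; j; k; l])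
    F i j k l.
Proof.
rewrite sum_quads_pairs.
under eq_bigr => u _ do rewrite big_mkcond.
rewrite -(pair_bigA _ (fun i j => \sum_(v : I * I)
   if quad_cond A B C D (i, j) v then F i j v.1 v.2 else 0))/=.
rewrite [RHS]big_mkcond; apply: eq_bigr => i _; case: ifPn => iA; last first.
  rewrite big1// => j _; rewrite big1// => v _.
  by rewrite /quad_cond/= (negbTE iA).
rewrite [RHS]big_mkcond; apply: eq_bigr => j _; case: ifPn => jB; last first.
  by rewrite big1// => v _; rewrite /quad_cond/= (negbTE jB) andbF.
rewrite -(pair_bigA _ (fun k l => if quad_cond A B C D (i, j) (k, l) then F i j k l else 0))/=.
rewrite [RHS]big_mkcond; apply: eq_bigr => k _; case: ifPn => kC; last first.
  by rewrite big1// => l _; rewrite /quad_cond/= (negbTE kC) !andbF.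
rewrite [RHS]big_mkcond; apply: eq_bigr => l _.
by rewrite /quad_cond/= iA jB kC.
Qed.

Lemma card_offdiag (A : {set I}) :
  #|[set v : I * I | [&& v.1 \in A, v.2 \in A & v.1 != v.2]]| = (#|A| * (#|A| - 1))%N.
Proof.
rewrite -sum1_card big_mkcond; under eq_bigr => v _ do rewrite inE.
rewrite -(pair_bigA _ (fun i j => if [&& i \in A, j \in A & i != j] then 1%N else 0%N))/=.
rewrite -sum_nat_const [RHS]big_mkcond; apply: eq_bigr => i _; case: ifPn => iA; last first.
  by rewrite big1// => j _; rewrite (negbTE iA).
rewrite -big_mkcond sum1_card; transitivity #|A :\ i|.
  by apply: eq_card => j; rewrite !inE -topredE/= andbC eq_sym.
by have := cardsD1 i A; rewrite iA add1n subn1 => ->.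
Qed.

Section Marginals.
Variable g : I -> I -> R.
Definition offdiag_sum (A : {set I}) : R :=
  \sum_(u : I * I | [&& u.1 \in A, u.2 \in A & u.1 != u.2]) g u.1 u.2.

(** A summand that sees only one of the two pairs is weighted by the number of completions to a
    quadruple, which is the same for every admissible pair. *)
Lemma marginal_sum (A : {set I}) (c : nat) (Q : rel (I * I)) :
  (forall u v, Q u v -> [&& u.1 \in A, u.2 \in A & u.1 != u.2]) ->
  (forall u, [&& u.1 \in A, u.2 \in A & u.1 != u.2] -> #|[set v | Q u v]| = c) ->
  \sum_(u : I * I) \sum_(v : I * I | Q u v) g u.1 u.2 = c%:R * offdiag_sum A.
Proof.
move=> QA Qc; rewrite /offdiag_sum big_distrr/= [RHS]big_mkcond.
apply: eq_bigr => u _; case: ifPn => uA; last first.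
  by rewrite big1// => v /QA; rewrite (negbTE uA).
rewrite -(Qc u uA) mulr_natl -sumr_const.
by apply: eq_bigl => v; rewrite inE.
Qed.

Lemma sum_AAAA1 (A : {set I}) :
  \sum_(q in quads (ranges A A A A)) g (q i0) (q i1) =
  ((#|A| - 2) * (#|A| - 3))%N%:R * offdiag_sum A.
Proof.
rewrite (sum_quads_pairs _ _ _ _ (fun i j _ _ => g i j)).
apply: marginal_sum.
  move=> u v /and5P[-> -> _ _]; rewrite /= !inE !negb_or -!andbA.
  by case/and5P.
move=> [a b] /= /and3P[aA bA ab].
transitivity #|[set v : I * I | [&& v.1 \in A :\ a :\ b, v.2 \in A :\ a :\ b & v.1 != v.2]]|.
  apply: eq_card => -[x y]; rewrite !inE /quad_cond/= aA bA/= !inE !negb_or ab/=.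
  rewrite (eq_sym a x) (eq_sym a y) (eq_sym b x) (eq_sym b y).
  by case: (x \in A); case: (y \in A); case: (x == a); case: (y == a);
    case: (x == b); case: (y == b); case: (x == y).
rewrite card_offdiag.
have h1 := cardsD1 a A; have h2 := cardsD1 b (A :\ a).
rewrite aA in h1; rewrite !inE bA eq_sym ab/= in h2.
have -> : #|A| = #|A :\ a :\ b|.+2 by rewrite h1 h2.
by rewrite !subSS subn0.
Qed.

Lemma sum_AAAA2 (A : {set I}) :
  \sum_(q in quads (ranges A A A A)) g (q i2) (q i3) =
  ((#|A| - 2) * (#|A| - 3))%N%:R * offdiag_sum A.
Proof.
rewrite (sum_quads_pairs _ _ _ _ (fun _ _ k l => g k l)) (exchange_big_dep xpredT)//=.
rewrite -sum_AAAA1 (sum_quads_pairs _ _ _ _ (fun i j _ _ => g i j)).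
apply: eq_bigr => u _; apply: eq_bigl => v; rewrite /quad_cond /= !inE !negb_or.
rewrite (eq_sym v.1 u.1) (eq_sym v.1 u.2) (eq_sym v.2 u.1) (eq_sym v.2 u.2).
by case: (u.1 \in A); case: (u.2 \in A); case: (v.1 \in A); case: (v.2 \in A);
   case: (u.1 == v.1); case: (u.1 == v.2); case: (u.2 == v.1); case: (u.2 == v.2);
   case: (u.1 == u.2); case: (v.1 == v.2).
Qed.

Variables A B : {set I}.
Hypothesis AB : [disjoint A & B].

Lemma uniq_AABB a b x y : a \in A -> b \in A -> x \in B -> y \in B ->
  uniq [:: a; b; x; y] = (a != b) && (x != y).
Proof.
move=> aA bA xB yB.
have AB' z t : z \in A -> t \in B -> (z == t) = false.
  move=> zA tB; apply/negP => /eqP zt; move: AB; rewrite disjoint_subset.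
  by move/fintype.subsetP/(_ _ zA); rewrite inE zt tB.
by rewrite /= !inE (AB' a x)// (AB' a y)// (AB' b x)// (AB' b y)// !orbF andbT.
Qed.

Lemma sum_AABB1 :
  \sum_(q in quads (ranges A A B B)) g (q i0) (q i1) =
  (#|B| * (#|B| - 1))%N%:R * offdiag_sum A.
Proof.
rewrite (sum_quads_pairs _ _ _ _ (fun i j _ _ => g i j)).
apply: marginal_sum.
  move=> u v /and5P[-> -> _ _]; rewrite /= !inE !negb_or -!andbA.
  by case/and5P.
move=> [a b] /= /and3P[aA bA ab]; rewrite -card_offdiag.
apply: eq_card => -[x y]; rewrite !inE /quad_cond [LHS]/= aA bA [LHS]/=.
have [xB|//] := boolP (x \in B); have [yB|//] := boolP (y \in B).
by have := uniq_AABB aA bA xB yB; rewrite /= => ->; rewrite ab.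
Qed.

Lemma sum_AABB2 :
  \sum_(q in quads (ranges A A B B)) g (q i2) (q i3) =
  (#|A| * (#|A| - 1))%N%:R * offdiag_sum B.
Proof.
rewrite (sum_quads_pairs _ _ _ _ (fun _ _ k l => g k l)) (exchange_big_dep xpredT)//=.
apply: marginal_sum.
  move=> u v /and5P[_ _ -> ->]; rewrite /= !inE !negb_or -!andbA.
  by case/and5P=> _ _ _ _ /and3P[].
move=> [a b] /= /and3P[aB bB ab]; rewrite -card_offdiag.
apply: eq_card => -[x y]; rewrite !inE /quad_cond [LHS]/= aB bB [LHS]/=.
have [xA|//] := boolP (x \in A); have [yA|//] := boolP (y \in A).
by have := uniq_AABB xA yA aB bB; rewrite /= => ->; rewrite ab andbT.
Qed.

End Marginals.

End QuadSums.

Lemma natr_ffact2 (R : realType) (a : nat) : (2 <= a)%N ->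
  (a ^_ 2)%:R = a%:R * (a%:R - 1) :> R.
Proof.
by move=> a2; rewrite ffactnSr ffactn1 natrM natrB//; lia.
Qed.

Lemma natr_ffact4 (R : realType) (a : nat) : (4 <= a)%N ->
  (a ^_ 4)%:R = a%:R * (a%:R - 1) * (a%:R - 2) * (a%:R - 3) :> R.
Proof.
by move=> a4; rewrite !ffactnSr ffactn0 mul1n subn0 !natrM !natrB//; lia.
Qed.

Section Shift.
Variables (R : realType) (n : nat) (K : finType) (A B : {set 'I_n.+1}).
Hypothesis AB : [disjoint A & B].
Hypotheses (A4 : (4 <= #|A|)%N) (B4 : (4 <= #|B|)%N).

Definition two_sample_stat (v : nat -> nat -> K -> R) : R :=
  (#|A| ^_ 4)%:R^-1 * (\sum_(q in quads (ranges A A A A)) pairing v v q)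
  + (#|B| ^_ 4)%:R^-1 * (\sum_(q in quads (ranges B B B B)) pairing v v q)
  - 2 / (#|A| ^_ 2 * #|B| ^_ 2)%:R *
    (\sum_(q in quads (ranges A A B B)) pairing v v q).

(** Expanding <v - b, v' - b>, the normalised linear terms give -2 times the average of <b, v> over
    each segment from the first two sums, and +2 times the same averages from the mixed sum; the
    constants cancel as 1 + 1 - 2. Segments of size four keep the normalisations nonzero. *)
Lemma two_sample_stat_shift v b :
  two_sample_stat (fun i j k => v i j k - b k) = two_sample_stat v.
Proof.
pose g (i j : 'I_n.+1) := dotk b (v i j).
pose bb := dotk b b.
have shift r : \sum_(q in quads r) pairing (fun i j k => v i j k - b k)
      (fun i j k => v i j k - b k) q =
    (\sum_(q in quads r) pairing v v q) -
    (\sum_(q in quads r) g (q (inord 0)) (q (inord 1))) -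
    (\sum_(q in quads r) g (q (inord 2)) (q (inord 3))) +
    bb * \sum_(q in quads r) 1.
  rewrite big_distrr/= -!sumrB -big_split/=; apply: eq_bigr => q _.
  rewrite /g /bb /pairing /dotk mulr1 -!sumrB -big_split/=.
  by apply: eq_bigr => k _; ring.
have off1 (C : {set 'I_n.+1}) : offdiag_sum (fun _ _ => 1 : R) C = (#|C| * (#|C| - 1))%N%:R.
  rewrite /offdiag_sum sumr_const -card_offdiag; congr (_%:R).
  by apply: eq_card => u; rewrite inE.
have c4 (C : {set 'I_n.+1}) : \sum_(q in quads (ranges C C C C)) (1 : R) =
    ((#|C| - 2) * (#|C| - 3))%N%:R * (#|C| * (#|C| - 1))%N%:R.
  by rewrite (sum_AAAA1 (fun _ _ => 1 : R)) off1.
have c22 : \sum_(q in quads (ranges A A B B)) (1 : R) =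
    (#|B| * (#|B| - 1))%N%:R * (#|A| * (#|A| - 1))%N%:R.
  by rewrite (sum_AABB1 (fun _ _ => 1 : R) AB) off1.
rewrite /two_sample_stat !shift !sum_AAAA1 !sum_AAAA2 sum_AABB1// sum_AABB2//.
have [A2 B2] : (2 <= #|A|)%N /\ (2 <= #|B|)%N by split; lia.
rewrite !c4 c22 (natr_ffact4 _ A4) (natr_ffact4 _ B4) (natrM _ (_ ^_ 2)).
rewrite (natr_ffact2 _ A2) (natr_ffact2 _ B2) !natrM !natrB; try lia.
have xA : 4 <= #|A|%:R :> R by rewrite ler_nat.
have xB : 4 <= #|B|%:R :> R by rewrite ler_nat.
field; rewrite !gt_eqF//; lra.
Qed.

End Shift.

Section StatisticsAsQuadSums.
Variables (R : realType) (n p : nat) (x : nat -> 'cV[R]_p).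

(** Ordinals below [n.+1] let the index [n] itself occur; the meaningless index 0 is excluded by
    taking [a] positive. *)
Definition ord_itv (a b : nat) : {set 'I_n.+1} := [set i : 'I_n.+1 | (a <= i < b)%N].

Lemma sum_ord_itv (a b : nat) (Q : pred nat) (F : nat -> R) : (b <= n.+1)%N ->
  \sum_(a <= i < b | Q i) F i = \sum_(i in ord_itv a b | Q i) F i.
Proof.
move=> bn; rewrite (big_nat_widen _ _ _ _ _ bn) (big_nat_widenl _ 0)//.
rewrite big_mkord; apply: eq_bigl => i; rewrite inE.
by case: (Q i); case: (i < b)%N; case: (a <= i)%N.
Qed.

Lemma card_ord_itv (a b : nat) : (b <= n.+1)%N -> #|ord_itv a b| = (b - a)%N.
Proof.
move=> bn; apply/eqP; rewrite -(eqr_nat R).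
have := sum_ord_itv a xpredT (fun=> 1) bn.
rewrite big_const_nat iter_addr_0 => ->.
by rewrite -sumr_const; apply/eqP/eq_bigl => i; rewrite andbT.
Qed.

Definition diff_tensor (i j : nat) (k : 'I_p) : R := (x i - x j) k 0.
Definition sqdiff_tensor (i j : nat) (kl : 'I_p * 'I_p) : R :=
  (x i - x j) kl.1 0 * (x i - x j) kl.2 0.

Variable tau : nat.
Let A := ord_itv 1 tau.+1.
Let B := ord_itv tau.+1 n.+1.

Lemma ord_itv_disjoint : [disjoint A & B].
Proof.
rewrite disjoint_subset; apply/fintype.subsetP => i; rewrite !inE => /andP[_].
by rewrite ltnS => itau; rewrite negb_and -leqNgt itau.
Qed.

(** The pairs are (i1, j1) and (i2, j2), hence the alternating ranges; as the two sides of tau are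
    disjoint, injectivity of the quadruple amounts to i1 <> i2 and j1 <> j2. *)
Lemma mean_stat_at_quads : (tau <= n)%N ->
  mean_stat_at n x tau = (tau * (tau - 1) * (n - tau) * (n - tau - 1))%:R^-1 *
    \sum_(q in quads (ranges A B A B)) pairing diff_tensor diff_tensor q.
Proof.
move=> tn; congr (_ * _).
rewrite (sum_quads_nested A B A B (fun i j k l : 'I_n.+1 =>
  dotk (diff_tensor i j) (diff_tensor k l))).
have b1 : (tau.+1 <= n.+1)%N by [].
rewrite (sum_ord_itv _ xpredT)//; apply: eq_big => [i|i]; first by rewrite andbT.
rewrite andbT => iA.
rewrite (sum_ord_itv _ (fun i2 => i != i2 :> nat))//.
rewrite [RHS]exchange_big/= big_mkcondr/=; apply: eq_bigr => k kA.
have uq (j l : 'I_n.+1) : j \in B -> l \in B -> uniq [:: i; j; k; l] = (i != k) && (j != l).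
  move=> jB lB; have := uniq_AABB ord_itv_disjoint iA kA jB lB => <-.
  by rewrite /= !inE; rewrite (eq_sym j k); case: (i == j); case: (i == k); case: (i == l);
    case: (k == j); case: (j == l); case: (k == l).
case: ifPn => ik; last first.
  rewrite big1// => j jB; rewrite big1// => l /andP[lB].
  by have := uq _ _ jB lB; rewrite /= => ->; rewrite -val_eqE/= (negbTE ik).
rewrite (sum_ord_itv _ xpredT)//; apply: eq_big => [j|j]; first by rewrite andbT.
rewrite andbT => jB; rewrite (sum_ord_itv _ (fun j2 => j != j2 :> nat))//.
apply: eq_big => [l|l _]; last first.
  by apply: eq_bigr => a _.
have [lB|//] := boolP (l \in B).
by have := uq _ _ jB lB; rewrite /= => ->; rewrite -!val_eqE/= ik.
Qed.

(** The square of an inner product is the Frobenius inner product of the outer squares, which puts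
    the covariance statistic in the same form as the mean statistic, with tensors of degree two. *)
Lemma sqdiff_pairing i j k l :
  cov_kernel x i j k l = 4^-1 * dotk (sqdiff_tensor i j) (sqdiff_tensor k l).
Proof.
rewrite /cov_kernel mulrC; congr (_ * _).
rewrite /dotv expr2 big_distrlr/= pair_bigA/=; apply: eq_bigr => -[a b] _ /=.
by rewrite /sqdiff_tensor/=; ring.
Qed.

Lemma cov_stat_at_quads : (4 <= tau)%N -> (4 <= n - tau)%N ->
  cov_stat_at n x tau = 4^-1 * two_sample_stat A B sqdiff_tensor.
Proof.
move=> t4 nt4; have b1 : (tau.+1 <= n.+1)%N by lia.
have cA : #|A| = tau by rewrite card_ord_itv// subn1.
have cB : #|B| = (n - tau)%N by rewrite card_ord_itv// subSS.
have same (a b : nat) : (b <= n.+1)%N ->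
    \sum_(a <= i < b) \sum_(a <= j < b) \sum_(a <= k < b)
      \sum_(a <= l < b | uniq [:: i; j; k; l]) cov_kernel x i j k l =
    4^-1 * \sum_(q in quads (ranges (ord_itv a b) (ord_itv a b) (ord_itv a b) (ord_itv a b)))
       pairing sqdiff_tensor sqdiff_tensor q.
  move=> bn; rewrite (sum_quads_nested _ _ _ _ (fun i j k l : 'I_n.+1 =>
    dotk (sqdiff_tensor i j) (sqdiff_tensor k l))) big_distrr/=.
  rewrite (sum_ord_itv _ xpredT)//; apply: eq_big => [i|i _]; first by rewrite andbT.
  rewrite (sum_ord_itv _ xpredT)// big_distrr; apply: eq_big => [j|j _]; first by rewrite andbT.
  rewrite (sum_ord_itv _ xpredT)// big_distrr; apply: eq_big => [k|k _]; first by rewrite andbT.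
  rewrite (sum_ord_itv _ (fun l => uniq [:: (i : nat); (j : nat); (k : nat); l]))//.
  by rewrite big_distrr; apply: eq_bigr => l _; rewrite sqdiff_pairing.
rewrite /cov_stat_at /two_sample_stat !same// cA cB mulrBr mulrDr.
congr (_ + _ - _); [by rewrite mulrCA|by rewrite mulrCA|].
rewrite [RHS]mulrCA; congr (_ * _).
rewrite (sum_quads_nested _ _ _ _ (fun i j k l : 'I_n.+1 =>
  dotk (sqdiff_tensor i j) (sqdiff_tensor k l))) big_distrr/=.
rewrite (sum_ord_itv _ xpredT)//; apply: eq_big => [i|i]; first by rewrite andbT.
rewrite andbT => iA; rewrite (sum_ord_itv _ (fun j => i != j :> nat))// big_mkcondr/=.
rewrite big_distrr/=; apply: eq_bigr => j jA.
have uq (k l : 'I_n.+1) : k \in B -> l \in B -> uniq [:: i; j; k; l] = (i != j) && (k != l).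
  move=> kB lB; have H := uniq_AABB ord_itv_disjoint iA jA kB lB; exact: H.
case: ifPn => ij; last first.
  rewrite big1 ?mulr0// => k kB; rewrite big1// => l /andP[lB].
  by have := uq _ _ kB lB; rewrite /= => ->; rewrite -val_eqE/= (negbTE ij).
rewrite (sum_ord_itv _ xpredT)// big_distrr; apply: eq_big => [k|k]; first by rewrite andbT.
rewrite andbT => kB; rewrite (sum_ord_itv _ (fun l => k != l :> nat))// big_distrr/=.
apply: eq_big => [l|l _]; last by rewrite sqdiff_pairing.
have [lB|//] := boolP (l \in B).
by have := uq _ _ kB lB; rewrite /= => ->; rewrite -!val_eqE/= ij.
Qed.

End StatisticsAsQuadSums.

Local Open Scope classical_set_scope.

(** * Moments of the observations *)

Local Notation sym_mx A := (forall k l, A k l = A l k).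

Section Moments.
Context d (T : measurableType d) (R : realType) (P : probability T R)
  (n p : nat) (X : nat -> 'I_p -> {RV P >-> R}).
Hypothesis indX : independent_vectors n X.
Hypothesis X8 : moments8 P n X.
Local Notation poly := (poly n X).
Local Notation nice := (poly xpredT 8).
Local Notation tensor := (tensor n X).
Local Notation Ex := (Ex P).
Local Notation gram := (gram P).
Local Notation gram_norm2 := (gram_norm2 P).
Local Notation in_range i := (1 <= i <= n)%N.
Local Notation y i := (centered (X i)).
Local Notation Sigma i := (cov_mx (X i)).

Lemma tensor_centered i : in_range i -> tensor (pred1 i) 1 (y i).
Proof.
move=> ri k; apply: polyB; first exact: poly_coord.
exact: poly_cst.
Qed.

Lemma Ex_centered i k : in_range i -> Ex (y i k) = 0.
Proof.
move=> ri; rewrite /centered.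
have nX : nice (X i k) by apply: (@poly_nice _ _ _ _ _ _ _ (pred1 i) 1) => //; exact: poly_coord.
rewrite (ExB X8)//; last exact: poly_cst.
by rewrite Ex_cst /mean_vec mxE subrr.
Qed.

Lemma gram_centered i k l : in_range i -> gram (y i) k l = Sigma i k l.
Proof.
move=> ri; rewrite /gram mxE /Ex covariance.unlock; congr (fine (expectation _ _)).
by apply/funext => w; rewrite /centered /mean_vec !mxE.
Qed.

Lemma cov_mx_sym i k l : Sigma i k l = Sigma i l k.
Proof.
rewrite !mxE covariance.unlock; congr (fine (expectation _ _)).
by apply/funext => w; rewrite /= mulrC.
Qed.

Lemma tr_sqr_sym (A : 'M[R]_p) : sym_mx A ->
  \tr (A ^+ 2) = \sum_k \sum_l A k l ^+ 2.
Proof.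
move=> As; rewrite /mxtrace; apply: eq_bigr => k _.
rewrite expr2 mxE; apply: eq_bigr => l _.
by rewrite (As l k) expr2.
Qed.

Lemma gram_norm2_centered i : in_range i -> gram_norm2 (y i) = \tr (Sigma i ^+ 2).
Proof.
move=> ri; rewrite tr_sqr_sym; last exact: cov_mx_sym.
by apply: eq_bigr => k _; apply: eq_bigr => l _; rewrite gram_centered.
Qed.

Lemma gram_norm2N (K : finType) (Q : K -> T -> R) :
  gram_norm2 (fun a w => - Q a w) = gram_norm2 Q.
Proof.
apply: eq_bigr => a _; apply: eq_bigr => b _; congr (_ ^+ 2); congr (Ex _).
by apply/funext => w; rewrite mulrNN.
Qed.

Lemma gram_norm2_cst (K : finType) (v : K -> R) :
  gram_norm2 (fun a _ => v a) = dotk v v ^+ 2.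
Proof.
rewrite expr2 /dotk big_distrlr/=; apply: eq_bigr => a _; apply: eq_bigr => b _.
by rewrite /gram Ex_cst; ring.
Qed.

Section Outer.
Variables (K : finType).
Definition outer (u v : K -> T -> R) (ab : K * K) w := u ab.1 w * v ab.2 w.

Lemma tensor_outer I k m (u v : K -> T -> R) : tensor I k u -> tensor I m v ->
  tensor I (k + m) (outer u v).
Proof. by move=> tu tv ab; exact: polyM (tu _) (tv _). Qed.

Lemma gram_norm2_outerD (u v : K -> T -> R) : tensor xpredT 2 u -> tensor xpredT 2 v ->
  gram_norm2 (outer (fun a w => u a w + v a w) (fun a w => u a w + v a w)) <=
  64 * (gram_norm2 (outer u u) + gram_norm2 (outer u v) +
        gram_norm2 (outer v u) + gram_norm2 (outer v v)).
Proof.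
move=> tu tv.
have -> : outer (fun a w => u a w + v a w) (fun a w => u a w + v a w) =
   fun ab w => (outer u u ab w + outer u v ab w) + (outer v u ab w + outer v v ab w).
  by apply/funext => ab; apply/funext => w; rewrite /outer; ring.
have t1 := tensor_outer tu tu; have t2 := tensor_outer tu tv.
have t3 := tensor_outer tv tu; have t4 := tensor_outer tv tv.
have h1 := gram_norm2D X8 t1 t2; have h2 := gram_norm2D X8 t3 t4.
have h := gram_norm2D X8 (fun ab => polyD (t1 ab) (t2 ab)) (fun ab => polyD (t3 ab) (t4 ab)).
by apply: le_trans h _; lra.
Qed.

End Outer.

Lemma gram_norm2_outer_indep (I J : pred nat) (K : finType) (u v : K -> T -> R) :
  (forall i, ~~ (I i && J i)) -> tensor I 2 u -> tensor J 2 v ->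
  gram_norm2 (outer u v) = gram_norm2 u * gram_norm2 v.
Proof. exact: (gram_norm2_outer indX X8). Qed.

Variables (mu1 mu2 : 'cV[R]_p) (S1 S2 : 'M[R]_p) (ts : nat) (C4 : R).
Hypothesis mean_cp : forall i, in_range i ->
  mean_vec (X i) = if (i <= ts)%N then mu1 else mu2.
Hypothesis cov_cp : forall i, in_range i -> Sigma i = if (i <= ts)%N then S1 else S2.
Hypothesis C4_ge0 : 0 <= C4.
Hypothesis fourth : forall i, in_range i ->
  gram_norm2 (outer (y i) (y i)) <= C4 * \tr (Sigma i ^+ 2) ^+ 2.

Definition delta2 : R := dotv (mu1 - mu2) (mu1 - mu2).
Definition kappa2 : R := \tr (S1 ^+ 2) + \tr (S2 ^+ 2).
(** Scale of the raw differences: the outer square of a mean difference has squared Frobenius norm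
    at most [delta2 ^+ 2]. *)
Definition kappa : R := kappa2 + delta2 ^+ 2.

Hypotheses (S1_sym : sym_mx S1) (S2_sym : sym_mx S2).

Lemma delta2_ge0 : 0 <= delta2.
Proof. by apply: sumr_ge0 => k _; rewrite -expr2 sqr_ge0. Qed.

Lemma tr_sqr_ge0 (A : 'M[R]_p) : sym_mx A -> 0 <= \tr (A ^+ 2).
Proof.
by move=> As; rewrite tr_sqr_sym//; apply: sumr_ge0 => k _; apply: sumr_ge0 => l _; exact: sqr_ge0.
Qed.

Lemma kappa2_ge0 : 0 <= kappa2.
Proof. by rewrite addr_ge0// tr_sqr_ge0. Qed.

Lemma kappa_ge0 : 0 <= kappa.
Proof. by rewrite addr_ge0 ?kappa2_ge0// sqr_ge0. Qed.

Lemma tr_Sigma_le i : in_range i -> 0 <= \tr (Sigma i ^+ 2) <= kappa2.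
Proof.
move=> ri; rewrite cov_cp//.
have t1 := tr_sqr_ge0 S1_sym; have t2 := tr_sqr_ge0 S2_sym.
by rewrite /kappa2; case: ifP => _; apply/andP; split=> //; lra.
Qed.

Definition noise_diff i j k w := y i k w - y j k w.

Lemma tensor_noise_diff i j : in_range i -> in_range j ->
  tensor (pred2 i j) 1 (noise_diff i j).
Proof.
move=> ri rj k; apply: polyB.
  by apply: poly_weaken (tensor_centered ri k) => // x /eqP ->; rewrite /= unfold_in/= eqxx.
by apply: poly_weaken (tensor_centered rj k) => // x /eqP ->; rewrite /= unfold_in/= eqxx orbT.
Qed.

Let tw I J k m (K : finType) (Q : K -> T -> R) : {subset I <= J} -> (k <= m)%N ->
  tensor I k Q -> tensor J m Q.
Proof. by move=> IJ km tQ a; exact: poly_weaken (tQ a). Qed.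

Lemma gram_norm2_noise_diff i j : in_range i -> in_range j ->
  gram_norm2 (noise_diff i j) <= 16 * kappa2.
Proof.
move=> ri rj.
have ty i' : in_range i' -> tensor xpredT 4 (y i').
  by move=> ri'; apply: tw (tensor_centered ri').
have tNy : tensor xpredT 4 (fun k w => - y j k w) by move=> k; apply: polyN; exact: ty.
have := gram_norm2D X8 (ty _ ri) tNy; rewrite gram_norm2N !gram_norm2_centered//.
have /andP[_ h1] := tr_Sigma_le ri; have /andP[_ h2] := tr_Sigma_le rj.
by rewrite -/(noise_diff i j) /noise_diff; lra.
Qed.

(** The outer square of y_i - y_j splits into four products: the two pure ones are controlled by the
    fourth-moment hypothesis and the two mixed ones by independence. This gives 64 * (2 C4 + 2). *)
Lemma gram_norm2_outer_noise_diff i j : in_range i -> in_range j -> i != j ->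
  gram_norm2 (outer (noise_diff i j) (noise_diff i j)) <=
  128 * (C4 + 1) * kappa2 ^+ 2.
Proof.
move=> ri rj ij.
have ty i' : in_range i' -> tensor (pred1 i') 2 (y i').
  by move=> ri'; apply: tw (tensor_centered ri').
have tNy : tensor (pred1 j) 2 (fun k w => - y j k w) by move=> k; apply: polyN; exact: ty.
have wi : tensor xpredT 2 (y i) by apply: tw (ty _ ri).
have wj : tensor xpredT 2 (fun k w => - y j k w) by apply: tw tNy.
have dij x : ~~ (pred1 i x && pred1 j x).
  by apply/negP => /andP[/= /eqP -> /eqP e]; move: ij; rewrite e eqxx.
have dji x : ~~ (pred1 j x && pred1 i x) by rewrite andbC.
apply: le_trans (gram_norm2_outerD wi wj) _.
rewrite (gram_norm2_outer_indep dij (ty _ ri) tNy).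
rewrite (gram_norm2_outer_indep dji tNy (ty _ ri)).
have -> : outer (fun k w => - y j k w) (fun k w => - y j k w) = outer (y j) (y j).
  by apply/funext => ab; apply/funext => w; rewrite /outer mulrNN.
rewrite gram_norm2N !gram_norm2_centered//.
have h1 := fourth ri; have h2 := fourth rj.
have /andP[a0 ak] := tr_Sigma_le ri; have /andP[b0 bk] := tr_Sigma_le rj.
set a := \tr (Sigma i ^+ 2) in h1 a0 ak *; set b := \tr (Sigma j ^+ 2) in h2 b0 bk *.
have k0 := kappa2_ge0.
have a2 : a ^+ 2 <= kappa2 ^+ 2 by rewrite lerXn2r ?nnegrE.
have b2 : b ^+ 2 <= kappa2 ^+ 2 by rewrite lerXn2r ?nnegrE.
have ab : a * b <= kappa2 ^+ 2 by rewrite expr2 ler_pM.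
have h3 : C4 * a ^+ 2 <= C4 * kappa2 ^+ 2 by rewrite ler_wpM2l.
have h4 : C4 * b ^+ 2 <= C4 * kappa2 ^+ 2 by rewrite ler_wpM2l.
lra.
Qed.

Definition mean_diff i j (k : 'I_p) : R := (mean_vec (X i) - mean_vec (X j)) k 0.

Lemma mean_diff_sqr i j : in_range i -> in_range j ->
  dotk (mean_diff i j) (mean_diff i j) =
  if (i <= ts)%N == (j <= ts)%N then 0 else delta2.
Proof.
move=> ri rj; rewrite /dotk /mean_diff /delta2 /dotv !mean_cp//.
case: (i <= ts)%N; case: (j <= ts)%N => /=.
- by rewrite big1// => k _; rewrite subrr mxE mul0r.
- by [].
- by apply: eq_bigr => k _; rewrite !mxE; ring.
- by rewrite big1// => k _; rewrite subrr mxE mul0r.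
Qed.

Lemma mean_diff_sqr_le i j : in_range i -> in_range j ->
  dotk (mean_diff i j) (mean_diff i j) <= delta2.
Proof.
move=> ri rj; rewrite mean_diff_sqr//; case: ifP => // _; exact: delta2_ge0.
Qed.

Definition raw_diff i j (k : 'I_p) (w : T) : R := noise_diff i j k w + mean_diff i j k.

Lemma raw_diffE i j k w : raw_diff i j k w =
  diff_tensor (realized_sample X w) i j k.
Proof.
by rewrite /raw_diff /noise_diff /mean_diff /diff_tensor /centered !mxE; ring.
Qed.

Lemma gram_norm2_outer_raw_diff i j : in_range i -> in_range j -> i != j ->
  gram_norm2 (outer (raw_diff i j) (raw_diff i j)) <=
  64 * (33 + 128 * (C4 + 1)) * kappa ^+ 2.
Proof.
move=> ri rj ij.
have tn : tensor (pred2 i j) 2 (noise_diff i j) by apply: tw (tensor_noise_diff ri rj).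
have tm I : tensor I 2 (fun k _ => mean_diff i j k) by move=> k; exact: poly_cst.
have tn' : tensor xpredT 2 (noise_diff i j) by apply: tw tn.
apply: le_trans (gram_norm2_outerD tn' (tm _)) _.
(* A deterministic tensor depends on the empty set of observations, so it is independent of every
   tensor, itself included. The three products with a deterministic factor contribute 33 = 16 + 16 +
   1. *)
have d1 x : ~~ (pred2 i j x && pred0 x) by rewrite andbF.
have d2 x : ~~ (pred0 x && pred2 i j x) by [].
have d3 (x : nat) : ~~ (pred0 x && pred0 x) by [].
rewrite (gram_norm2_outer_indep d1 tn (tm _)).
rewrite (gram_norm2_outer_indep d2 (tm _) tn).
rewrite (gram_norm2_outer_indep d3 (tm _) (tm _)) gram_norm2_cst.
have h1 := gram_norm2_noise_diff ri rj.
have h2 := gram_norm2_outer_noise_diff ri rj ij.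
have g0 := gram_norm2_ge0 P (noise_diff i j).
set g := gram_norm2 (noise_diff i j) in h1 g0 *.
have m0 : 0 <= dotk (mean_diff i j) (mean_diff i j).
  by apply: sumr_ge0 => k _; rewrite -expr2 sqr_ge0.
have m1 := mean_diff_sqr_le ri rj.
have k0 := kappa2_ge0; have d0 := delta2_ge0.
have m2 : dotk (mean_diff i j) (mean_diff i j) ^+ 2 <= delta2 ^+ 2 by rewrite lerXn2r ?nnegrE.
have m20 : 0 <= dotk (mean_diff i j) (mean_diff i j) ^+ 2 by exact: sqr_ge0.
set m := dotk _ _ ^+ 2 in m2 m20 *.
have d20 : 0 <= delta2 ^+ 2 by exact: sqr_ge0.
have kk : kappa2 <= kappa by rewrite /kappa; lra.
have dk : delta2 ^+ 2 <= kappa by rewrite /kappa; lra.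
have gm : g * m <= 16 * kappa ^+ 2.
  apply: (@le_trans _ _ ((16 * kappa2) * delta2 ^+ 2)); first by rewrite ler_pM.
  by rewrite -mulrA expr2; have : kappa2 * delta2 ^+ 2 <= kappa * kappa by [rewrite ler_pM|]; lra.
have mm : m * m <= kappa ^+ 2 by rewrite expr2 ler_pM//; lra.
have k2 : (C4 + 1) * kappa2 ^+ 2 <= (C4 + 1) * kappa ^+ 2.
  by rewrite ler_wpM2l ?addr_ge0// lerXn2r ?nnegrE//; lra.
rewrite (mulrC m g); lra.
Qed.

End Moments.

Local Close Scope classical_set_scope.

(** * The mean statistic *)

Section Weights.
Variable R : realType.

Definition weight (n tau : nat) : R := (tau * (n - tau))%:R / n%:R.

Lemma weight_ge0 n tau : 0 <= weight n tau.
Proof. by rewrite divr_ge0 ?ler0n. Qed.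

Lemma weight_lel n tau : weight n tau <= tau%:R.
Proof.
have [->|n0] := posnP n; first by rewrite /weight invr0 mulr0 ler0n.
by rewrite ler_pdivrMr ?ltr0n// -natrM ler_nat leq_mul2l leq_subr orbT.
Qed.

Lemma weight_ler n tau : weight n tau <= (n - tau)%:R.
Proof.
have [tn|nt] := leqP tau n; last first.
  by rewrite /weight (_ : (n - tau = 0)%N) ?muln0 ?mul0r//; lia.
have [n_eq0|n0] := posnP n; first by rewrite /weight n_eq0 invr0 mulr0 ler0n.
by rewrite ler_pdivrMr ?ltr0n// -natrM ler_nat mulnC leq_mul2l tn orbT.
Qed.

Lemma sum_weight_le n a b : (b <= n)%N -> \sum_(a <= tau < b) weight n tau <= n%:R ^+ 2.
Proof.
move=> bn; apply: (@le_trans _ _ (\sum_(a <= tau < b) n%:R)).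
  by apply: ler_sum => tau _; apply: le_trans (weight_ler n tau) _; rewrite ler_nat leq_subr.
rewrite sumr_const_nat -[leLHS]mulr_natr expr2 ler_wpM2l ?ler0n// ler_nat.
by apply: leq_trans bn; exact: leq_subr.
Qed.

(** Only the central values from q = n %/ 4 to n - q are kept: there are at least n / 2 of them,
    each of weight at least n / 16. The threshold on [n] gives q >= 32, so any cut-off a <= 32
    leaves them in. *)
Lemma sum_weight_ge n a : (128 <= n)%N -> (a <= 32)%N ->
  n%:R ^+ 2 / 32 <= \sum_(a <= tau < (n - a).+1) weight n tau.
Proof.
move=> n128 a32; pose q := (n %/ 4)%N.
have q4 : (4 * q <= n < 4 * q + 4)%N by rewrite /q; lia.
have q32 : (32 <= q)%N by lia.
rewrite (big_cat_nat _ (n := q))/=; [|lia|lia].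
rewrite [X in _ + X](big_cat_nat _ (n := (n - q)%N))/=; [|lia|lia].
have s0 u v : 0 <= \sum_(u <= tau < v) weight n tau by apply: sumr_ge0 => tau _; exact: weight_ge0.
have := s0 a q; have := s0 (n - q)%N (n - a).+1.
suff : n%:R ^+ 2 / 32 <= \sum_(q <= tau < n - q) weight n tau by lra.
have n0 : 0 < n%:R :> R by rewrite ltr0n; lia.
apply: (@le_trans _ _ (\sum_(q <= tau < n - q) (n%:R / 16))).
  rewrite sumr_const_nat -[leRHS]mulr_natr.
  have : (n%:R / 2 <= (n - q - q)%:R :> R).
    by rewrite ler_pdivrMr// -natrM ler_nat; lia.
  nra.
rewrite big_nat [leRHS]big_nat; apply: ler_sum => tau /andP[qt tq].
rewrite /weight ler_pdivlMr// mulrAC ler_pdivrMr// -!natrM ler_nat.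
have h1 : (n <= 8 * q)%N by lia.
have h2 : (q * (n - q) <= tau * (n - tau))%N by nia.
nia.
Qed.

End Weights.

Section SumOverTau.
Context d (T : measurableType d) (R : realType) (P : probability T R)
  (n p : nat) (X : nat -> 'I_p -> {RV P >-> R}).
Hypothesis indX : independent_vectors n X.
Hypothesis X8 : moments8 P n X.
Local Notation poly := (poly n X).
Local Notation Ex := (Ex P).

(** All pairs are declared overlapping in [Ex_sqr_sum], which amounts to Cauchy-Schwarz over the at
    most n terms. *)
Lemma Ex_sqr_sum_nat (a b : nat) (h : nat -> T -> R) (V : R) : (b <= n.+1)%N -> (0 < a)%N ->
  0 <= V ->
  (forall t, (a <= t < b)%N -> poly xpredT 4 (h t)) ->
  (forall t, (a <= t < b)%N -> Ex (fun w => h t w ^+ 2) <= V) ->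
  Ex (fun w => (\sum_(a <= t < b) h t w) ^+ 2) <= n%:R ^+ 2 * V.
Proof.
move=> bn a0 V0 ph hV.
have -> : (fun w => (\sum_(a <= t < b) h t w) ^+ 2) =
   fun w => (\sum_(t in ord_itv n a b) h t w) ^+ 2.
  apply/funext => w; rewrite (sum_ord_itv _ xpredT (h ^~ w) bn); congr (_ ^+ 2).
  by apply: eq_bigl => t; rewrite andbT.
have cn : #|ord_itv n a b|%:R <= n%:R :> R by rewrite card_ord_itv// ler_nat; lia.
apply: le_trans (_ : V * (#|ord_itv n a b|%:R * n%:R) <= _).
  apply: (@Ex_sqr_sum _ _ _ _ _ _ _ X8 _ _ (fun t : 'I_n.+1 => h t) (fun _ _ => true)) => //.
  - by move=> t; rewrite inE => /ph.
  - by move=> t; rewrite inE => /hV.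
  - move=> t _; apply: le_trans cn; rewrite ler_nat; apply: subset_leq_card.
    by apply/fintype.subsetP => u; rewrite inE => /andP[].
by rewrite mulrC ler_wpM2r// expr2 ler_wpM2r ?ler0n.
Qed.

Lemma poly_sum_pairing (K : finType) (G : nat -> nat -> K -> T -> R) (r : 'I_4 -> {set 'I_n.+1}) :
  (forall i j, (1 <= i <= n)%N -> (1 <= j <= n)%N -> tensor n X xpredT 2 (G i j)) ->
  (forall s i, i \in r s -> (1 <= i)%N) ->
  poly xpredT 4 (fun w => \sum_(q in quads r)
    pairing (fun i j k => G i j k w) (fun i j k => G i j k w) q).
Proof.
move=> tG r1; apply: poly_sum => q; rewrite inE => /andP[/forallP rq _].
have rg s : (1 <= q s <= n)%N by rewrite (r1 s)//= -ltnS.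
apply: poly_sum => k _.
by apply: (polyM (tG _ _ (rg _) (rg _) k) (tG _ _ (rg _) (rg _) k)).
Qed.

End SumOverTau.

Lemma mean_norm_bounds n tau : (2 <= tau < (n - 2).+1)%N ->
  (0 < tau * (tau - 1) * (n - tau) * (n - tau - 1))%N /\
  (tau * (tau - 1) * (n - tau) * (n - tau - 1) <= tau * (n - tau) * (tau * (n - tau)))%N.
Proof.
move=> ht; split; first by rewrite !muln_gt0 !subn_gt0; lia.
have -> : (tau * (n - tau) * (tau * (n - tau)) = tau * tau * (n - tau) * (n - tau))%N by ring.
by rewrite !leq_mul// leq_subr.
Qed.

Section MeanStatistic.
Context d (T : measurableType d) (R : realType) (P : probability T R)
  (n p : nat) (X : nat -> 'I_p -> {RV P >-> R}).
Hypothesis indX : independent_vectors n X.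
Hypothesis X8 : moments8 P n X.
Local Notation poly := (poly n X).
Local Notation nice := (poly xpredT 8).
Local Notation tensor := (tensor n X).
Local Notation Ex := (Ex P).
Local Notation in_range i := (1 <= i <= n)%N.

Variables (mu1 mu2 : 'cV[R]_p) (S1 S2 : 'M[R]_p) (ts : nat).
Hypothesis mean_cp : forall i, in_range i ->
  mean_vec (X i) = if (i <= ts)%N then mu1 else mu2.
Hypothesis cov_cp : forall i, in_range i -> cov_mx (X i) = if (i <= ts)%N then S1 else S2.
Hypotheses (S1_sym : sym_mx S1) (S2_sym : sym_mx S2).

Let A tau := ord_itv n 1 tau.+1.
Let B tau := ord_itv n tau.+1 n.+1.
Let xs w := realized_sample X w.
Let noise := noise_diff X.
Let M := mean_diff X.
Local Notation delta2 := (delta2 mu1 mu2).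
Local Notation kappa2 := (kappa2 S1 S2).

Definition mean_coef (tau : nat) : R :=
  weight R n tau * (tau * (tau - 1) * (n - tau) * (n - tau - 1))%:R^-1.

Definition mean_signal_at (tau : nat) : R :=
  mean_coef tau * \sum_(q in quads (ranges (A tau) (B tau) (A tau) (B tau))) pairing M M q.

(** The value at which the statistic is centred for Chebyshev; it is the expectation, because the
    indices of a quadruple are distinct and the noise is centred. *)
Definition mean_stat_signal : R := \sum_(2 <= tau < (n - 2).+1) mean_signal_at tau.

Let ranges_ge1 tau s (i : 'I_n.+1) :
  i \in ranges (A tau) (B tau) (A tau) (B tau) s -> (1 <= i)%N.
Proof.
have hA : i \in A tau -> (1 <= i)%N by rewrite inE => /andP[].
have hB : i \in B tau -> (1 <= i)%N by rewrite inE => /andP[h _]; exact: leq_ltn_trans h.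
by case: s => -[|[|[|[|s]]]] h //=; rewrite /ranges/=.
Qed.

(** The mass condition of [Ex_sqr_pairing] with a = 4 and m the smaller side of tau. The 4 comes
    from tau <= 2 (tau - 1) on both sides, and the weight is at most the smaller side. *)
Lemma mean_coef_bound tau : (2 <= tau < (n - 2).+1)%N ->
  0 <= mean_coef tau /\
  mean_coef tau * (tau * (n - tau) * tau * (n - tau))%N%:R <= 4 * (minn tau (n - tau))%:R.
Proof.
move=> /andP[t2 tn]; have nt2 : (2 <= n - tau)%N by lia.
have w0 := weight_ge0 R n tau.
split; first by rewrite mulr_ge0// invr_ge0 ler0n.
have D0 : 0 < (tau * (tau - 1) * (n - tau) * (n - tau - 1))%N%:R :> R.
  by rewrite ltr0n !muln_gt0; lia.
rewrite /mean_coef -mulrA [_^-1 * _]mulrC.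
apply: (@le_trans _ _ (weight R n tau * 4)).
  rewrite ler_wpM2l// ler_pdivrMr// -natrM ler_nat.
  have h1 : (tau <= 2 * (tau - 1))%N by lia.
  have h2 : (n - tau <= 2 * (n - tau - 1))%N by lia.
  have := leq_mul (leq_mul (leqnn (tau * (n - tau))) h1) h2.
  by set a := tau; set b := (n - tau)%N; nia.
rewrite mulrC ler_pM2l//.
by rewrite /minn; case: ifP => _; [exact: weight_lel|exact: weight_ler].
Qed.

Lemma mean_stat_decomp w : mean_stat n (xs w) - mean_stat_signal =
  \sum_(2 <= tau < (n - 2).+1) mean_coef tau *
    \sum_(q in quads (ranges (A tau) (B tau) (A tau) (B tau)))
      (pairing (fun i j k => noise i j k w + M i j k)
         (fun i j k => noise i j k w + M i j k) q - pairing M M q).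
Proof.
rewrite /mean_stat /mean_stat_signal -sumrB; apply: eq_big_nat => tau /andP[t2 tn].
rewrite -/(weight R n tau) mean_stat_at_quads; last by lia.
rewrite mulrA -/(mean_coef tau) /mean_signal_at -mulrBr sumrB; congr (_ * (_ - _)).
apply: eq_bigr => q _; apply: eq_bigr => k _.
by rewrite -!raw_diffE.
Qed.

Lemma poly_mean_term tau : poly xpredT 4 (fun w => mean_coef tau *
    \sum_(q in quads (ranges (A tau) (B tau) (A tau) (B tau)))
      (pairing (fun i j k => noise i j k w + M i j k)
         (fun i j k => noise i j k w + M i j k) q - pairing M M q)).
Proof.
apply: polyZ; under [X in poly _ _ X]eq_fun do rewrite sumrB.
apply: polyB; last exact: poly_cst.
apply: (@poly_sum_pairing _ _ _ _ _ _ _ _ (fun i j k w => noise i j k w + M i j k)).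
  move=> i j ri rj k; apply: polyD; last exact: poly_cst.
  by apply: poly_weaken (tensor_noise_diff X ri rj k).
exact: ranges_ge1.
Qed.

Lemma nice_mean_stat_dev : nice (fun w => (mean_stat n (xs w) - mean_stat_signal) ^+ 2).
Proof.
apply: (@poly_sqrw _ _ _ _ _ _ _ _ 4); under [X in poly _ _ X]eq_fun do rewrite mean_stat_decomp.
by apply: poly_sum => tau _; exact: poly_mean_term.
Qed.

Lemma mean_stat_noise :
  Ex (fun w => (mean_stat n (xs w) - mean_stat_signal) ^+ 2) <=
  n%:R ^+ 2 * (192 * 4 ^+ 2 * (4 ^+ 2 * kappa2 + n%:R * (4 * Num.sqrt kappa2 * delta2))).
Proof.
have k0 := kappa2_ge0 S1_sym S2_sym.
have d0 := delta2_ge0 mu1 mu2.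
have s0 := sqrtr_ge0 kappa2.
under [X in Ex X]eq_fun do rewrite mean_stat_decomp.
have tn i j : in_range i -> in_range j -> tensor (pred2 i j) 2 (noise i j).
  by move=> ri rj k; apply: poly_weaken (tensor_noise_diff X ri rj k).
apply: (@Ex_sqr_sum_nat _ _ _ _ _ _ _ X8).
- by lia.
- by [].
- apply: mulr_ge0; first by apply: mulr_ge0; [exact: ler0n|exact: sqr_ge0].
  apply: addr_ge0; first by apply: mulr_ge0; [exact: sqr_ge0|].
  apply: mulr_ge0; first exact: ler0n.
  by apply: mulr_ge0 => //; apply: mulr_ge0 => //; exact: ler0n.
- by move=> tau _; exact: poly_mean_term.
- move=> tau /[dup] htau /andP[t2 tn2].
  have [e0 ea] := mean_coef_bound htau.
  have cA : #|A tau| = tau by rewrite card_ord_itv ?subn1//; lia.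
  have cB : #|B tau| = (n - tau)%N by rewrite card_ord_itv// subSS.
  have mm : (0 < minn tau (n - tau) <= n)%N by rewrite /minn; case: ifP; lia.
  have c0 : 0 <= 4 * Num.sqrt kappa2 by rewrite mulr_ge0.
  have := @Ex_sqr_pairing _ _ _ _ _ _ _ indX X8 _ noise M (4 * Num.sqrt kappa2) delta2 _ _ c0 d0 _ _
    (ranges (A tau) (B tau) (A tau) (B tau)) (minn tau (n - tau)) _ mm _ (mean_coef tau) 4 e0.
  rewrite prod_ranges cA cB exprMn sqr_sqrtr// => H.
  apply: H.
  + by move=> i j ri rj _; exact: tn.
  + move=> i j k ri rj ij; rewrite /noise /noise_diff.
    have nc i' : in_range i' -> nice (centered (X i') k).
      by move=> ri'; apply: poly_weaken (tensor_centered X ri' k).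
    rewrite (ExB X8); [|exact: nc|exact: nc].
    by rewrite !(Ex_centered X8) ?subrr.
  + move=> i j ri rj _.
    apply: le_trans (gram_norm2_noise_diff X8 cov_cp S1_sym S2_sym ri rj) _.
    by rewrite (_ : 16 = 4 ^+ 2 :> R)//; ring.
  + by move=> i j ri rj; apply: mean_diff_sqr_le mean_cp _ _ _ _.
  + exact: ranges_ge1.
  + move=> s; have : (minn tau (n - tau) <= tau)%N /\ (minn tau (n - tau) <= n - tau)%N.
      by rewrite geq_minl geq_minr.
    by case=> h1 h2; case: s => -[|[|[|[|s]]]] h //=; rewrite /ranges/= ?cA ?cB.
  + exact: ea.
Qed.

(** Differences always go from the left of tau to the right, so a mean difference is either 0 or mu1
    - mu2, never its opposite. Hence the contributions of different quadruples cannot cancel. *)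
Lemma pairing_mean_diff tau (q : {ffun 'I_4 -> 'I_n.+1}) :
  q \in quads (ranges (A tau) (B tau) (A tau) (B tau)) ->
  pairing M M q = if [&& (q (inord 0) <= ts)%N, (ts < q (inord 1))%N,
    (q (inord 2) <= ts)%N & (ts < q (inord 3))%N] then delta2 else 0.
Proof.
rewrite mem_quads => /and5P[a0 b1 a2 b3 _].
have Mij (i j : 'I_n.+1) : i \in A tau -> j \in B tau -> forall k,
    M i j k = if (i <= ts)%N && (ts < j)%N then (mu1 - mu2) k 0 else 0.
  rewrite !inE => /andP[i1 it] /andP[tj jn] k; rewrite /M /mean_diff !mean_cp; [|lia|lia].
  case: (leqP i ts) => its; case: (leqP j ts) => jts /=; rewrite ?subrr ?mxE//.
  by exfalso; lia.
rewrite /pairing /dotk; case: ifPn => [/and4P[h0 h1 h2 h3]|hN].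
  by apply: eq_bigr => k _; rewrite !Mij// h0 h1 h2 h3.
apply: big1 => k _; rewrite !Mij//; move: hN.
by case: (q (inord 0) <= ts)%N => /=; case: (ts < q (inord 1))%N => /= ; rewrite ?mul0r//;
  case: (q (inord 2) <= ts)%N => /=; case: (ts < q (inord 3))%N => /= ; rewrite ?mulr0//.
Qed.

Lemma mean_signal_at_ge0 tau : (2 <= tau < (n - 2).+1)%N -> 0 <= mean_signal_at tau.
Proof.
move=> ht; have [e0 _] := mean_coef_bound ht; apply: mulr_ge0 => //.
apply: sumr_ge0 => q qr; rewrite (pairing_mean_diff qr).
by case: ifP => // _; exact: delta2_ge0.
Qed.

Variable c : R.
Hypotheses (c0 : 0 <= c) (cts : c * n%:R <= ts%:R) (cnts : c * n%:R <= (n - ts)%N%:R).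
Hypotheses (ts32 : (32 <= ts)%N) (nts32 : (32 <= n - ts)%N).

(** Quadruples whose left indices are at most min (tau, ts) and whose right indices exceed max (tau,
    ts) contribute [delta2] each. One of the counts a, b is a full side of tau and the other is at
    least c n, so a b >= c tau (n - tau); the 1/2 pays for repeated indices. *)
Lemma mean_signal_at_ge tau : (32 <= tau < (n - 32).+1)%N ->
  weight R n tau * (c ^+ 2 / 2 * delta2) <= mean_signal_at tau.
Proof.
move=> /andP[t32 tn]; have ht : (2 <= tau < (n - 2).+1)%N by lia.
have d0 := delta2_ge0 mu1 mu2; have [e0 _] := mean_coef_bound ht.
pose a := minn tau ts; pose b := (n - maxn tau ts)%N.
pose A' := ord_itv n 1 a.+1; pose B' := ord_itv n (maxn tau ts).+1 n.+1.
have [an bn] : (a <= n)%N /\ (maxn tau ts <= n)%N by rewrite /a; split; lia.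
have cA : #|A'| = a by rewrite card_ord_itv ?subn1.
have cB : #|B'| = b by rewrite card_ord_itv// subSS.
have sub : quads (ranges A' B' A' B') \subset quads (ranges (A tau) (B tau) (A tau) (B tau)).
  apply/fintype.subsetP => q; rewrite !mem_quads => /and5P[].
  rewrite !inE => /andP[-> h0] /andP[h1 ->] /andP[-> h2] /andP[h3 ->] ->.
  by rewrite !andbT /=; rewrite /a in h0 h2; apply/and4P; split; lia.
have qge : ((a * b) ^ 2)%N%:R / 2 <= #|quads (ranges A' B' A' B')|%:R :> R.
  have := @card_quads_ge _ (ranges A' B' A' B') 32.
  rewrite prod_ranges cA cB => /(_ _ isT) h.
  rewrite ler_pdivrMr// -natrM ler_nat [leqRHS]mulnC.
  rewrite (_ : ((a * b) ^ 2 = a * b * a * b)%N); last by rewrite -mulnn mulnA.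
  apply: h => s; have [h1 h2] : (32 <= a)%N /\ (32 <= b)%N by rewrite /a /b; split; lia.
  by case: s => -[|[|[|[|s]]]] h //=; rewrite /ranges/= ?cA ?cB.
have sumge : delta2 * (((a * b) ^ 2)%N%:R / 2) <=
    \sum_(q in quads (ranges (A tau) (B tau) (A tau) (B tau))) pairing M M q.
  rewrite (big_setID (quads (ranges A' B' A' B')))/= (finset.setIidPr sub).
  apply: (@le_trans _ _ (\sum_(q in quads (ranges A' B' A' B')) pairing M M q)); last first.
    rewrite lerDl; apply: sumr_ge0 => q; rewrite inE => /andP[_ qr].
    by rewrite (pairing_mean_diff qr); case: ifP.
  apply: (@le_trans _ _ (\sum_(q in quads (ranges A' B' A' B')) delta2)).
    by rewrite sumr_const -[leRHS]mulr_natr ler_wpM2l.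
  apply: ler_sum => q qr.
  rewrite (pairing_mean_diff (fintype.subsetP sub _ qr)) ifT//.
  move: qr; rewrite mem_quads => /and5P[].
  rewrite !inE => /andP[_ h0] /andP[h1 _] /andP[_ h2] /andP[h3 _] _.
  by rewrite /a in h0 h2; apply/and4P; split; lia.
have tR : 0 < tau%:R :> R by rewrite ltr0n; lia.
have ntR : 0 < (n - tau)%N%:R :> R by rewrite ltr0n; lia.
have abge : c * (tau * (n - tau))%N%:R <= (a * b)%N%:R.
  rewrite !natrM /a /b; have [tts|/ltnW tts] := leqP tau ts.
    rewrite mulrCA ler_wpM2l ?ler0n//; apply: le_trans cnts.
    by rewrite ler_wpM2l// ler_nat leq_subr.
  rewrite mulrA ler_wpM2r ?ler0n//; apply: le_trans cts.
  by rewrite ler_wpM2l// ler_nat; lia.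
set x := (tau * (n - tau))%N in abge.
have x0 : 0 < x%:R :> R by rewrite /x natrM mulr_gt0.
have coefge : weight R n tau / x%:R ^+ 2 <= mean_coef tau.
  have [D0 Dle] := mean_norm_bounds ht.
  rewrite ler_wpM2l ?weight_ge0// lef_pV2 ?posrE ?exprn_gt0// ?ltr0n//.
  by rewrite expr2 -natrM ler_nat.
have w0 := weight_ge0 R n tau.
have ab2 : c ^+ 2 * x%:R ^+ 2 <= ((a * b) ^ 2)%N%:R.
  by rewrite natrX -exprMn lerXn2r ?nnegrE ?mulr_ge0// ler0n.
apply: (@le_trans _ _ (weight R n tau / x%:R ^+ 2 *
  (delta2 * (((a * b) ^ 2)%N%:R / 2)))); last first.
  apply: ler_pM => //; first by rewrite divr_ge0// sqr_ge0.
  by rewrite mulr_ge0// divr_ge0// ler0n.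
have -> : weight R n tau * (c ^+ 2 / 2 * delta2) =
  weight R n tau / x%:R ^+ 2 * (delta2 * (c ^+ 2 * x%:R ^+ 2 / 2)) by field; rewrite gt_eqF.
rewrite ler_wpM2l ?divr_ge0 ?sqr_ge0// ler_wpM2l//.
by rewrite ler_pM2r// invr_gt0.
Qed.

Lemma mean_stat_signal_ge : (128 <= n)%N ->
  n%:R ^+ 2 / 32 * (c ^+ 2 / 2 * delta2) <= mean_stat_signal.
Proof.
move=> n128; have d0 := delta2_ge0 mu1 mu2.
have hw := @sum_weight_ge R n 32 n128 isT.
apply: (@le_trans _ _ (\sum_(32 <= tau < (n - 32).+1) mean_signal_at tau)).
  apply: (@le_trans _ _ ((\sum_(32 <= tau < (n - 32).+1) weight R n tau) * (c ^+ 2 / 2 * delta2))).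
    by rewrite ler_wpM2r// mulr_ge0// divr_ge0// sqr_ge0.
  rewrite mulr_suml big_nat [leRHS]big_nat; apply: ler_sum => tau.
  exact: mean_signal_at_ge.
have e1 : mean_stat_signal = \sum_(2 <= tau < 32) mean_signal_at tau +
    \sum_(32 <= tau < (n - 2).+1) mean_signal_at tau.
  by rewrite /mean_stat_signal (big_cat_nat _ (n := 32))//=; lia.
have e2 : \sum_(32 <= tau < (n - 2).+1) mean_signal_at tau =
    \sum_(32 <= tau < (n - 32).+1) mean_signal_at tau +
    \sum_((n - 32).+1 <= tau < (n - 2).+1) mean_signal_at tau.
  by rewrite (big_cat_nat _ (n := (n - 32).+1))//=; lia.
rewrite e1 e2.
have s0 u v : (2 <= u)%N -> (v <= (n - 2).+1)%N -> 0 <= \sum_(u <= tau < v) mean_signal_at tau.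
  move=> u2 vn; rewrite big_nat; apply: sumr_ge0 => tau /andP[h1 h2].
  by apply: mean_signal_at_ge0; lia.
have := s0 2 32%N isT ltac:(lia); have := s0 (n - 32).+1 (n - 2).+1 ltac:(lia) ltac:(lia).
lra.
Qed.

End MeanStatistic.

(** * The covariance statistic *)

(** At a = 4 the ratio of the fourth power to the falling factorial is 256 / 24 = 32 / 3, which 12
    exceeds. *)
Lemma ffact4_ge (R : realType) (a : nat) : (4 <= a)%N ->
  0 < (a ^_ 4)%:R :> R /\ (a ^_ 4)%:R <= a%:R ^+ 4 :> R /\ a%:R ^+ 4 <= 12 * (a ^_ 4)%:R :> R.
Proof.
move=> a4; rewrite natr_ffact4//.
have x4 : 4 <= a%:R :> R by rewrite ler_nat.
set x := a%:R in x4 *.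
have h1 : 0 < x * (x - 1) by nra.
have h2 : 0 < (x - 2) * (x - 3) by nra.
have h3 : x * (x - 1) <= x ^+ 2 by nra.
have h4 : (x - 2) * (x - 3) <= x ^+ 2 by nra.
have h5 : 3 * x ^+ 2 <= 4 * (x * (x - 1)) by nra.
have h6 : x ^+ 2 <= 8 * ((x - 2) * (x - 3)) by nra.
have e : x * (x - 1) * (x - 2) * (x - 3) = (x * (x - 1)) * ((x - 2) * (x - 3)) by ring.
have e2 : x ^+ 4 = x ^+ 2 * x ^+ 2 by ring.
rewrite e e2; split; first exact: mulr_gt0.
split; first by apply: ler_pM => //; exact: ltW.
have : (3 * x ^+ 2) * x ^+ 2 <= (4 * (x * (x - 1))) * (8 * ((x - 2) * (x - 3))).
  by apply: ler_pM => //; rewrite ?mulr_ge0// sqr_ge0.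
nra.
Qed.

Lemma ffact2_ge (R : realType) (a : nat) : (2 <= a)%N ->
  0 < (a ^_ 2)%:R :> R /\ a%:R ^+ 2 <= 2 * (a ^_ 2)%:R :> R.
Proof.
move=> a2; rewrite natr_ffact2//.
have x2 : 2 <= a%:R :> R by rewrite ler_nat.
by split; nra.
Qed.

Section CovStatistic.
Context d (T : measurableType d) (R : realType) (P : probability T R)
  (n p : nat) (X : nat -> 'I_p -> {RV P >-> R}).
Hypothesis indX : independent_vectors n X.
Hypothesis X8 : moments8 P n X.
Local Notation poly := (poly n X).
Local Notation nice := (poly xpredT 8).
Local Notation tensor := (tensor n X).
Local Notation Ex := (Ex P).
Local Notation gram_norm2 := (gram_norm2 P).
Local Notation in_range i := (1 <= i <= n)%N.
Local Notation Sigma i := (cov_mx (X i)).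
Local Notation KK := ('I_p * 'I_p)%type.

Variables (mu1 mu2 : 'cV[R]_p) (S1 S2 : 'M[R]_p) (ts : nat) (C4 : R).
Hypothesis mean_cp : forall i, in_range i ->
  mean_vec (X i) = if (i <= ts)%N then mu1 else mu2.
Hypothesis cov_cp : forall i, in_range i -> Sigma i = if (i <= ts)%N then S1 else S2.
Hypothesis C4_ge0 : 0 <= C4.
Hypothesis fourth : forall i, in_range i ->
  gram_norm2 (outer (centered (X i)) (centered (X i))) <= C4 * \tr (Sigma i ^+ 2) ^+ 2.
Hypotheses (S1_sym : sym_mx S1) (S2_sym : sym_mx S2).

Local Notation delta2 := (delta2 mu1 mu2).
Local Notation kappa := (kappa mu1 mu2 S1 S2).
Let W i j : KK -> T -> R := outer (raw_diff X i j) (raw_diff X i j).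
Let D2 : R := \tr ((S1 - S2) ^+ 2).

Definition outer_mean i j (kl : KK) : R :=
  Sigma i kl.1 kl.2 + Sigma j kl.1 kl.2 + mean_diff X i j kl.1 * mean_diff X i j kl.2.

Lemma tensor_raw_diff i j : in_range i -> in_range j -> tensor (pred2 i j) 1 (raw_diff X i j).
Proof.
by move=> ri rj k; apply: polyD; [exact: tensor_noise_diff|exact: poly_cst].
Qed.

Lemma tensor_outer_raw i j : in_range i -> in_range j -> tensor (pred2 i j) 2 (W i j).
Proof. by move=> ri rj; apply: (tensor_outer (k := 1) (m := 1)); exact: tensor_raw_diff. Qed.

Lemma Ex_outer_raw i j kl : in_range i -> in_range j -> i != j ->
  Ex (W i j kl) = outer_mean i j kl.
Proof.
move=> ri rj ij; case: kl => k l; rewrite /W /outer/= /raw_diff /noise_diff.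
set yi := centered (X i); set yj := centered (X j).
set a := mean_diff X i j k; set b := mean_diff X i j l.
have pi k' : poly (pred1 i) 1 (yi k') by exact: tensor_centered.
have pj k' : poly (pred1 j) 1 (yj k') by exact: tensor_centered.
have wi k' : poly xpredT 1 (yi k') by apply: poly_weaken (pi k').
have wj k' : poly xpredT 1 (yj k') by apply: poly_weaken (pj k').
have dij x : ~~ (pred1 i x && pred1 j x).
  by apply/negP => /andP[/= /eqP -> /eqP e]; move: ij; rewrite e eqxx.
have n2 f g : poly xpredT 1 f -> poly xpredT 1 g -> nice (fun w => f w * g w).
  by move=> pf pg; apply: poly_weaken (polyM pf pg).
have n1 f : poly xpredT 1 f -> nice f by move=> pf; apply: poly_weaken pf.
have pu k' : poly xpredT 1 (fun w => yi k' w - yj k' w) by exact: polyB.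
rewrite (_ : (fun w => _) = fun w => ((yi k w * yi l w + yj k w * yj l w) -
   (yi k w * yj l w + yi l w * yj k w)) +
   (b * (yi k w - yj k w) + (a * (yi l w - yj l w) + a * b))); last first.
  by apply/funext => w; ring.
have nA : nice (fun w => yi k w * yi l w + yj k w * yj l w) by apply: polyD; exact: n2.
have nB : nice (fun w => yi k w * yj l w + yi l w * yj k w) by apply: polyD; exact: n2.
have nC : nice (fun w => b * (yi k w - yj k w)) by apply: polyZ; exact: n1 (pu k).
have nD : nice (fun w => a * (yi l w - yj l w)) by apply: polyZ; exact: n1 (pu l).
have nE : nice (fun w => a * (yi l w - yj l w) + a * b) by apply: polyD => //; exact: poly_cst.
rewrite (ExD X8); [|exact: polyB|exact: polyD].
rewrite (ExB X8)// (ExD X8); [|exact: n2|exact: n2].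
rewrite (ExD X8); [|exact: n2|exact: n2].
rewrite (ExD X8)// (ExD X8)//; last exact: poly_cst.
rewrite (ExZ X8 b (n1 _ (pu k))) (ExZ X8 a (n1 _ (pu l))).
rewrite !(ExB X8 (n1 _ (wi _)) (n1 _ (wj _))).
rewrite !(Ex_centered X8)// Ex_cst.
rewrite (Ex_indepM indX X8 dij _ (pi k) (pj l))// (Ex_indepM indX X8 dij _ (pi l) (pj k))//.
rewrite !(Ex_centered X8)//.
have -> : Ex (fun w => yi k w * yi l w) = Sigma i k l by exact: (gram_centered X k l ri).
have -> : Ex (fun w => yj k w * yj l w) = Sigma j k l by exact: (gram_centered X k l rj).
by rewrite /outer_mean/= -/a -/b; ring.
Qed.

Section Base.
(* [bs] tells which segment provides the centring matrix; [other i] tells that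
   [i] lies in the opposite segment. *)
Variable bs : bool.
Let Sb := if bs then S1 else S2.
Definition other (i : nat) : bool := (i <= ts)%N != bs.
Definition cov_jump (kl : KK) : R := (if bs then S2 - S1 else S1 - S2) kl.1 kl.2.
Definition mean_jump2 (kl : KK) : R := (mu1 - mu2) kl.1 0 * (mu1 - mu2) kl.2 0.
Definition shifted_mean i j (kl : KK) : R := outer_mean i j kl - 2 * Sb kl.1 kl.2.

(** The gain of the shift: pairs inside the base segment have mean zero, mixed pairs one covariance
    jump plus the outer square of the mean jump, and pairs inside the opposite segment twice the
    covariance jump. *)
Lemma shifted_meanE i j kl : in_range i -> in_range j ->
  shifted_mean i j kl = ((other i)%:R + (other j)%:R) * cov_jump kl +
    (other i != other j)%:R * mean_jump2 kl.
Proof.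
move=> ri rj; rewrite /shifted_mean /outer_mean /mean_diff /cov_jump /mean_jump2 /other /Sb.
rewrite !mean_cp// !cov_cp//.
by case: bs; case: (i <= ts)%N; case: (j <= ts)%N; rewrite /= !mxE; ring.
Qed.

Lemma cov_jump_sqr : dotk cov_jump cov_jump = D2.
Proof.
rewrite /D2 tr_sqr_sym; last by move=> k l; rewrite !mxE S1_sym S2_sym.
rewrite pair_bigA/=; apply: eq_bigr => -[k l] _; rewrite /cov_jump/=.
by case: bs; rewrite !mxE; ring.
Qed.

Lemma mean_jump2_sqr : dotk mean_jump2 mean_jump2 = delta2 ^+ 2.
Proof.
rewrite expr2 /delta2 /dotv big_distrlr/= pair_bigA/=; apply: eq_bigr => -[k l] _.
by rewrite /mean_jump2/=; ring.
Qed.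

Lemma shifted_mean_sqr_le i j : in_range i -> in_range j ->
  dotk (shifted_mean i j) (shifted_mean i j) <= 8 * (D2 + delta2 ^+ 2).
Proof.
move=> ri rj; rewrite -cov_jump_sqr -mean_jump2_sqr /dotk -big_split/= big_distrr/=.
apply: ler_sum => kl _; rewrite shifted_meanE//.
set e := cov_jump kl; set f := mean_jump2 kl.
have := sqr_ge0 (e - f); have := sqr_ge0 e; have := sqr_ge0 f.
by case: (other i); case: (other j) => /=; lra.
Qed.

(** With e the covariance jump and f the outer square of the mean jump, each factor is 0, e + f or 2
    e. The only product that can be negative is 2 e (e + f), whose minimum over e is - f^2 / 2, at e
    = - f / 2. *)
Lemma pairing_shifted_ge (q : {ffun 'I_4 -> 'I_n.+1}) : (forall s, in_range (q s)) ->
  - (delta2 ^+ 2 / 2) <= pairing shifted_mean shifted_mean q.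
Proof.
move=> rq; rewrite -mean_jump2_sqr lerNl -subr_ge0 opprK /pairing /dotk mulr_suml -big_split/=.
apply: sumr_ge0 => kl _; rewrite !shifted_meanE//.
set e := cov_jump kl; set f := mean_jump2 kl.
have := sqr_ge0 (e + f); have := sqr_ge0 e; have := sqr_ge0 f; have := sqr_ge0 (2 * e + f).
by case: (other _); case: (other _); case: (other _); case: (other _) => /=; lra.
Qed.

Lemma pairing_shifted_other (q : {ffun 'I_4 -> 'I_n.+1}) : (forall s, in_range (q s)) ->
  (forall s, other (q s)) -> pairing shifted_mean shifted_mean q = 4 * D2.
Proof.
move=> rq oq; rewrite -cov_jump_sqr /pairing /dotk big_distrr/=.
by apply: eq_bigr => kl _; rewrite !shifted_meanE// !oq/=; ring.
Qed.

Lemma pairing_shifted0 (q : {ffun 'I_4 -> 'I_n.+1}) : (forall s, in_range (q s)) ->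
  ~~ other (q (inord 0)) -> ~~ other (q (inord 1)) ->
  pairing shifted_mean shifted_mean q = 0.
Proof.
move=> rq o0 o1; rewrite /pairing /dotk big1// => kl _.
by rewrite !shifted_meanE// (negbTE o0) (negbTE o1)/= addr0 !mul0r addr0 mul0r.
Qed.

Let Q i j kl w := W i j kl w - outer_mean i j kl.
(** 104^2 = 10816 leaves room above 64 * (33 + 128) = 10304, the constant of
    [gram_norm2_outer_raw_diff] at C4 = 0. *)
Let c : R := 104 * (1 + C4) * kappa.

Lemma noise_bound_ge0 : 0 <= c.
Proof.
rewrite /c; apply: mulr_ge0; last exact: kappa_ge0.
by apply: mulr_ge0; [exact: ler0n|rewrite addr_ge0].
Qed.

Lemma tensor_Q i j : in_range i -> in_range j -> tensor (pred2 i j) 2 (Q i j).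
Proof. by move=> ri rj kl; apply: polyB; [exact: tensor_outer_raw|exact: poly_cst]. Qed.

Lemma gram_norm2_Q i j : in_range i -> in_range j -> i != j ->
  gram_norm2 (Q i j) <= c ^+ 2.
Proof.
move=> ri rj ij.
have -> : Q i j = fun kl w => W i j kl w - Ex (W i j kl).
  by apply/funext => kl; apply/funext => w; rewrite /Q Ex_outer_raw.
apply: (@le_trans _ _ (gram_norm2 (W i j))).
  apply: (gram_norm2_center X8) => kl.
  by apply: poly_weaken (tensor_outer_raw ri rj kl).
apply: le_trans (gram_norm2_outer_raw_diff indX X8 mean_cp cov_cp C4_ge0 fourth
  S1_sym S2_sym ri rj ij) _.
rewrite /c exprMn ler_wpM2r ?sqr_ge0//.
by have := C4_ge0; nra.
Qed.

Definition block_noise (r : 'I_4 -> {set 'I_n.+1}) w : R := \sum_(q in quads r)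
  (pairing (fun i j k => Q i j k w + shifted_mean i j k)
     (fun i j k => Q i j k w + shifted_mean i j k) q - pairing shifted_mean shifted_mean q).

Let D2_ge0 : 0 <= D2.
Proof. by rewrite -cov_jump_sqr; apply: sumr_ge0 => kl _; rewrite -expr2 sqr_ge0. Qed.

Lemma Ex_block_noise (r : 'I_4 -> {set 'I_n.+1}) m e :
  (forall s i, i \in r s -> (1 <= i)%N) -> (0 < m <= n)%N -> (forall s, (m <= #|r s|)%N) ->
  0 <= e -> e * (\prod_s #|r s|)%N%:R <= 3 * m%:R ->
  Ex (fun w => (e * block_noise r w) ^+ 2) <=
  192 * 3 ^+ 2 * (c ^+ 2 + n%:R * (c * (8 * (D2 + delta2 ^+ 2)))).
Proof.
move=> r1 mn rm e0 ea; apply: (Ex_sqr_pairing indX X8) r1 mn rm _ _ e0 ea.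
- by move=> i j ri rj _; exact: tensor_Q.
- move=> i j kl ri rj ij; rewrite /Q (ExB X8); last exact: poly_cst.
    by rewrite Ex_cst Ex_outer_raw// subrr.
  by apply: poly_weaken (tensor_outer_raw ri rj kl).
- exact: noise_bound_ge0.
- by apply: mulr_ge0; [exact: ler0n|rewrite addr_ge0// sqr_ge0].
- exact: gram_norm2_Q.
- exact: shifted_mean_sqr_le.
Qed.

Lemma poly_block_noise (r : 'I_4 -> {set 'I_n.+1}) e :
  (forall s i, i \in r s -> (1 <= i)%N) -> poly xpredT 4 (fun w => e * block_noise r w).
Proof.
move=> r1; apply: polyZ; rewrite /block_noise.
under [X in poly _ _ X]eq_fun do rewrite sumrB.
apply: polyB; last exact: poly_cst.
apply: (@poly_sum_pairing _ _ _ _ _ _ _ _ (fun i j k w => Q i j k w + shifted_mean i j k)) => //.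
move=> i j ri rj k; apply: polyD; last exact: poly_cst.
by apply: poly_weaken (tensor_Q ri rj k).
Qed.

End Base.

End CovStatistic.

Lemma minn_range n tau : (0 < tau)%N -> (0 < n - tau)%N -> (0 < minn tau (n - tau) <= n)%N.
Proof. by rewrite /minn; case: ifP => _; lia. Qed.

Section CovStatisticTotal.
Context d (T : measurableType d) (R : realType) (P : probability T R)
  (n p : nat) (X : nat -> 'I_p -> {RV P >-> R}).
Hypothesis indX : independent_vectors n X.
Hypothesis X8 : moments8 P n X.
Local Notation poly := (poly n X).
Local Notation nice := (poly xpredT 8).
Local Notation Ex := (Ex P).
Local Notation gram_norm2 := (gram_norm2 P).
Local Notation in_range i := (1 <= i <= n)%N.
Local Notation Sigma i := (cov_mx (X i)).

Variables (mu1 mu2 : 'cV[R]_p) (S1 S2 : 'M[R]_p) (ts : nat) (C4 : R).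
Hypothesis mean_cp : forall i, in_range i ->
  mean_vec (X i) = if (i <= ts)%N then mu1 else mu2.
Hypothesis cov_cp : forall i, in_range i -> Sigma i = if (i <= ts)%N then S1 else S2.
Hypotheses (S1_sym : sym_mx S1) (S2_sym : sym_mx S2).

Local Notation delta2 := (delta2 mu1 mu2).
Local Notation kappa := (kappa mu1 mu2 S1 S2).
Local Notation A tau := (ord_itv n 1 tau.+1).
Local Notation B tau := (ord_itv n tau.+1 n.+1).
Local Notation D2 := (\tr ((S1 - S2) ^+ 2)).
Let xs w := realized_sample X w.
(** The base is the segment that contains one whole side of tau: the left side if tau <= ts, the
    right side otherwise. Pairs on that side then have shifted mean zero. *)
Let bs tau := (tau <= ts)%N.
Let M tau := shifted_mean X S1 S2 (bs tau).
Let N tau (r : 'I_4 -> {set 'I_n.+1}) w := block_noise X S1 S2 (bs tau) r w.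
Let c : R := 104 * (1 + C4) * kappa.

Definition cov_signal_at tau : R :=
  weight R n tau * (4^-1 * two_sample_stat (A tau) (B tau) (M tau)).
Definition cov_stat_signal : R := \sum_(4 <= tau < (n - 4).+1) cov_signal_at tau.

Let e1 tau : R := weight R n tau / 4 * (tau ^_ 4)%:R^-1.
Let e2 tau : R := weight R n tau / 4 * ((n - tau) ^_ 4)%:R^-1.
Let e3 tau : R := weight R n tau / 4 * (2 / (tau ^_ 2 * (n - tau) ^_ 2)%:R).

Let card_A tau : (tau <= n)%N -> #|A tau| = tau.
Proof. by move=> tn; rewrite card_ord_itv ?subn1. Qed.

Let card_B tau : #|B tau| = (n - tau)%N.
Proof. by rewrite card_ord_itv// subSS. Qed.

Lemma cov_stat_decomp w : cov_stat n (xs w) - cov_stat_signal =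
  \sum_(4 <= tau < (n - 4).+1)
    (e1 tau * N tau (ranges (A tau) (A tau) (A tau) (A tau)) w
     + e2 tau * N tau (ranges (B tau) (B tau) (B tau) (B tau)) w
     - e3 tau * N tau (ranges (A tau) (A tau) (B tau) (B tau)) w).
Proof.
rewrite /cov_stat /cov_stat_signal -sumrB; apply: eq_big_nat => tau /andP[t4 tn].
have nt4 : (4 <= n - tau)%N by lia.
rewrite -/(weight R n tau) cov_stat_at_quads// /cov_signal_at -mulrBr -mulrBr.
have cA : #|A tau| = tau by apply: card_A; lia.
have cB := card_B tau.
pose Sb := if bs tau then S1 else S2.
(* The observed statistic is not changed by the unknown matrix 2 Sb, so a different matrix may be
   subtracted for each tau. *)
rewrite -(two_sample_stat_shift (ord_itv_disjoint n tau) _ _ _ (fun kl => 2 * Sb kl.1 kl.2))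
  ?cA ?cB//.
pose G i j kl :=
  (outer (raw_diff X i j) (raw_diff X i j) kl w - outer_mean X i j kl) + M tau i j kl.
have -> : (fun i j kl => sqdiff_tensor (xs w) i j kl - 2 * Sb kl.1 kl.2) = G.
  apply/funext => i; apply/funext => j; apply/funext => kl.
  rewrite /G /M /shifted_mean -/Sb /outer !raw_diffE /sqdiff_tensor /diff_tensor.
  by ring.
rewrite /two_sample_stat cA cB /N /block_noise /e1 /e2 /e3 !sumrB -/(M tau).
set a1 := \sum_(q in _) _; set a2 := \sum_(q in _) _; set a3 := \sum_(q in _) _.
set b1 := \sum_(q in _) _; set b2 := \sum_(q in _) _; set b3 := \sum_(q in _) _.
by ring.
Qed.

Let ge1A tau (i : 'I_n.+1) : i \in A tau -> (1 <= i)%N.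
Proof. by rewrite inE => /andP[]. Qed.
Let ge1B tau (i : 'I_n.+1) : i \in B tau -> (1 <= i)%N.
Proof. by rewrite inE => /andP[h _]; exact: leq_ltn_trans h. Qed.

Let ranges_ge1 (C D : {set 'I_n.+1}) : (forall i, i \in C -> (1 <= i)%N) ->
  (forall i, i \in D -> (1 <= i)%N) ->
  forall s i, i \in ranges C C D D s -> (1 <= i)%N.
Proof.
move=> hC hD [[|[|[|[|s]]]] h] i //=; rewrite /ranges/=.
- exact: hC.
- exact: hC.
- exact: hD.
- exact: hD.
Qed.

Let ranges_card (C D : {set 'I_n.+1}) m : (m <= #|C|)%N -> (m <= #|D|)%N ->
  forall s, (m <= #|ranges C C D D s|)%N.
Proof. by move=> hC hD [[|[|[|[|s]]]] h]. Qed.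

(** The mass conditions of [Ex_block_noise] for the three sums. For the pure ones 3 = 12 / 4, with
    12 from [ffact4_ge] and 4 from the kernel; the mixed one needs only 8 / 4 = 2. *)
Lemma cov_coef_bounds tau : (4 <= tau < (n - 4).+1)%N ->
  [/\ 0 <= e1 tau, 0 <= e2 tau & 0 <= e3 tau] /\
  [/\ e1 tau * tau%:R ^+ 4 <= 3 * tau%:R, e2 tau * (n - tau)%N%:R ^+ 4 <= 3 * (n - tau)%N%:R &
      e3 tau * (tau%:R ^+ 2 * (n - tau)%N%:R ^+ 2) <= 3 * (minn tau (n - tau))%:R].
Proof.
move=> /andP[t4 tn]; have nt4 : (4 <= n - tau)%N by lia.
have w0 := weight_ge0 R n tau.
have [f1 [_ f2]] := ffact4_ge R t4; have [g1 [_ g2]] := ffact4_ge R nt4.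
have [h1 h2] := @ffact2_ge R _ (leq_trans (isT : (2 <= 4)%N) t4).
have [k1 k2] := @ffact2_ge R _ (leq_trans (isT : (2 <= 4)%N) nt4).
have wl := weight_lel R n tau; have wr := weight_ler R n tau.
split.
  split; rewrite /e1 /e2 /e3; apply: mulr_ge0; rewrite ?divr_ge0 ?invr_ge0 ?ler0n//.
split.
- rewrite /e1 -mulrA mulrC; apply: (@le_trans _ _ (12 * (weight R n tau / 4))).
    by rewrite ler_wpM2r ?divr_ge0// mulrC ler_pdivrMr.
  by lra.
- rewrite /e2 -mulrA mulrC; apply: (@le_trans _ _ (12 * (weight R n tau / 4))).
    by rewrite ler_wpM2r ?divr_ge0// mulrC ler_pdivrMr.
  by lra.
- have wm : weight R n tau <= (minn tau (n - tau))%:R by rewrite /minn; case: ifP.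
  have wm0 := le_trans w0 wm.
  rewrite /e3 natrM -mulrA; apply: (@le_trans _ _ (weight R n tau / 4 * 8)); last by lra.
  rewrite ler_wpM2l ?divr_ge0// mulrAC ler_pdivrMr ?mulr_gt0//.
  have : tau%:R ^+ 2 * (n - tau)%N%:R ^+ 2 <= (2 * (tau ^_ 2)%:R) * (2 * ((n - tau) ^_ 2)%:R) :> R.
    by apply: ler_pM => //; exact: sqr_ge0.
  by lra.
Qed.

Let poly_block tau e (C D : {set 'I_n.+1}) : (forall i, i \in C -> (1 <= i)%N) ->
  (forall i, i \in D -> (1 <= i)%N) -> poly xpredT 4 (fun w => e * N tau (ranges C C D D) w).
Proof. by move=> hC hD; apply: poly_block_noise; exact: ranges_ge1. Qed.

Lemma poly_cov_term tau :
  poly xpredT 4 (fun w => e1 tau * N tau (ranges (A tau) (A tau) (A tau) (A tau)) w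
     + e2 tau * N tau (ranges (B tau) (B tau) (B tau) (B tau)) w
     - e3 tau * N tau (ranges (A tau) (A tau) (B tau) (B tau)) w).
Proof.
apply: polyB; last by apply: poly_block; [exact: ge1A|exact: ge1B].
by apply: polyD; apply: poly_block; [exact: ge1A|exact: ge1A|exact: ge1B|exact: ge1B].
Qed.

Lemma nice_cov_stat_dev : nice (fun w => (cov_stat n (xs w) - cov_stat_signal) ^+ 2).
Proof.
apply: (@poly_sqrw _ _ _ _ _ _ _ _ 4); under [X in poly _ _ X]eq_fun do rewrite cov_stat_decomp.
by apply: poly_sum => tau _; exact: poly_cov_term.
Qed.

Section NoiseBound.
Hypothesis C4_ge0 : 0 <= C4.
Hypothesis fourth : forall i, in_range i ->
  gram_norm2 (outer (centered (X i)) (centered (X i))) <= C4 * \tr (Sigma i ^+ 2) ^+ 2.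

Lemma cov_stat_noise : Ex (fun w => (cov_stat n (xs w) - cov_stat_signal) ^+ 2) <=
  n%:R ^+ 2 * (9 * (192 * 3 ^+ 2 * (c ^+ 2 + n%:R * (c * (8 * (D2 + delta2 ^+ 2)))))).
Proof.
set V := 192 * _ * _.
have c0 := noise_bound_ge0 mu1 mu2 C4_ge0 S1_sym S2_sym.
have D20 : 0 <= D2.
  by apply: tr_sqr_ge0 => k l; rewrite !mxE S1_sym S2_sym.
have V0 : 0 <= V.
  rewrite /V; apply: mulr_ge0; first by apply: mulr_ge0; [exact: ler0n|exact: sqr_ge0].
  apply: addr_ge0; first exact: sqr_ge0.
  apply: mulr_ge0; first exact: ler0n.
  apply: mulr_ge0; first exact: c0.
  by apply: mulr_ge0; [exact: ler0n|rewrite addr_ge0// sqr_ge0].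
under [X in Ex X]eq_fun do rewrite cov_stat_decomp.
apply: (@Ex_sqr_sum_nat _ _ _ _ _ _ _ X8).
- by lia.
- by [].
- by apply: mulr_ge0; [exact: ler0n|].
- by move=> tau _; exact: poly_cov_term.
move=> tau /[dup] htau /andP[t4 tn].
have nt4 : (4 <= n - tau)%N by lia.
have [tn1 tn2] : (0 < tau <= n)%N /\ (0 < n - tau <= n)%N by lia.
have cA : #|A tau| = tau by apply: card_A; lia.
have cB := card_B tau.
have [[e10 e20 e30] [b1 b2 b3]] := cov_coef_bounds htau.
pose h1 w := e1 tau * N tau (ranges (A tau) (A tau) (A tau) (A tau)) w.
pose h2 w := e2 tau * N tau (ranges (B tau) (B tau) (B tau) (B tau)) w.
pose h3 w := e3 tau * N tau (ranges (A tau) (A tau) (B tau) (B tau)) w.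
have H := Ex_block_noise indX X8 mean_cp cov_cp C4_ge0 fourth S1_sym S2_sym (bs tau).
have E1 : Ex (fun w => h1 w ^+ 2) <= V.
  apply: (H _ tau) => //.
  - by apply: ranges_ge1; exact: ge1A.
  - by apply: ranges_card; rewrite cA.
  - by rewrite prod_ranges cA (_ : (tau * tau * tau * tau = tau ^ 4)%N) ?natrX//; ring.
have E2 : Ex (fun w => h2 w ^+ 2) <= V.
  apply: (H _ (n - tau)%N) => //.
  - by apply: ranges_ge1; exact: ge1B.
  - by apply: ranges_card; rewrite cB.
  - rewrite prod_ranges cB; move: b2; set u := (n - tau)%N.
    by rewrite (_ : (u * u * u * u = u ^ 4)%N) ?natrX//; ring.
have E3 : Ex (fun w => h3 w ^+ 2) <= V.
  apply: (H _ (minn tau (n - tau))) => //.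
  - by apply: ranges_ge1; [exact: ge1A|exact: ge1B].
  - by apply: minn_range; [exact: leq_trans t4|exact: leq_trans nt4].
  - by apply: ranges_card; rewrite ?cA ?cB ?geq_minl ?geq_minr.
  - rewrite prod_ranges cA cB !natrM (_ : _ * _ * _ * _ = tau%:R ^+ 2 * (n - tau)%N%:R ^+ 2) //.
    by ring.
have p1 : poly xpredT 4 h1 by apply: poly_block; exact: ge1A.
have p2 : poly xpredT 4 h2 by apply: poly_block; exact: ge1B.
have p3 : poly xpredT 4 h3 by apply: poly_block; [exact: ge1A|exact: ge1B].
have n1 := poly_sqrw p1; have n2 := poly_sqrw p2; have n3 := poly_sqrw p3.
(* The factor 9 of the statement: 3 from the square of a sum of three terms, times the three bounds
   [V]. *)
apply: (@le_trans _ _ (Ex (fun w => 3 * (h1 w ^+ 2 + h2 w ^+ 2 + h3 w ^+ 2)))).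
  apply: (Ex_le X8).
  - exact: poly_sqrw (poly_cov_term tau).
  - by apply: polyZ; apply: polyD => //; exact: polyD.
  - move=> w; rewrite -/(h1 w) -/(h2 w) -/(h3 w).
    have := sqr_ge0 (h1 w - h2 w); have := sqr_ge0 (h1 w + h3 w).
    by have := sqr_ge0 (h2 w + h3 w); lra.
rewrite (ExZ X8); last by apply: polyD => //; exact: polyD.
rewrite (ExD X8)//; last exact: polyD.
rewrite (ExD X8)//; lra.
Qed.

End NoiseBound.

Variable cc : R.
Hypotheses (cc0 : 0 <= cc) (cts : cc * n%:R <= ts%:R) (cnts : cc * n%:R <= (n - ts)%N%:R).
Hypotheses (ts32 : (32 <= ts)%N) (nts32 : (32 <= n - ts)%N).

Let D2_ge0 : 0 <= D2.
Proof. by apply: tr_sqr_ge0 => k l; rewrite !mxE S1_sym S2_sym. Qed.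

Let quads_range (C D : {set 'I_n.+1}) (q : {ffun 'I_4 -> 'I_n.+1}) :
  (forall i, i \in C -> (1 <= i)%N) -> (forall i, i \in D -> (1 <= i)%N) ->
  q \in quads (ranges C C D D) -> forall s, in_range (q s).
Proof.
move=> hC hD; rewrite inE => /andP[/forallP rq _] s.
by rewrite (ranges_ge1 hC hD (rq s))/= -ltnS.
Qed.

(** [C'] is the part of the block in the opposite segment, where each quadruple gives 4 D2; all the
    others are bounded below by [pairing_shifted_ge]. The 2 is 4 / 2, half being lost to repeated
    indices, and the 6 is 12 / 2. *)
Lemma block_signal_ge (b : bool) (C C' : {set 'I_n.+1}) :
  (forall i, i \in C -> (1 <= i)%N) -> C' \subset C ->
  (forall i : 'I_n.+1, i \in C' -> other ts b i) ->
  (4 <= #|C| <= n)%N -> (32 <= #|C'|)%N -> cc * n%:R <= #|C'|%:R ->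
  2 * cc ^+ 4 * D2 - 6 * delta2 ^+ 2 <= (#|C| ^_ 4)%:R^-1 *
    \sum_(q in quads (ranges C C C C)) pairing (shifted_mean X S1 S2 b) (shifted_mean X S1 S2 b) q.
Proof.
move=> C1 C'C oC' /andP[C4' Cn] C'32 cC'.
set sm := shifted_mean X S1 S2 b.
have [f1 [f2 f3]] := ffact4_ge R C4'; set u := #|C| in C4' Cn f1 f2 f3 *.
have d0 : 0 <= delta2 ^+ 2 by exact: sqr_ge0.
have C'1 i : i \in C' -> (1 <= i)%N by move=> /(fintype.subsetP C'C)/C1.
have sub : quads (ranges C' C' C' C') \subset quads (ranges C C C C).
  apply/fintype.subsetP => q; rewrite !mem_quads => /and5P[].
  by do 4! move=> /(fintype.subsetP C'C) ->.
have qC : #|quads (ranges C C C C)|%:R <= u%:R ^+ 4 :> R.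
  rewrite -natrX ler_nat; apply: leq_trans (card_quads_le _) _.
  by rewrite prod_ranges (_ : (u ^ 4 = u * u * u * u)%N)//; ring.
have qC' : #|C'|%:R ^+ 4 / 2 <= #|quads (ranges C' C' C' C')|%:R :> R.
  have := @card_quads_ge _ (ranges C' C' C' C') 32.
  rewrite prod_ranges => h; rewrite ler_pdivrMr// -natrX -natrM ler_nat [leqRHS]mulnC.
  rewrite (_ : (#|C'| ^ 4 = #|C'| * #|C'| * #|C'| * #|C'|)%N); last by ring.
  by apply: h => //; exact: ranges_card.
have sumge : 4 * D2 * (#|C'|%:R ^+ 4 / 2) - delta2 ^+ 2 / 2 * u%:R ^+ 4 <=
    \sum_(q in quads (ranges C C C C)) pairing sm sm q.
  (* Adding delta2^2 / 2 to every term makes all of them nonnegative, so the sum may be restricted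
     to quadruples inside [C']. *)
  have -> : \sum_(q in quads (ranges C C C C)) pairing sm sm q =
     \sum_(q in quads (ranges C C C C)) (pairing sm sm q + delta2 ^+ 2 / 2)
     - delta2 ^+ 2 / 2 * #|quads (ranges C C C C)|%:R.
    by rewrite big_split/= sumr_const mulr_natr addrK.
  apply: lerB; last by apply: ler_wpM2l => //; lra.
  rewrite (big_setID (quads (ranges C' C' C' C')))/= (finset.setIidPr sub).
  apply: (@le_trans _ _ (\sum_(q in quads (ranges C' C' C' C'))
      (pairing sm sm q + delta2 ^+ 2 / 2))); last first.
    rewrite lerDl; apply: sumr_ge0 => q; rewrite inE => /andP[_ qr].
    have rq := quads_range C1 C1 qr.
    by have := pairing_shifted_ge mean_cp cov_cp b rq; rewrite -/sm; lra.
  apply: (@le_trans _ _ (\sum_(q in quads (ranges C' C' C' C')) (4 * D2))).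
    by rewrite sumr_const -[leRHS]mulr_natr; apply: ler_wpM2l => //; apply: mulr_ge0.
  apply: ler_sum => q qr; have rq := quads_range C'1 C'1 qr.
  have oq s : other ts b (q s).
    move: qr; rewrite inE => /andP[/forallP/(_ s) + _].
    by case: s => -[|[|[|[|s]]]] h //=; rewrite /ranges/=; exact: oC'.
  by rewrite /sm (pairing_shifted_other mean_cp cov_cp S1_sym S2_sym rq oq); lra.
apply: (@le_trans _ _ ((u ^_ 4)%:R^-1 *
  (4 * D2 * (#|C'|%:R ^+ 4 / 2) - delta2 ^+ 2 / 2 * u%:R ^+ 4))); last first.
  by rewrite ler_wpM2l// invr_ge0 ltW.
rewrite [leRHS]mulrC ler_pdivlMr// mulrBl; apply: lerB.
  have cc4 : cc ^+ 4 * (u ^_ 4)%:R <= #|C'|%:R ^+ 4.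
    apply: (@le_trans _ _ ((cc * n%:R) ^+ 4)); last first.
      by rewrite lerXn2r ?nnegrE ?mulr_ge0// ler0n.
    rewrite exprMn ler_wpM2l ?exprn_ge0//; apply: le_trans f2 _.
    by rewrite lerXn2r ?nnegrE ?ler0n// ler_nat.
  have : D2 * (cc ^+ 4 * (u ^_ 4)%:R) <= D2 * #|C'|%:R ^+ 4 by rewrite ler_wpM2l.
  by lra.
have : delta2 ^+ 2 * u%:R ^+ 4 <= delta2 ^+ 2 * (12 * (u ^_ 4)%:R) by rewrite ler_wpM2l.
lra.
Qed.

(** With the base chosen by [bs], one pure sum and the mixed sum have zero mean, since one of their
    pairs lies in the base segment. Only the pure sum over the side straddling the changepoint
    remains. *)
Lemma cov_signal_at_ge tau : (4 <= tau < (n - 4).+1)%N ->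
  weight R n tau * (cc ^+ 4 / 2 * D2 - 3 / 2 * delta2 ^+ 2) <= cov_signal_at tau.
Proof.
move=> /andP[t4 tn]; have nt4 : (4 <= n - tau)%N by lia.
have cA : #|A tau| = tau by apply: card_A; lia.
have cB := card_B tau.
rewrite /cov_signal_at; apply: ler_wpM2l; first exact: weight_ge0.
suff : 2 * cc ^+ 4 * D2 - 6 * delta2 ^+ 2 <= two_sample_stat (A tau) (B tau) (M tau) by lra.
have oth b (i : nat) : (i <= ts)%N = b -> ~~ other ts b i.
  by rewrite /other => ->; rewrite eqxx.
have zero (C D : {set 'I_n.+1}) : (forall i, i \in C -> (1 <= i)%N) ->
    (forall i, i \in D -> (1 <= i)%N) ->
    (forall i : 'I_n.+1, i \in C -> ~~ other ts (bs tau) i) \/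
    (forall i : 'I_n.+1, i \in D -> ~~ other ts (bs tau) i) ->
    \sum_(q in quads (ranges C C D D)) pairing (M tau) (M tau) q = 0.
  move=> hC hD h; apply: big1 => q qr; have rq := quads_range hC hD qr.
  move: qr; rewrite mem_quads => /and5P[q0 q1 q2 q3 _].
  case: h => h; first by apply: (pairing_shifted0 mean_cp cov_cp rq); exact: h.
  rewrite /pairing /dotk big1// => kl _; rewrite mulrC.
  rewrite /M (shifted_meanE mean_cp cov_cp (bs tau) kl (rq (inord 2)) (rq (inord 3))).
  by rewrite (negbTE (h _ q2)) (negbTE (h _ q3))/= addr0 !mul0r addr0 mul0r.
rewrite /two_sample_stat; have [tts|tts] := leqP tau ts.
- have bsE : bs tau = true by rewrite /bs tts.
  have hA (i : 'I_n.+1) : i \in A tau -> ~~ other ts (bs tau) i.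
    by rewrite inE bsE => /andP[_ it]; apply: oth; lia.
  rewrite (zero (A tau) (A tau)); [|exact: ge1A|exact: ge1A|by left].
  rewrite (zero (A tau) (B tau)); [|exact: ge1A|exact: ge1B|by left].
  rewrite mulr0 add0r mulr0 subr0.
  apply: (@block_signal_ge (bs tau) (B tau) (ord_itv n ts.+1 n.+1)).
  + exact: ge1B.
  + by apply/fintype.subsetP => i; rewrite !inE => /andP[h ->]; rewrite andbT; lia.
  + by move=> i; rewrite inE bsE /other => /andP[h _]; lia.
  + by rewrite cB; lia.
  + by rewrite card_ord_itv// subSS.
  + by rewrite card_ord_itv// subSS.
- have bsE : bs tau = false by rewrite /bs leqNgt tts.
  have hB (i : 'I_n.+1) : i \in B tau -> ~~ other ts (bs tau) i.
    by rewrite inE bsE => /andP[it _]; apply: oth; lia.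
  rewrite (zero (B tau) (B tau)); [|exact: ge1B|exact: ge1B|by left].
  rewrite (zero (A tau) (B tau)); [|exact: ge1A|exact: ge1B|by right].
  rewrite !mulr0 addr0 subr0.
  apply: (@block_signal_ge (bs tau) (A tau) (ord_itv n 1 ts.+1)).
  + exact: ge1A.
  + by apply/fintype.subsetP => i; rewrite !inE => /andP[-> h]/=; lia.
  + by move=> i; rewrite inE bsE /other => /andP[_ h]; lia.
  + by rewrite cA; lia.
  + by rewrite card_ord_itv ?subn1//; lia.
  + by rewrite card_ord_itv ?subn1//; lia.
Qed.

Lemma cov_stat_signal_ge : (128 <= n)%N ->
  n%:R ^+ 2 * (cc ^+ 4 / 64 * D2 - 3 / 2 * delta2 ^+ 2) <= cov_stat_signal.
Proof.
move=> n128; have hw := @sum_weight_ge R n 4 n128 isT.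
have hw2 := @sum_weight_le R n 4 (n - 4).+1 ltac:(lia).
apply: (@le_trans _ _ ((\sum_(4 <= tau < (n - 4).+1) weight R n tau) *
    (cc ^+ 4 / 2 * D2 - 3 / 2 * delta2 ^+ 2))).
  (* The jump term takes the lower bound n^2 / 32 of the total weight, the negative mean term the
     upper bound n^2. *)
  set S := \sum_(_ <= _ < _) _ in hw hw2 *.
  have h1 : n%:R ^+ 2 / 32 * (cc ^+ 4 / 2 * D2) <= S * (cc ^+ 4 / 2 * D2).
    by rewrite ler_wpM2r// mulr_ge0// divr_ge0// exprn_ge0.
  have h2 : S * (delta2 ^+ 2) <= n%:R ^+ 2 * delta2 ^+ 2 by rewrite ler_wpM2r// sqr_ge0.
  lra.
rewrite mulr_suml /cov_stat_signal big_nat [leRHS]big_nat; apply: ler_sum => tau.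
exact: cov_signal_at_ge.
Qed.

End CovStatisticTotal.

(** * The trace estimator *)

Section TraceEstimator.
Context d (T : measurableType d) (R : realType) (P : probability T R)
  (n p : nat) (X : nat -> 'I_p -> {RV P >-> R}).
Hypothesis indX : independent_vectors n X.
Hypothesis X8 : moments8 P n X.
Local Notation poly := (poly n X).
Local Notation nice := (poly xpredT 8).
Local Notation tensor := (tensor n X).
Local Notation Ex := (Ex P).
Local Notation gram := (gram P).
Local Notation gram_norm2 := (gram_norm2 P).
Local Notation in_range i := (1 <= i <= n)%N.
Local Notation Sigma i := (cov_mx (X i)).

Variables (mu1 mu2 : 'cV[R]_p) (S1 S2 : 'M[R]_p) (ts : nat).
Hypothesis mean_cp : forall i, in_range i ->
  mean_vec (X i) = if (i <= ts)%N then mu1 else mu2.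
Hypothesis cov_cp : forall i, in_range i -> Sigma i = if (i <= ts)%N then S1 else S2.
Hypotheses (S1_sym : sym_mx S1) (S2_sym : sym_mx S2).

Local Notation delta2 := (delta2 mu1 mu2).
Local Notation kappa2 := (kappa2 S1 S2).
Local Notation kappa := (kappa mu1 mu2 S1 S2).
Let xs w := realized_sample X w.

Definition cross i w : R := dotk (raw_diff X i i.+1 ^~ w) (raw_diff X i.+2 i.+3 ^~ w).

Lemma tr_sigma2_hatE w : tr_sigma2_hat n (xs w) =
  (4 * (n - 3))%:R^-1 * \sum_(1 <= i < (n - 3).+1) cross i w ^+ 2.
Proof.
congr (_ * _); apply: eq_bigr => i _; congr (_ ^+ 2).
by apply: eq_bigr => k _; rewrite !raw_diffE.
Qed.

Lemma gram_norm2_raw_diff i j : in_range i -> in_range j ->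
  gram_norm2 (raw_diff X i j) <= 128 * kappa.
Proof.
move=> ri rj.
have t1 : tensor xpredT 4 (noise_diff X i j).
  by move=> k; apply: poly_weaken (tensor_noise_diff X ri rj k).
have t2 : tensor xpredT 4 (fun k (_ : T) => mean_diff X i j k) by move=> k; exact: poly_cst.
apply: le_trans (gram_norm2D X8 t1 t2) _; rewrite gram_norm2_cst.
have h1 := gram_norm2_noise_diff X8 cov_cp S1_sym S2_sym ri rj.
have m0 : 0 <= dotk (mean_diff X i j) (mean_diff X i j).
  by apply: sumr_ge0 => k _; rewrite -expr2 sqr_ge0.
have m1 := mean_diff_sqr_le mean_cp ri rj.
have d0 := delta2_ge0 mu1 mu2.
have m2 : dotk (mean_diff X i j) (mean_diff X i j) ^+ 2 <= delta2 ^+ 2 by rewrite lerXn2r ?nnegrE.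
have d20 : 0 <= delta2 ^+ 2 by exact: sqr_ge0.
by rewrite /kappa; lra.
Qed.

Let pred4 i : pred nat := fun j => (i <= j < i + 4)%N.

Let cross_tensors i : in_range i -> in_range i.+3 ->
  tensor (pred2 i i.+1) 2 (raw_diff X i i.+1) /\
  tensor (pred2 i.+2 i.+3) 2 (raw_diff X i.+2 i.+3).
Proof.
move=> r0 r3; have [r1 r2] : in_range i.+1 /\ in_range i.+2 by lia.
split=> k; first by apply: poly_weaken (tensor_raw_diff X r0 r1 k).
by apply: poly_weaken (tensor_raw_diff X r2 r3 k).
Qed.

Let cross_disjoint i x : ~~ (pred2 i i.+1 x && pred2 i.+2 i.+3 x).
Proof. by rewrite /=; lia. Qed.

Lemma poly_cross i : in_range i -> in_range i.+3 -> poly (pred4 i) 2 (cross i).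
Proof.
move=> r0 r3; have [r1 r2] : in_range i.+1 /\ in_range i.+2 by lia.
apply: poly_sum => k _; apply: (polyM (k := 1) (m := 1)).
  apply: poly_weaken (tensor_raw_diff X r0 r1 k) => // x.
  by rewrite !unfold_in /= /pred4 => /orP[] /eqP ->; lia.
apply: poly_weaken (tensor_raw_diff X r2 r3 k) => // x.
by rewrite !unfold_in /= /pred4 => /orP[] /eqP ->; lia.
Qed.

Lemma nice_cross_sqr i : in_range i -> in_range i.+3 -> nice (fun w => cross i w ^+ 2).
Proof. by move=> r0 r3; apply: poly_weaken (poly_sqrw (poly_cross r0 r3)). Qed.

Lemma nice_tr_sigma2_hat : nice (fun w => tr_sigma2_hat n (xs w)).
Proof.
under [X in poly _ _ X]eq_fun do rewrite tr_sigma2_hatE big_nat.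
by apply: polyZ; apply: poly_sum => i hi; apply: nice_cross_sqr; lia.
Qed.

Lemma tr_sigma2_hat_ge0 w : 0 <= tr_sigma2_hat n (xs w).
Proof.
rewrite tr_sigma2_hatE mulr_ge0 ?invr_ge0 ?ler0n//.
by apply: sumr_ge0 => i _; exact: sqr_ge0.
Qed.

Lemma Ex_tr_sigma2_hat : (4 <= n)%N -> Ex (fun w => tr_sigma2_hat n (xs w)) <= 32 * kappa.
Proof.
move=> n4; under [X in Ex X]eq_fun do rewrite tr_sigma2_hatE big_nat.
have nc i : (1 <= i < (n - 3).+1)%N -> nice (fun w => cross i w ^+ 2).
  by move=> hi; apply: nice_cross_sqr; lia.
rewrite (ExZ X8); last exact: poly_sum.
rewrite (Ex_sum X8)// -big_nat.
have N0 : 0 < (4 * (n - 3))%:R :> R by rewrite ltr0n; lia.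
rewrite mulrC ler_pdivrMr//.
apply: (@le_trans _ _ (\sum_(1 <= i < (n - 3).+1) (128 * kappa))).
  rewrite big_nat [leRHS]big_nat; apply: ler_sum => i hi.
  have [r0 r3] : in_range i /\ in_range i.+3 by lia.
  have [r1 r2] : in_range i.+1 /\ in_range i.+2 by lia.
  have [t1 t2] := cross_tensors r0 r3.
  by apply: (Ex_sqr_dotk_le indX X8 (cross_disjoint i) t1 t2); exact: gram_norm2_raw_diff.
rewrite sumr_const_nat subn1/= -[leLHS]mulr_natr natrM; lra.
Qed.

Section Blocks.
Variable C4 : R.
Hypothesis C4_ge0 : 0 <= C4.
Hypothesis fourth : forall i, in_range i ->
  gram_norm2 (outer (centered (X i)) (centered (X i))) <= C4 * \tr (Sigma i ^+ 2) ^+ 2.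
Variables (b : bool) (s0 m : nat).
Hypothesis m0 : (0 < m)%N.
Hypothesis seg : forall i, (s0 < i <= s0 + 4 * m)%N -> in_range i /\ (i <= ts)%N = b.
Let Sb := if b then S1 else S2.
Let t : R := \tr (Sb ^+ 2).
Hypotheses (t0 : 0 < t) (tk : kappa2 <= 2 * t).

Let start k := (s0 + 4 * k).+1.

Let start_range (k : 'I_m) j : (j < 4)%N -> in_range (start k + j) /\ ((start k + j) <= ts)%N = b.
Proof. by move=> j4; apply: seg; have := ltn_ord k; rewrite /start; lia. Qed.

Let raw_noise i j : in_range i -> in_range j -> (i <= ts)%N = b -> (j <= ts)%N = b ->
  raw_diff X i j = noise_diff X i j.
Proof.
move=> ri rj ib jb; apply/funext => k; apply/funext => w.
by rewrite /raw_diff /mean_diff !mean_cp// ib jb subrr mxE addr0.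
Qed.

Lemma gram_noise_diff i j k l : in_range i -> in_range j -> i != j ->
  (i <= ts)%N = b -> (j <= ts)%N = b -> gram (raw_diff X i j) k l = 2 * Sb k l.
Proof.
move=> ri rj ij ib jb.
have := Ex_outer_raw indX X8 (k, l) ri rj ij; rewrite /outer/= /gram => ->.
rewrite /outer_mean/= /mean_diff !mean_cp// !cov_cp// ib jb subrr mxE mul0r addr0.
by rewrite /Sb; case: b; ring.
Qed.

Let blk (k : 'I_m) : [/\ in_range (start k), in_range (start k).+1, in_range (start k).+2
   & in_range (start k).+3] /\ [/\ (start k <= ts)%N = b, ((start k).+1 <= ts)%N = b,
   ((start k).+2 <= ts)%N = b & ((start k).+3 <= ts)%N = b].
Proof.
have [h0 b0] := start_range k (isT : (0 < 4)%N); have [h1 b1] := start_range k (isT : (1 < 4)%N).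
have [h2 b2] := start_range k (isT : (2 < 4)%N); have [h3 b3] := start_range k (isT : (3 < 4)%N).
by rewrite addn0 addn1 addn2 addn3 in h0 b0 h1 b1 h2 b2 h3 b3.
Qed.

(** Inside one segment both differences have second-moment matrix 2 Sb, and the inner product of
    these two matrices is 4 tr Sb^2. *)
Lemma Ex_cross_sqr (k : 'I_m) : Ex (fun w => cross (start k) w ^+ 2) = 4 * t.
Proof.
have [[r0 r1 r2 r3] [b0 b1 b2 b3]] := blk k.
have [t1 t2] := cross_tensors r0 r3.
rewrite (Ex_sqr_dotk_indep indX X8 (cross_disjoint _) t1 t2).
rewrite /t tr_sqr_sym; last by move=> u v; rewrite /Sb; case: b.
rewrite big_distrr; apply: eq_bigr => u _; rewrite big_distrr; apply: eq_bigr => v _.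
by rewrite !gram_noise_diff//; [rewrite /=; ring|lia|lia].
Qed.

(** The square of an inner product is again an inner product, now of outer squares, so the fourth
    moment follows from the second-moment bound for independent tensors. Here 512 = 128 * 4, the 4
    coming from kappa2 <= 2 t. *)
Lemma Ex_cross_4 (k : 'I_m) :
  Ex (fun w => (cross (start k) w ^+ 2) ^+ 2) <= 512 * (C4 + 1) * t ^+ 2.
Proof.
have [[r0 r1 r2 r3] [b0 b1 b2 b3]] := blk k.
set i := start k in r0 r1 r2 r3 b0 b1 b2 b3 *.
have -> : (fun w => (cross i w ^+ 2) ^+ 2) = fun w =>
    dotk (outer (noise_diff X i i.+1) (noise_diff X i i.+1) ^~ w)
      (outer (noise_diff X i.+2 i.+3) (noise_diff X i.+2 i.+3) ^~ w) ^+ 2.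
  apply/funext => w; congr (_ ^+ 2); rewrite /cross !raw_noise// expr2.
  rewrite /dotk big_distrlr/= pair_bigA/=.
  by apply: eq_bigr => -[u v] _; rewrite /outer/=; ring.
have kt : kappa2 ^+ 2 <= 4 * t ^+ 2.
  have -> : 4 * t ^+ 2 = (2 * t) ^+ 2 by ring.
  by rewrite lerXn2r ?nnegrE ?kappa2_ge0// mulr_ge0// ltW.
have bd i' j' : in_range i' -> in_range j' -> i' != j' ->
    gram_norm2 (outer (noise_diff X i' j') (noise_diff X i' j')) <= 512 * (C4 + 1) * t ^+ 2.
  move=> ri' rj' ij'.
  apply: le_trans (gram_norm2_outer_noise_diff indX X8 cov_cp C4_ge0 fourth
    S1_sym S2_sym ri' rj' ij') _.
  have : (C4 + 1) * kappa2 ^+ 2 <= (C4 + 1) * (4 * t ^+ 2) by rewrite ler_wpM2l// addr_ge0.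
  by lra.
have tn i' j' : in_range i' -> in_range j' -> tensor (pred2 i' j') 2
    (outer (noise_diff X i' j') (noise_diff X i' j')).
  by move=> ri' rj'; apply: (tensor_outer (k := 1) (m := 1)); exact: tensor_noise_diff.
apply: (Ex_sqr_dotk_le indX X8 (cross_disjoint i)).
- exact: tn.
- exact: tn.
- by apply: bd => //; lia.
- by apply: bd => //; lia.
Qed.

Let h (k : 'I_m) w := cross (start k) w ^+ 2 - 4 * t.

Let pcross (k : 'I_m) : poly (pred4 (start k)) 4 (fun w => cross (start k) w ^+ 2).
Proof. by have [[r0 r1 r2 r3] _] := blk k; exact: poly_sqrw (poly_cross r0 r3). Qed.

Let ph (k : 'I_m) : poly (pred4 (start k)) 4 (h k).
Proof. by apply: polyB; [exact: pcross|exact: poly_cst]. Qed.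

(** Different blocks use disjoint observations, so only the diagonal survives and the count in
    [Ex_sqr_sum] is 1. *)
Lemma Ex_sum_cross : Ex (fun w => (\sum_(k in [set: 'I_m]) h k w) ^+ 2) <=
  512 * (C4 + 1) * t ^+ 2 * (m%:R * 1).
Proof.
rewrite -[in X in X%:R * 1](card_ord m) -cardsT.
apply: (@Ex_sqr_sum _ _ _ _ _ _ _ X8 _ _ h (fun k l => k == l)).
- by move=> k _; apply: poly_weaken (ph k).
- move=> k _; apply: le_trans (Ex_cross_4 k).
  have nc : nice (fun w => cross (start k) w ^+ 2) by apply: poly_weaken (pcross k).
  have pc4 : poly xpredT 4 (fun w => cross (start k) w ^+ 2) by apply: poly_weaken (pcross k).
  have nc4 : nice (fun w => (cross (start k) w ^+ 2) ^+ 2) by exact: poly_sqrw pc4.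
  have -> : (fun w => h k w ^+ 2) = fun w => (cross (start k) w ^+ 2) ^+ 2 +
      ((- (8 * t)) * cross (start k) w ^+ 2 + (4 * t) ^+ 2).
    by apply/funext => w; rewrite /h; ring.
  rewrite (ExD X8)//; last by apply: polyD; [exact: polyZ|exact: poly_cst].
  rewrite (ExD X8); [|exact: polyZ|exact: poly_cst].
  rewrite (ExZ X8)// Ex_cst Ex_cross_sqr; have := sqr_ge0 t; lra.
- move=> k l _ _ kl.
  have dkl x : ~~ (pred4 (start k) x && pred4 (start l) x).
    by move: kl; rewrite -val_eqE/= /pred4 /start => kl; lia.
  rewrite (Ex_indepM indX X8 dkl _ (ph k) (ph l))//.
  have nc : nice (fun w => cross (start k) w ^+ 2) by apply: poly_weaken (pcross k).
  rewrite /h (ExB X8)//; last exact: poly_cst.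
  by rewrite Ex_cst Ex_cross_sqr subrr mul0r.
- move=> k _; rewrite (_ : [set q' in [set: 'I_m] | k == q'] = [set k]) ?cards1//.
  by apply/setP => l; rewrite !inE eq_sym.
Qed.

(** The estimator is a sum of squares: if it vanishes, so does every block product, and the centred
    block sum equals - 4 t m. Chebyshev then gives 32 = 512 / 16. *)
Lemma prob_tr_sigma2_hat_eq0 : (4 <= n)%N ->
  fine (P [set w | tr_sigma2_hat n (xs w) = 0]%classic) <= 32 * (C4 + 1) / m%:R.
Proof.
move=> n4; have mR : 0 < m%:R :> R by rewrite ltr0n.
pose f w := (\sum_(k in [set: 'I_m]) h k w) ^+ 2.
have pS : poly xpredT 4 (fun w => \sum_(k in [set: 'I_m]) h k w).
  by apply: poly_sum => k _; apply: poly_weaken (ph k).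
have nf : nice f by exact: poly_sqrw pS.
have f0 w : 0 <= f w by exact: sqr_ge0.
set lam := (m%:R * (4 * t)) ^+ 2.
have lam0 : 0 < lam by rewrite exprn_gt0// mulr_gt0// mulr_gt0.
have mtr := poly_measurable nice_tr_sigma2_hat.
have mf := poly_measurable nf.
have mA : measurable [set w | tr_sigma2_hat n (xs w) = 0]%classic.
  by rewrite -[X in measurable X]setTI; apply: (mtr measurableT [set 0]%classic).
have mB : measurable [set w | lam <= f w]%classic.
  rewrite -[X in measurable X]setTI; exact: measurable_fun_ler.
apply: (@le_trans _ _ (fine (P [set w | lam <= f w]%classic))).
  apply: fine_le; rewrite ?fin_num_measure//; apply: le_measure; rewrite ?inE//.
  move=> w /= tr0.
  have c0 (k : 'I_m) : cross (start k) w ^+ 2 = 0.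
    move: tr0; rewrite tr_sigma2_hatE => /eqP; rewrite mulf_eq0 invr_eq0 pnatr_eq0.
    have [[r0 r1 r2 r3] _] := blk k.
    case/orP => [|]; first by lia.
    rewrite psumr_eq0 => [/allP/(_ (start k))|i _]; last exact: sqr_ge0.
    by rewrite mem_index_iota /= => imp; apply/eqP/imp; lia.
  rewrite /f (eq_bigr (fun=> - (4 * t))); last by move=> k _; rewrite /h c0 sub0r.
  by rewrite sumrN sqrrN sumr_const cardsT card_ord /lam -[(4 * t) *+ m]mulr_natl.
apply: le_trans (Ex_markov X8 nf f0 lam0) _.
rewrite ler_pdivrMr//; apply: le_trans Ex_sum_cross _.
rewrite /lam; have -> : 32 * (C4 + 1) / m%:R * (m%:R * (4 * t)) ^+ 2 =
   512 * (C4 + 1) * t ^+ 2 * (m%:R * 1) by field; rewrite gt_eqF.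
by [].
Qed.

End Blocks.
End TraceEstimator.

(** * Fourth moments from cumulants *)

Section Ffun4.
Variables (R : realType) (I : finType) (a b c e : 'I_4).
Hypothesis abce : uniq [:: a; b; c; e].

Lemma mem_uniq_ord4 (s : 'I_4) : s \in [:: a; b; c; e].
Proof.
have [//|sN] := boolP (s \in _).
have u : uniq (s :: [:: a; b; c; e]) by rewrite cons_uniq sN.
have := max_card (mem (s :: [:: a; b; c; e])).
by rewrite (card_uniqP u) card_ord.
Qed.

Lemma sum_ffun4 (F : I -> I -> I -> I -> R) :
  \sum_(l : {ffun 'I_4 -> I}) F (l a) (l b) (l c) (l e) =
  \sum_(u : I * I) \sum_(v : I * I) F u.1 u.2 v.1 v.2.
Proof.
rewrite pair_bigA/=.
pose f (l : {ffun 'I_4 -> I}) := ((l a, l b), (l c, l e)).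
pose g (z : (I * I) * (I * I)) : {ffun 'I_4 -> I} :=
  [ffun s => nth z.1.1 [:: z.1.1; z.1.2; z.2.1; z.2.2] (index s [:: a; b; c; e])].
have fg : cancel f g.
  move=> l; apply/ffunP => s; rewrite ffunE /f /=.
  have := mem_uniq_ord4 s; rewrite !inE.
  have [->|sa] := eqVneq s a; first by [].
  have [->|sb] := eqVneq s b; first by [].
  have [->|sc] := eqVneq s c; first by [].
  by have [->|se] := eqVneq s e.
have gf : cancel g f.
  move: abce; rewrite /= !inE !negb_or -!andbA => /and5P[ab ac ae bc /and3P[be ce _]].
  move=> [[x y] [z w]]; rewrite /f /g !ffunE /= !eqxx.
  by rewrite (negbTE ab) (negbTE ac) (negbTE ae) (negbTE bc) (negbTE be) (negbTE ce).
rewrite (reindex f)/=; last by apply: onW_bij; exists g.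
by [].
Qed.

End Ffun4.

Section Cumulants.
Context d (T : measurableType d) (R : realType) (P : probability T R)
  (n p : nat) (X : nat -> 'I_p -> {RV P >-> R}).
Hypothesis X8 : moments8 P n X.
Local Notation Ex := (Ex P).
Local Notation gram := (gram P).
Local Notation gram_norm2 := (gram_norm2 P).
Variable i : nat.
Hypothesis ri : (1 <= i <= n)%N.
Local Notation y := (centered (X i)).
Local Notation Sigma := (cov_mx (X i)).
Local Notation LL := {ffun 'I_4 -> 'I_p}.

Let mom (l : LL) (B : {set 'I_4}) : R := Ex (fun w => \prod_(a in B) y (l a) w).
Let coef (s : {set {set 'I_4}}) : R := (-1) ^+ (#|s| - 1) * ((#|s| - 1)`!)%:R.
Let term (s : {set {set 'I_4}}) (l : LL) : R := coef s * \prod_(B in s) mom l B.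
Let t : R := \tr (Sigma ^+ 2).

Let tE : t = \sum_(u : 'I_p * 'I_p) Sigma u.1 u.2 ^+ 2.
Proof. by rewrite /t tr_sqr_sym ?pair_bigA//; exact: cov_mx_sym. Qed.

Let t0 : 0 <= t.
Proof. by rewrite tE; apply: sumr_ge0 => u _; exact: sqr_ge0. Qed.

Lemma mom_pair (l : LL) a b : a != b -> mom l [set a; b]%SET = Sigma (l a) (l b).
Proof.
move=> ab; rewrite -(gram_centered X (l a) (l b) ri) /mom /gram.
by congr (Ex _); apply/funext => w; rewrite big_setU1 ?inE//= big_set1.
Qed.

(** A singleton block kills the term because the variables are centred. Otherwise the blocks have at
    least two elements, and a partition of four points with more than one block consists of two
    pairs; the sum of squares then factors as (tr Sigma^2)^2. *)
Lemma term_sqr_le (s : {set {set 'I_4}}) :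
  finset.partition s [set: 'I_4]%SET -> s != [set [set: 'I_4]]%SET ->
  \sum_(l : LL) term s l ^+ 2 <= t ^+ 2.
Proof.
move=> /[dup] ps /and3P[/eqP cov triv s0] sN.
have cardE := card_partition ps; rewrite cardsT card_ord in cardE.
have [[B [Bs B1]]|no1] := pselect (exists B, B \in s /\ #|B| = 1%N).
  rewrite big1 ?sqr_ge0// => l _; rewrite /term.
  have /cards1P[a Ba] : #|B| == 1%N by rewrite B1.
  rewrite (big_setD1 B)//= Ba /mom; under [X in Ex X]eq_fun do rewrite big_set1.
  by rewrite (Ex_centered X8)// mul0r mulr0 expr0n.
have ge2 B : B \in s -> (2 <= #|B|)%N.
  move=> Bs; rewrite ltn_neqAle; apply/andP; split.
    by apply/negP => /eqP B1; apply: no1; exists B.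
  by rewrite card_gt0; apply: contraNneq s0 => <-.
have s2 : (2 * #|s| <= 4)%N.
  have : (\sum_(B in s) 2 <= \sum_(B in s) #|B|)%N by apply: leq_sum; exact: ge2.
  by rewrite sum_nat_const -cardE mulnC.
have cs : #|s| = 2%N.
  case: (posnP #|s|) => [/eqP|sgt0].
    rewrite cards_eq0 => /eqP se; move: cardE; rewrite se big_set0//.
  have [/eqP /cards1P[B sB]|/eqP s1] := eqVneq #|s| 1%N; last by lia.
  by move: cov sN; rewrite sB /finset.cover big_set1 => ->; rewrite eqxx.
have /eqP/cards2P[B1 [B2 [B12 sE]]] := cs.
have [B1s B2s] : B1 \in s /\ B2 \in s by rewrite sE !inE !eqxx orbT.
have cB : (#|B1| + #|B2| = 4)%N by apply: esym; rewrite [LHS]cardE sE big_setU1 ?inE//= big_set1.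
have [c1 c2] : #|B1| = 2%N /\ #|B2| = 2%N by have := ge2 _ B1s; have := ge2 _ B2s; lia.
have /eqP/cards2P[a [b [ab B1E]]] := c1.
have /eqP/cards2P[a' [b' [ab' B2E]]] := c2.
have dis : [disjoint B1 & B2] by apply: (finset.trivIsetP triv).
have uq : uniq [:: a; b; a'; b'].
  have nn x z : x \in B1 -> z \in B2 -> x != z.
    by move=> xB1 zB2; apply/eqP => xz; move: (disjointFr dis xB1); rewrite xz zB2.
  rewrite /= !inE !negb_or ab ab' !nn ?B1E ?B2E ?inE ?eqxx ?orbT//.
have termE l : term s l ^+ 2 = Sigma (l a) (l b) ^+ 2 * Sigma (l a') (l b') ^+ 2.
  rewrite /term /coef cs /= subn1/= expr1 mulr1 sE big_setU1 ?inE//= big_set1 B1E B2E.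
  by rewrite !mom_pair// exprMn sqrrN expr1n mul1r exprMn.
under eq_bigr do rewrite termE.
rewrite (sum_ffun4 uq (fun x z x' z' => Sigma x z ^+ 2 * Sigma x' z' ^+ 2)).
by rewrite tE expr2 big_distrlr.
Qed.

Lemma gram_norm2_outer_centered_ffun :
  gram_norm2 (outer y y) = \sum_(l : LL) mom l [set: 'I_4]%SET ^+ 2.
Proof.
have uq : uniq [:: (inord 0 : 'I_4); inord 1; inord 2; inord 3].
  by rewrite -enum_ord4 enum_uniq.
have momT l : mom l [set: 'I_4]%SET =
    Ex (fun w => y (l (inord 0)) w * y (l (inord 1)) w * (y (l (inord 2)) w * y (l (inord 3)) w)).
  rewrite /mom; congr (Ex _); apply/funext => w.
  rewrite (eq_bigl xpredT); last by move=> a; rewrite inE.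
  by rewrite -[LHS]big_enum enum_ord4 !big_cons big_nil /= mulr1 !mulrA.
under [RHS]eq_bigr do rewrite momT.
by rewrite (sum_ffun4 uq (fun k l k' l' =>
  Ex (fun w => y k w * y l w * (y k' w * y l' w)) ^+ 2)).
Qed.

(** A crude bound for the number of partitions, counting all families of subsets; only a finite
    constant is wanted. *)
Definition npart : R := #|{set {set 'I_4}}|%:R.

Lemma sqr_sum_le (J : finType) (Q : pred J) (F : J -> R) :
  (\sum_(j | Q j) F j) ^+ 2 <= #|J|%:R * \sum_(j | Q j) F j ^+ 2.
Proof.
rewrite expr2 big_distrlr/=.
have card_le : (\sum_(j | Q j) 1 : R) <= #|J|%:R.
  by rewrite sumr_const ler_nat max_card.
apply: (@le_trans _ _ (\sum_(j | Q j) \sum_(k | Q k) (F j ^+ 2 / 2 + F k ^+ 2 / 2))).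
  apply: ler_sum => j _; apply: ler_sum => k _.
  by have := sqr_ge0 (F j - F k); lra.
have -> : \sum_(j | Q j) \sum_(k | Q k) (F j ^+ 2 / 2 + F k ^+ 2 / 2) =
    (\sum_(j | Q j) 1) * \sum_(j | Q j) F j ^+ 2.
  under eq_bigr do rewrite big_split/=.
  rewrite big_split/= [X in _ + X]exchange_big/= -big_split/= [RHS]mulrC big_distrl/=.
  apply: eq_bigr => j _; rewrite !big_distrr/= -big_split/=.
  by apply: eq_bigr => k _; lra.
by rewrite ler_wpM2r// sumr_ge0// => j _; exact: sqr_ge0.
Qed.

(** The one-block partition has coefficient 1, so the fourth moment is the cumulant minus the terms
    of the other partitions. One factor [npart] comes from Cauchy-Schwarz over partitions, the other
    from their number. *)
Lemma fourth_moment_le (C : R) : sum_cumulant2 4 (X i) <= C * t ^+ 2 ->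
  gram_norm2 (outer y y) <= 2 * (`|C| + npart ^+ 2) * t ^+ 2.
Proof.
move=> cumC; rewrite gram_norm2_outer_centered_ffun.
set s0 : {set {set 'I_4}} := [set [set: 'I_4]]%SET.
have ps0 : finset.partition s0 [set: 'I_4]%SET.
  apply/and3P; split; first by rewrite /finset.cover big_set1.
    by apply/finset.trivIsetP => B B'; rewrite !inE => /eqP -> /eqP ->; rewrite eqxx.
  by rewrite inE eq_sym -card_gt0 cardsT card_ord.
pose Qs s := finset.partition s [set: 'I_4]%SET && (s != s0).
pose rest (l : LL) := \sum_(s | Qs s) term s l.
have momE l : mom l [set: 'I_4]%SET = joint_cumulant P (fun a => y (l a)) - rest l.
  rewrite /joint_cumulant (bigD1 s0)//= cards1 subnn expr0 mul1r fact0 mul1r big_set1.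
  rewrite -/(mom l [set: 'I_4]%SET) -[X in _ = _ + X - _]/(rest l).
  by rewrite addrK.
have npart0 : 0 <= npart by exact: ler0n.
have restB : \sum_(l : LL) rest l ^+ 2 <= npart ^+ 2 * t ^+ 2.
  apply: (@le_trans _ _ (\sum_(l : LL) npart * \sum_(s | Qs s) term s l ^+ 2)).
    by apply: ler_sum => l _; exact: sqr_sum_le.
  rewrite -mulr_sumr exchange_big/= expr2 -mulrA ler_wpM2l//.
  apply: (@le_trans _ _ (\sum_(s | Qs s) t ^+ 2)).
    by apply: ler_sum => s /andP[ps sN]; exact: term_sqr_le.
  rewrite sumr_const -[leLHS]mulr_natl ler_wpM2r ?sqr_ge0// ler_nat.
  exact: max_card.
have C1 : C * t ^+ 2 <= `|C| * t ^+ 2 by rewrite ler_wpM2r ?sqr_ge0// ler_norm.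
apply: (@le_trans _ _ (\sum_(l : LL)
  (2 * joint_cumulant P (fun a => y (l a)) ^+ 2 + 2 * rest l ^+ 2))).
  apply: ler_sum => l _; rewrite momE.
  by have := sqr_ge0 (joint_cumulant P (fun a => y (l a)) + rest l); lra.
rewrite big_split/= -!mulr_sumr.
have := cumC; rewrite /sum_cumulant2; lra.
Qed.

End Cumulants.

Local Open Scope classical_set_scope.

(** * The normal distribution function *)

Section NormalCdf.
Variable R : realType.
Implicit Types t u : R.

Lemma sin_le_id t : 0 <= t -> sin t <= t.
Proof.
move=> t0; have [c _] := @MVT_segment R sin cos 0 t t0 (fun x _ => is_derive_sin x)
  (continuous_subspaceT (@continuous_sin R)).
by rewrite sin0 !subr0 => ->; rewrite ler_piMl// cos_le1.
Qed.

(** Makes the scale constants 2 pi^2 - 18 and 4 pi^2 - 36 positive. From sin (3/8) <= 3/8, two angle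
    doublings give cos (3/4) >= 23/32 and then cos (3/2) > 0, that is 3/2 < pi/2. *)
Lemma pi_gt3 : 3 < pi :> R.
Proof.
have pi2 := @pi_ge2 R.
have s38 : 0 <= sin (3 / 8 : R) <= 3 / 8.
  by rewrite sin_le_id ?andbT ?sin_ge0_pi//; lra.
have c34 : 23 / 32 <= cos (3 / 4 : R).
  have -> : 3 / 4 = (3 / 8) *+ 2 :> R by lra.
  rewrite cos_mulr2n cos2sin2.
  move: s38 => /andP[s0 s1].
  have : sin (3 / 8 : R) ^+ 2 <= (3 / 8) ^+ 2 by rewrite ler_sqr ?nnegrE//; lra.
  by rewrite -mulr_natr; lra.
have c32 : 0 < cos (3 / 2 : R).
  have -> : 3 / 2 = (3 / 4) *+ 2 :> R by lra.
  rewrite cos_mulr2n -mulr_natr.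
  have : (23 / 32) ^+ 2 <= cos (3 / 4 : R) ^+ 2 by rewrite ler_sqr ?nnegrE//; lra.
  by lra.
have : cos (pi / 2) < cos (3 / 2 : R) by rewrite cos_pihalf.
rewrite ltr_cos ?in_itv/=; lra.
Qed.

Local Notation Phi := (@std_normal_cdf R).

(** Under the standard normal law the identity is a random variable with distribution function
    [Phi], which gives access to the general facts about [cdf]. *)
Let idR : measurableTypeR R -> R := idfun.

#[local] HB.instance Definition _ :=
  @isMeasurableFun.Build _ _ _ _ idR (@measurable_id _ _ setT).

Let Z : {RV normal_prob (0 : R) 1 >-> R} := idR.

Lemma std_normal_cdfE t : Phi t = fine (cdf Z t).
Proof. by []. Qed.

Lemma std_normal_cdf_ge0 t : 0 <= Phi t.
Proof. by rewrite std_normal_cdfE fine_ge0// cdf_ge0. Qed.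

Lemma std_normal_cdf_nd : {homo Phi : t u / t <= u}.
Proof.
move=> t u tu; rewrite !std_normal_cdfE fine_le ?fin_num_measure//.
exact: cdf_nondecreasing.
Qed.

Lemma std_normal_cdf_lt1 t : Phi t < 1.
Proof.
pose I : set R := `[t + 1, t + 2]%classic.
have mJ : measurable (`]-oo, t]%classic : set R) by exact: measurable_itv.
have mI : measurable I by exact: measurable_itv.
have IJ : I `<=` ~` `]-oo, t].
  move=> x; rewrite /I/= !in_itv/= => /andP[tx _]; apply/negP.
  by rewrite -ltNge (lt_le_trans _ tx)// ltrDl.
(* A lower bound for the density on [t + 1, t + 2], hence for the mass of this interval of length
   one beyond t. *)
pose m : R := normal_peak 1 * expR (- ((`|t| + 2) ^+ 2 / 2)).
have m0 : 0 < m by rewrite mulr_gt0 ?normal_peak_gt0 ?expR_gt0// oner_eq0.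
have sq (x : R) : t + 1 <= x -> x <= t + 2 -> x ^+ 2 / 2 <= (`|t| + 2) ^+ 2 / 2.
  move=> tx xt; rewrite ler_wpM2r ?invr_ge0// -[leLHS]real_normK ?num_real//.
  have t20 : 0 <= `|t| + 2 by have := normr_ge0 t; lra.
  rewrite ler_sqr ?nnegrE//.
  rewrite ler_norml; have := ler_norm t; have := ler_norm (- t).
  by rewrite normrN; lra.
have PI : (m%:E <= normal_prob (0 : R) 1 I)%E.
  have -> : m%:E = (\int[lebesgue_measure]_(x in I) m%:E)%E.
    rewrite integral_cst//= /I lebesgue_measure_itv/= lte_fin ltrD2l ltr1n -EFinB.
    by rewrite -[X in _ = X]EFinM; congr (_%:E); lra.
  apply: ge0_le_integral => //=.
  - by move=> x _; rewrite lee_fin ltW.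
  - apply/measurable_EFinP; apply: measurable_funTS; exact: measurable_normal_pdf.
  - move=> x; rewrite /I/= in_itv/= => /andP[tx xt].
    rewrite lee_fin normal_pdfE ?oner_eq0// ler_wpM2l ?normal_peak_ge0//.
    rewrite /normal_fun ler_expR subr0 mulNr lerN2 expr1n.
    by apply: sq.
have := probability_setC (normal_prob (0 : R) 1) mJ.
have : (m%:E <= normal_prob (0 : R) 1 (~` `]-oo, t]))%E.
  by apply: (le_trans PI); rewrite le_measure ?inE//; exact: measurableC.
rewrite /std_normal_cdf => + PC; rewrite PC -[X in (1 - X)%E]fineK ?fin_num_measure//.
by rewrite -EFinB lee_fin; lra.
Qed.

Lemma std_normal_cdf_cvg1 (eps : R) : 0 < eps -> exists t, 1 - eps < Phi t.
Proof.
move=> e0; have /fine_cvgP[_ /cvgrPdist_lt/(_ _ e0)[M [_ MP]]] := cvg_cdfy1 Z.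
exists (M + 1); have := MP (M + 1); rewrite /= => /(_ _).
rewrite ltrDl ltr01 => /(_ isT); by rewrite ltr_distlC => /andP[].
Qed.

Lemma measurable_std_normal_cdf : measurable_fun [set: R] Phi.
Proof. by apply: nondecreasing_measurable => //; exact: std_normal_cdf_nd. Qed.

End NormalCdf.

(** * Tail bounds at a fixed sample size *)

Section StudentizedEvents.
Context d (T : measurableType d) (R : realType) (P : probability T R)
  (n p : nat) (X : nat -> 'I_p -> {RV P >-> R}).
Hypothesis X8 : moments8 P n X.
Local Notation nice := (poly n X xpredT 8).
Local Notation Ex := (Ex P).
Local Notation pr A := (fine (P A)).

Lemma fine_prob_le (A B : set T) : measurable A -> measurable B -> A `<=` B -> pr A <= pr B.
Proof. by move=> mA mB AB; rewrite fine_le ?fin_num_measure// le_measure ?inE. Qed.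

Lemma fine_probU_le (A B : set T) : measurable A -> measurable B -> pr (A `|` B) <= pr A + pr B.
Proof.
move=> mA mB; rewrite -lee_fin EFinD !fineK ?fin_num_measure//; last exact: measurableU.
exact: measureU2.
Qed.

Lemma measurable_eq0 (f : T -> R) : measurable_fun setT f -> measurable [set w | f w = 0].
Proof. by move=> mf; rewrite -[X in measurable X]setTI; apply: (mf measurableT [set 0]). Qed.

Lemma measurable_geC (f : T -> R) c : measurable_fun setT f -> measurable [set w | c <= f w].
Proof.
by move=> mf; rewrite -[X in measurable X]setTI; apply: (measurable_fun_ler _ _ measurableT).
Qed.

Lemma measurable_leC (f : T -> R) c : measurable_fun setT f -> measurable [set w | f w <= c].
Proof.
by move=> mf; rewrite -[X in measurable X]setTI; apply: (measurable_fun_ler _ _ measurableT).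
Qed.

(** A small ratio has one of three causes: a vanishing scale (where the ratio is 0 by convention), a
    statistic below half its centre [theta], or a scale too large compared with [theta]. *)
Lemma ratio_le_cases (s m theta t : R) : 0 <= s -> s^-1 * m <= t ->
  [\/ s = 0, (theta / 2) ^+ 2 <= (m - theta) ^+ 2 | theta / 2 <= t * s] \/ theta <= 0.
Proof.
move=> s0 smt; have [th0|th0] := leP theta 0; [by right|left].
have [->|sN0] := eqVneq s 0; first by constructor 1.
have sgt0 : 0 < s by rewrite lt_neqAle eq_sym sN0.
have mts : m <= t * s by rewrite -ler_pdivrMr// mulrC.
have [h|h] := leP (theta / 2) m; first by constructor 3; lra.
by constructor 2; nra.
Qed.

Lemma measurable_inv_ge0 (s : T -> R) : measurable_fun setT s -> (forall w, 0 <= s w) ->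
  measurable_fun setT (fun w => (s w)^-1).
Proof.
move=> ms s0; under eq_fun do rewrite -powR_inv1//.
exact: measurableT_comp (measurable_powR _) ms.
Qed.

Lemma prob_ratio_le (s m : T -> R) (theta t : R) :
  measurable_fun setT s -> measurable_fun setT m -> (forall w, 0 <= s w) -> 0 < theta ->
  nice (fun w => (m w - theta) ^+ 2) ->
  pr [set w | (s w)^-1 * m w <= t] <=
    pr [set w | s w = 0] + Ex (fun w => (m w - theta) ^+ 2) / (theta / 2) ^+ 2
    + pr [set w | theta / 2 <= t * s w].
Proof.
move=> ms mm s0 th0 nd.
have mE : measurable [set w | (s w)^-1 * m w <= t].
  by apply: measurable_leC; apply: measurable_funM => //; exact: measurable_inv_ge0.
have m1 := measurable_eq0 ms.
have m2 : measurable [set w | (theta / 2) ^+ 2 <= (m w - theta) ^+ 2].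
  by apply: measurable_geC; exact: poly_measurable nd.
have m3 : measurable [set w | theta / 2 <= t * s w].
  by apply: measurable_geC; exact: measurable_funM.
apply: le_trans (fine_prob_le mE (measurableU _ _ (measurableU _ _ m1 m2) m3) _) _.
  move=> w /= /(@ratio_le_cases _ _ theta _ (s0 w))[|]; last by rewrite leNgt th0.
  by case=> h; [left; left|left; right|right].
apply: le_trans (fine_probU_le (measurableU _ _ m1 m2) m3) _.
rewrite lerD2r; apply: le_trans (fine_probU_le m1 m2) _.
rewrite lerD2l; apply: Ex_markov nd _ _ => //; first by move=> w; exact: sqr_ge0.
by rewrite exprn_gt0// divr_gt0.
Qed.

End StudentizedEvents.

(** * Measurability of the statistics and p-values *)

Section Measurability.
Context d (T : measurableType d) (R : realType) (P : probability T R)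
  (n p : nat) (X : nat -> 'I_p -> {RV P >-> R}).
Let xs w := realized_sample X w.

Lemma measurable_dotv (u v : T -> 'cV[R]_p) :
  (forall l, measurable_fun setT (fun w => u w l 0)) ->
  (forall l, measurable_fun setT (fun w => v w l 0)) ->
  measurable_fun setT (fun w => dotv (u w) (v w)).
Proof.
move=> mu mv; apply: measurable_sum => l.
exact: measurable_funM.
Qed.

Lemma measurable_dotv_diff i j k l :
  measurable_fun setT (fun w => dotv (xs w i - xs w j) (xs w k - xs w l)).
Proof.
have mx a b c : measurable_fun setT (fun w => (xs w a - xs w b) c 0).
  by under eq_fun do rewrite !mxE; exact: measurable_funB.
by apply: measurable_dotv.
Qed.

Lemma measurable_sum_cond (I : Type) (r : seq I) (Q : pred I) (h : I -> T -> R) :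
  (forall i, Q i -> measurable_fun setT (h i)) ->
  measurable_fun setT (fun w => \sum_(i <- r | Q i) h i w).
Proof.
move=> mh.
rewrite (_ : (fun w => _) = fun w => \sum_(i <- r) if Q i then h i w else 0); last first.
  by apply/funext => w; rewrite big_mkcond.
by apply: measurable_sum => i; case Qi : (Q i) => //; exact: mh.
Qed.

Lemma measurable_cov_kernel i j k l : measurable_fun setT (fun w => cov_kernel (xs w) i j k l).
Proof. by apply: measurable_funM => //; apply: measurable_funX; exact: measurable_dotv_diff. Qed.

Lemma measurable_mean_stat : measurable_fun setT (fun w => mean_stat n (xs w)).
Proof.
apply: measurable_sum => tau; do 2!apply: measurable_funM => //.
do 4!(apply: measurable_sum_cond => ? _); exact: measurable_dotv_diff.
Qed.

Lemma measurable_cov_stat : measurable_fun setT (fun w => cov_stat n (xs w)).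
Proof.
apply: measurable_sum => tau; apply: measurable_funM => //.
apply: measurable_funB; [apply: measurable_funD|]; apply: measurable_funM => //;
  do 4!(apply: measurable_sum_cond => ? _); exact: measurable_cov_kernel.
Qed.

Lemma measurable_tr_sigma2_hat : measurable_fun setT (fun w => tr_sigma2_hat n (xs w)).
Proof.
apply: measurable_funM => //; apply: measurable_sum => i.
by apply: measurable_funX; exact: measurable_dotv_diff.
Qed.

Lemma measurable_sigma1_hat : measurable_fun setT (fun w => sigma1_hat n (xs w)).
Proof.
apply: (measurableT_comp (continuous_measurable_fun (@sqrt_continuous R))).
by apply: measurable_funM => //; exact: measurable_tr_sigma2_hat.
Qed.

Lemma measurable_sigma2_hat : measurable_fun setT (fun w => sigma2_hat n (xs w)).
Proof.
apply: (measurableT_comp (continuous_measurable_fun (@sqrt_continuous R))).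
apply: measurable_funM => //; apply: measurable_funX; exact: measurable_tr_sigma2_hat.
Qed.

Lemma measurable_mean_ratio :
  measurable_fun setT (fun w => (sigma1_hat n (xs w))^-1 * mean_stat n (xs w)).
Proof.
apply: measurable_funM; last exact: measurable_mean_stat.
by apply: measurable_inv_ge0; [exact: measurable_sigma1_hat|move=> w; exact: sqrtr_ge0].
Qed.

Lemma measurable_cov_ratio :
  measurable_fun setT (fun w => (sigma2_hat n (xs w))^-1 * cov_stat n (xs w)).
Proof.
apply: measurable_funM; last exact: measurable_cov_stat.
by apply: measurable_inv_ge0; [exact: measurable_sigma2_hat|move=> w; exact: sqrtr_ge0].
Qed.

Lemma measurable_pval (q : T -> R) :
  measurable_fun setT q -> measurable_fun setT (fun w => 1 - std_normal_cdf (q w)).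
Proof.
move=> mq; apply: measurable_funB => //.
exact: (measurableT_comp (@measurable_std_normal_cdf R)).
Qed.

Lemma measurable_combined_stat : measurable_fun setT (fun w => combined_stat n (xs w)).
Proof.
apply: measurable_funB; apply: measurable_funM => //; apply: measurableT_comp => //.
  exact: measurable_pval measurable_mean_ratio.
exact: measurable_pval measurable_cov_ratio.
Qed.

End Measurability.

(** [V] is a second moment and [th] the centre of the statistic; in the applications k is the sample
    size, u the signal and N the level that the signal ratio exceeds. *)
Lemma chebyshev_ratio (R : realFieldType) (V th a c k u N : R) :
  0 < a -> 0 < k -> 0 < u -> 0 < N -> 0 <= c -> a * (k * u) <= th -> V * N <= c * (k * u) ^+ 2 ->
  V / (th / 2) ^+ 2 <= 4 * c / a ^+ 2 / N.
Proof.
move=> a0 k0 u0 N0 c0 ath VN; have ku0 : 0 < k * u by rewrite mulr_gt0.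
have th0 : 0 < th by apply: lt_le_trans ath; rewrite mulr_gt0.
rewrite ler_pdivrMr; last by rewrite exprn_gt0// divr_gt0.
apply: (@le_trans _ _ (c * (k * u) ^+ 2 / N)); first by rewrite ler_pdivlMr.
have -> : 4 * c / a ^+ 2 / N * (th / 2) ^+ 2 = c * (th / a) ^+ 2 / N by field; rewrite !gt_eqF.
rewrite ler_wpM2r ?invr_ge0 ?(ltW N0)// ler_wpM2l//.
rewrite ler_sqr ?nnegrE ?divr_ge0 ?(ltW th0) ?(ltW a0) ?(ltW ku0)//.
by rewrite ler_pdivlMr// mulrC.
Qed.

Lemma markov_ratio (R : realFieldType) (V th a c k u N : R) :
  0 < a -> 0 < k -> 0 < u -> 0 < N -> 0 <= c -> a * (k * u) <= th -> V * N <= c * (k * u) ->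
  V / (th / 2) <= 2 * c / a / N.
Proof.
move=> a0 k0 u0 N0 c0 ath VN; have ku0 : 0 < k * u by rewrite mulr_gt0.
have th0 : 0 < th by apply: lt_le_trans ath; rewrite mulr_gt0.
rewrite ler_pdivrMr ?divr_gt0//.
apply: (@le_trans _ _ (c * (k * u) / N)); first by rewrite ler_pdivlMr.
have -> : 2 * c / a / N * (th / 2) = c * (th / a) / N by field; rewrite !gt_eqF.
rewrite ler_wpM2r ?invr_ge0 ?(ltW N0)// ler_wpM2l//.
by rewrite ler_pdivlMr// mulrC.
Qed.

Section FixedSampleBounds.
Context d (T : measurableType d) (R : realType) (P : probability T R)
  (n p : nat) (X : nat -> 'I_p -> {RV P >-> R}).
Hypothesis indX : independent_vectors n X.
Hypothesis X8 : moments8 P n X.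
Local Notation nice := (poly n X xpredT 8).
Local Notation pr A := (fine (P A)).
Local Notation in_range i := (1 <= i <= n)%N.
Local Notation Sigma i := (cov_mx (X i)).

(** The cross term is an inner product of positive semidefinite matrices, hence nonnegative, and is
    bounded by 2 x y <= x^2 + y^2. So the denominators of the signal ratios lie between [kappa2] and
    twice it. *)
Lemma tr_sqr_sumE i j : in_range i -> in_range j ->
  exists2 c, 0 <= c & \tr ((Sigma i + Sigma j) ^+ 2) =
    \tr (Sigma i ^+ 2) + \tr (Sigma j ^+ 2) + 2 * c /\
    2 * c <= \tr (Sigma i ^+ 2) + \tr (Sigma j ^+ 2).
Proof.
move=> ri rj; exists (\sum_k \sum_l Sigma i k l * Sigma j k l).
  have t4 a : in_range a -> tensor n X xpredT 4 (centered (X a)).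
    by move=> ra k; apply: poly_weaken (tensor_centered X ra k).
  have := gram_dot_ge0 X8 (t4 _ ri) (t4 _ rj).
  by under eq_bigr do under eq_bigr do rewrite (gram_centered _ _ _ ri) (gram_centered _ _ _ rj).
rewrite !tr_sqr_sym; try exact: cov_mx_sym; last first.
  by move=> k l; rewrite [LHS]mxE [RHS]mxE; congr (_ + _); exact: cov_mx_sym.
split.
  rewrite mulr_sumr -!big_split/=; apply: eq_bigr => k _.
  rewrite mulr_sumr -!big_split/=; apply: eq_bigr => l _.
  have -> : (Sigma i + Sigma j) k l = Sigma i k l + Sigma j k l by rewrite [LHS]mxE.
  ring.
rewrite mulr_sumr -!big_split/=; apply: ler_sum => k _.
rewrite mulr_sumr -!big_split/=; apply: ler_sum => l _.
by have := sqr_ge0 (Sigma i k l - Sigma j k l); lra.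
Qed.

Variables (mu1 mu2 : 'cV[R]_p) (S1 S2 : 'M[R]_p) (ts : nat) (C4 : R).
Hypothesis mean_cp : forall i, in_range i ->
  mean_vec (X i) = if (i <= ts)%N then mu1 else mu2.
Hypothesis cov_cp : forall i, in_range i -> Sigma i = if (i <= ts)%N then S1 else S2.
Hypothesis C4_ge0 : 0 <= C4.
Hypothesis fourth : forall i, in_range i ->
  gram_norm2 P (outer (centered (X i)) (centered (X i))) <= C4 * \tr (Sigma i ^+ 2) ^+ 2.
Hypotheses (S1_sym : sym_mx S1) (S2_sym : sym_mx S2).
Local Notation delta2 := (delta2 mu1 mu2).
Local Notation kappa2 := (kappa2 S1 S2).
Local Notation kappa := (kappa mu1 mu2 S1 S2).
Local Notation D2 := (\tr ((S1 - S2) ^+ 2)).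
Let xs w := realized_sample X w.

Lemma prob_tr_eq0 m : (0 < m)%N -> (4 * m <= ts)%N -> (4 * m <= n - ts)%N -> 0 < kappa2 ->
  pr [set w | tr_sigma2_hat n (xs w) = 0] <= 32 * (C4 + 1) / m%:R.
Proof.
move=> m0 mts mnts k0; have n4 : (4 <= n)%N by lia.
(* The blocks are placed in the segment with the larger trace t, so that kappa2 <= 2 t. *)
have [h|h] := leP (\tr (S2 ^+ 2)) (\tr (S1 ^+ 2)); rewrite /kappa2 in k0.
  apply: (@prob_tr_sigma2_hat_eq0 _ _ _ _ _ _ _ indX X8 _ _ _ _ _ mean_cp cov_cp
    S1_sym S2_sym _ C4_ge0 fourth true 0 m m0) => //=.
  - by move=> i hi; split; lia.
  - lra.
  - by rewrite /kappa2; lra.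
apply: (@prob_tr_sigma2_hat_eq0 _ _ _ _ _ _ _ indX X8 _ _ _ _ _ mean_cp cov_cp
    S1_sym S2_sym _ C4_ge0 fourth false ts m m0) => //=.
- by move=> i hi; split; lia.
- lra.
- by rewrite /kappa2; lra.
Qed.

Variables (cc t N : R) (m : nat).
Hypotheses (cc0 : 0 < cc) (cts : cc * n%:R <= ts%:R) (cnts : cc * n%:R <= (n - ts)%N%:R).
Hypotheses (n128 : (128 <= n)%N) (ts32 : (32 <= ts)%N) (nts32 : (32 <= n - ts)%N).
Hypotheses (m0 : (0 < m)%N) (mts : (4 * m <= ts)%N) (mnts : (4 * m <= n - ts)%N).
Hypotheses (N1 : 1 <= N) (Nm : N <= m%:R) (Nn : N <= n%:R) (t0 : 0 <= t) (k0 : 0 < kappa2).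

Let n0 : 0 < n%:R :> R.
Proof. by rewrite ltr0n; exact: leq_trans n128. Qed.

Let N0 : 0 < N. Proof. exact: lt_le_trans N1. Qed.

Let n1 : 1 <= n%:R :> R. Proof. exact: le_trans Nn. Qed.

Let d0 : 0 <= delta2. Proof. exact: delta2_ge0. Qed.

Let prob_tr0 : pr [set w | tr_sigma2_hat n (xs w) = 0] <= 32 * (C4 + 1) / N.
Proof.
apply: le_trans (prob_tr_eq0 m0 mts mnts k0) _.
rewrite ler_wpM2l ?lef_pV2 ?posrE ?ltr0n// mulr_ge0// addr_ge0//.
Qed.

Let sq0 (q : R) : 0 < q -> 0 < q * n%:R ^+ 2.
Proof. by move=> q0; rewrite mulr_gt0// exprn_gt0. Qed.

Let tr0 w : 0 <= tr_sigma2_hat n (xs w). Proof. exact: tr_sigma2_hat_ge0. Qed.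

Let q1 : R := (2 * pi ^+ 2 - 18) / 3.
Let q2 : R := (4 * pi ^+ 2 - 36) / 3.
Let pi9 : 9 < pi ^+ 2 :> R.
Proof. by have := @pi_gt3 R; nra. Qed.
Let q10 : 0 < q1. Proof. by have := pi9; rewrite /q1; lra. Qed.
Let q20 : 0 < q2. Proof. by have := pi9; rewrite /q2; lra. Qed.

(** The summands correspond to the three causes of a small ratio. Here a = cc^2 / 64 combines the
    weight n^2 / 32 with the quadruple fraction cc^2 / 2, and 20 = 16 + 4 adds quadratic and linear
    noise. *)
Definition mean_const : R :=
  let a := cc ^+ 2 / 64 in
  32 * (C4 + 1) + 4 * (192 * 4 ^+ 2 * 20) / a ^+ 2 + 4 * (64 * (t ^+ 2 * q1)) / a ^+ 2.

Lemma prob_mean_stat_le : N * Num.sqrt kappa2 <= n%:R * delta2 ->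
  pr [set w | (sigma1_hat n (xs w))^-1 * mean_stat n (xs w) <= t] <= mean_const / N.
Proof.
set s := Num.sqrt kappa2; set u := n%:R * delta2 => Nk.
have s0 : 0 < s by rewrite sqrtr_gt0.
have sE : kappa2 = s ^+ 2 by rewrite sqr_sqrtr// ltW.
have su : s <= u by apply: le_trans Nk; rewrite ler_peMl// ltW.
have u0 : 0 < u by exact: lt_le_trans su.
have sNu : s * N * s <= u * u.
  by apply: ler_pM => //; [rewrite mulr_ge0// ltW|rewrite ltW|rewrite mulrC].
have nN2 : N <= n%:R ^+ 2 by apply: le_trans Nn _; rewrite ler_eXnr.
set th := mean_stat_signal n X.
have thE : cc ^+ 2 / 64 * (n%:R * u) <= th.
  have := mean_stat_signal_ge mean_cp (ltW cc0) cts cnts ts32 nts32 n128.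
  by apply: le_trans; rewrite /u; lra.
have a0 : 0 < cc ^+ 2 / 64 by rewrite divr_gt0// exprn_gt0.
have th0 : 0 < th by apply: lt_le_trans thE; rewrite mulr_gt0// mulr_gt0.
have s1_ge0 w : 0 <= sigma1_hat n (xs w) by exact: sqrtr_ge0.
apply: le_trans (@prob_ratio_le _ _ _ _ _ _ _ X8 _ _ th t (measurable_sigma1_hat n X)
  (measurable_mean_stat n X) s1_ge0 th0 (nice_mean_stat_dev n X)) _.
rewrite /mean_const [leRHS]mulrDl [X in _ <= X + _]mulrDl; apply: lerD; first apply: lerD.
- apply: le_trans _ prob_tr0; apply: fine_prob_le.
  + exact/measurable_eq0/measurable_sigma1_hat.
  + exact/measurable_eq0/measurable_tr_sigma2_hat.
  + move=> w /= /eqP; rewrite sqrtr_eq0 pmulr_rle0 ?sq0// => h.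
    by apply/eqP; rewrite eq_le h tr0.
- apply: (chebyshev_ratio a0 n0 u0 N0 _ thE); first by rewrite mulr_ge0// mulr_ge0// sqr_ge0.
  apply: (@le_trans _ _ (n%:R ^+ 2 * (192 * 4 ^+ 2 *
      (4 ^+ 2 * kappa2 + n%:R * (4 * Num.sqrt kappa2 * delta2))) * N)).
    rewrite ler_wpM2r ?(ltW N0)//.
    exact: (mean_stat_noise indX X8 mean_cp cov_cp S1_sym S2_sym).
  rewrite -/s sE; have -> : n%:R * (4 * s * delta2) = 4 * (s * u) by rewrite /u; ring.
  have h : (4 ^+ 2 * s ^+ 2 + 4 * (s * u)) * N <= 20 * u ^+ 2.
    have -> : (4 ^+ 2 * s ^+ 2 + 4 * (s * u)) * N = 16 * (s * N * s) + 4 * (N * s * u) by ring.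
    have : N * s * u <= u * u by rewrite ler_wpM2r// ltW.
    by rewrite expr2; move: sNu; lra.
  have : 0 <= n%:R ^+ 2 * (192 * 4 ^+ 2) :> R by rewrite mulr_ge0// ?sqr_ge0// mulr_ge0// sqr_ge0.
  by move=> c0; have := ler_wpM2l c0 h; lra.
- have nf : nice (fun w => t ^+ 2 * (q1 * n%:R ^+ 2) * tr_sigma2_hat n (xs w)).
    by apply: polyZ; exact: nice_tr_sigma2_hat.
  (* Squaring removes the root in [sigma1_hat], so that Markov applies to the trace estimator
     itself. *)
  apply: (@le_trans _ _ (pr [set w | (th / 2) ^+ 2 <=
      t ^+ 2 * (q1 * n%:R ^+ 2) * tr_sigma2_hat n (xs w)])).
    apply: fine_prob_le.
    + by apply: measurable_geC; apply: measurable_funM => //; exact: measurable_sigma1_hat.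
    + by apply: measurable_geC; exact: poly_measurable nf.
    + move=> w /= h.
      have : (th / 2) ^+ 2 <= (t * sigma1_hat n (xs w)) ^+ 2.
        by rewrite ler_sqr ?nnegrE ?divr_ge0 ?(ltW th0)// mulr_ge0// sqrtr_ge0.
      rewrite [X in _ <= X -> _]exprMn sqr_sqrtr; last first.
        by apply: mulr_ge0 => //; apply: ltW; exact: sq0.
      by rewrite [X in _ <= X -> _]mulrA.
  apply: le_trans (Ex_markov X8 nf _ _) _.
  + by move=> w; rewrite mulr_ge0// mulr_ge0 ?sqr_ge0// (ltW (sq0 q10)).
  + by rewrite exprn_gt0// divr_gt0.
  apply: (chebyshev_ratio a0 n0 u0 N0 _ thE).
    by rewrite mulr_ge0// mulr_ge0 ?sqr_ge0// ltW.
  rewrite (ExZ X8); last exact: nice_tr_sigma2_hat.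
  have n4 : (4 <= n)%N by exact: leq_trans n128.
  have ET := Ex_tr_sigma2_hat indX X8 mean_cp cov_cp S1_sym S2_sym n4.
  rewrite /kappa sE in ET.
  (* The contamination of the trace estimator by the mean jump is harmless: delta2^2 N <= (n
     delta2)^2, because N <= n^2. *)
  have h : (s ^+ 2 + delta2 ^+ 2) * N <= 2 * u ^+ 2.
    have : delta2 ^+ 2 * N <= delta2 ^+ 2 * n%:R ^+ 2 by rewrite ler_wpM2l// sqr_ge0.
    have -> : delta2 ^+ 2 * n%:R ^+ 2 = u * u by rewrite /u; ring.
    have -> : (s ^+ 2 + delta2 ^+ 2) * N = s * N * s + delta2 ^+ 2 * N by ring.
    have -> : 2 * u ^+ 2 = u * u + u * u by ring.
    exact: lerD.
  have c0 : 0 <= t ^+ 2 * (q1 * n%:R ^+ 2) by rewrite mulr_ge0 ?sqr_ge0// (ltW (sq0 q10)).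
  apply: (@le_trans _ _ (t ^+ 2 * (q1 * n%:R ^+ 2) * (32 * (s ^+ 2 + delta2 ^+ 2)) * N)).
    by rewrite ler_wpM2r ?(ltW N0)// ler_wpM2l.
  have := ler_wpM2l c0 h; lra.
Qed.

Variable B : R.
Hypotheses (B_ge0 : 0 <= B) (meanB : (n%:R * delta2) ^+ 2 <= B * kappa2).

(** A bounded mean signal gives kappa <= (1 + B) kappa2, so the noise constant of the covariance
    statistic is at most [L * kappa2]. *)
Let L : R := 104 * (1 + C4) * (1 + B).

Definition cov_const : R :=
  let a := cc ^+ 4 / 128 in
  32 * (C4 + 1) + 4 * (9 * (192 * 3 ^+ 2) * (L ^+ 2 + 8 * L * (1 + B))) / a ^+ 2
  + 2 * (t * Num.sqrt q2 * 32 * (1 + B)) / a.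

Lemma prob_cov_stat_le : N * kappa2 <= n%:R * D2 -> 3 / 2 * B <= cc ^+ 4 / 128 * N ->
  pr [set w | (sigma2_hat n (xs w))^-1 * cov_stat n (xs w) <= t] <= cov_const / N.
Proof.
set u := n%:R * D2 => Nk BN.
have ku : kappa2 <= u by apply: le_trans Nk; rewrite ler_peMl// ltW.
have u0 : 0 < u by exact: lt_le_trans ku.
have a0 : 0 < cc ^+ 4 / 128 by rewrite divr_gt0// exprn_gt0.
have nd2 : n%:R * delta2 ^+ 2 <= n%:R * (n%:R * delta2 ^+ 2).
  by rewrite ler_peMl// mulr_ge0 ?(ltW n0)// sqr_ge0.
have d2 : delta2 ^+ 2 <= n%:R * delta2 ^+ 2 by rewrite ler_peMl// sqr_ge0.
have meanB' : n%:R * (n%:R * delta2 ^+ 2) <= B * kappa2 by apply: le_trans meanB; lra.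
set th := cov_stat_signal n X S1 S2 ts.
have thE : cc ^+ 4 / 128 * (n%:R * u) <= th.
  have := cov_stat_signal_ge mean_cp cov_cp S1_sym S2_sym (ltW cc0) cts cnts ts32 nts32 n128.
  apply: le_trans; set a := cc ^+ 4 / 128 in a0 BN *.
  have -> : cc ^+ 4 / 64 = 2 * a by rewrite /a; lra.
  (* Half of the covariance signal absorbs the negative contribution of the mean jump; this halving
     turns cc^4 / 64 into cc^4 / 128. *)
  have h1 : 3 / 2 * (n%:R * (n%:R * delta2 ^+ 2)) <= a * u.
    apply: (@le_trans _ _ (3 / 2 * B * kappa2)); first by move: meanB'; lra.
    apply: (@le_trans _ _ (a * (N * kappa2))); first by rewrite mulrA ler_wpM2r// ltW.
    by rewrite ler_wpM2l// ltW.
  have h2 : a * u <= n%:R * (a * u) by rewrite ler_peMl// mulr_ge0 ?ltW.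
  have -> : n%:R ^+ 2 * (2 * a * D2 - 3 / 2 * delta2 ^+ 2) =
    2 * (n%:R * (a * u)) - 3 / 2 * (n%:R * (n%:R * delta2 ^+ 2)) by rewrite /u; ring.
  by move: h1 h2; lra.
have th0 : 0 < th by apply: lt_le_trans thE; rewrite mulr_gt0// mulr_gt0.
have s2_ge0 w : 0 <= sigma2_hat n (xs w) by exact: sqrtr_ge0.
(* This scale is linear in the trace estimator, so Markov applies to it without squaring. *)
have s2E w : sigma2_hat n (xs w) = Num.sqrt q2 * n%:R * tr_sigma2_hat n (xs w).
  rewrite /sigma2_hat -/q2 -[_ * _ ^+ 2 * _ ^+ 2]mulrA -exprMn sqrtrM ?(ltW q20)//.
  have nt0 : 0 <= n%:R * tr_sigma2_hat n (xs w) by rewrite mulr_ge0 ?(ltW n0)//; exact: tr0.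
  by rewrite sqrtr_sqr ger0_norm// [LHS]mulrA.
have sq20 : 0 < Num.sqrt q2 by rewrite sqrtr_gt0.
have kapB : kappa <= (1 + B) * kappa2.
  by rewrite /kappa mulrDl mul1r lerD2l; apply: le_trans d2 _; exact: le_trans nd2 _.
have B1 : 0 <= 1 + B by rewrite addr_ge0.
apply: le_trans (@prob_ratio_le _ _ _ _ _ _ _ X8 _ _ th t (measurable_sigma2_hat n X)
  (measurable_cov_stat n X) s2_ge0 th0 (nice_cov_stat_dev n X S1 S2 ts)) _.
rewrite /cov_const [leRHS]mulrDl [X in _ <= X + _]mulrDl; apply: lerD; first apply: lerD.
- apply: le_trans _ prob_tr0; apply: fine_prob_le.
  + exact/measurable_eq0/measurable_sigma2_hat.
  + exact/measurable_eq0/measurable_tr_sigma2_hat.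
  + move=> w /= /eqP; rewrite s2E mulf_eq0 gt_eqF ?mulr_gt0//= => /eqP//.
- have L0 : 0 <= L by rewrite /L mulr_ge0// mulr_ge0// addr_ge0.
  have LB : 0 <= L ^+ 2 + 8 * L * (1 + B) by rewrite addr_ge0 ?sqr_ge0// mulr_ge0// mulr_ge0.
  apply: (chebyshev_ratio a0 n0 u0 N0 _ thE).
    by rewrite mulr_ge0// mulr_ge0// mulr_ge0// sqr_ge0.
  set c := 104 * (1 + C4) * kappa.
  have c0 : 0 <= c by exact: noise_bound_ge0.
  have cL : c <= L * kappa2.
    rewrite /c /L -[X in _ <= X]mulrA ler_wpM2l// mulr_ge0// addr_ge0//.
  apply: (@le_trans _ _ (n%:R ^+ 2 * (9 * (192 * 3 ^+ 2 *
      (c ^+ 2 + n%:R * (c * (8 * (D2 + delta2 ^+ 2)))))) * N)).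
    rewrite ler_wpM2r ?(ltW N0)//.
    exact: (cov_stat_noise indX X8 mean_cp cov_cp S1_sym S2_sym C4_ge0 fourth).
  have cN : c * N <= L * u.
    apply: (@le_trans _ _ (L * kappa2 * N)); first by rewrite ler_wpM2r// ltW.
    by rewrite -mulrA ler_wpM2l// mulrC.
  have cu : c <= L * u by apply: le_trans cL _; rewrite ler_wpM2l.
  have h1 : c * (c * N) <= L * u * (L * u) by apply: ler_pM => //; rewrite mulr_ge0// ltW.
  have un : n%:R * (D2 + delta2 ^+ 2) <= (1 + B) * u.
    rewrite mulrDr mulrDl mul1r lerD2l; apply: le_trans nd2 _; apply: le_trans meanB' _.
    by rewrite ler_wpM2l.
  have D20 : 0 <= D2 by move: u0; rewrite /u pmulr_rgt0// => /ltW.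
  have h2 : c * N * (n%:R * (D2 + delta2 ^+ 2)) <= L * u * ((1 + B) * u).
    apply: ler_pM => //; first by rewrite mulr_ge0// ltW.
    by rewrite mulr_ge0 ?(ltW n0)// addr_ge0// sqr_ge0.
  have h : (c ^+ 2 + n%:R * (c * (8 * (D2 + delta2 ^+ 2)))) * N <=
      (L ^+ 2 + 8 * L * (1 + B)) * u ^+ 2.
    have -> : (c ^+ 2 + n%:R * (c * (8 * (D2 + delta2 ^+ 2)))) * N =
      c * (c * N) + 8 * (c * N * (n%:R * (D2 + delta2 ^+ 2))) by ring.
    have -> : (L ^+ 2 + 8 * L * (1 + B)) * u ^+ 2 =
      L * u * (L * u) + 8 * (L * u * ((1 + B) * u)) by ring.
    by rewrite lerD// ler_wpM2l.
  have w0 : 0 <= n%:R ^+ 2 * (9 * (192 * 3 ^+ 2)) :> R.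
    by rewrite mulr_ge0 ?sqr_ge0// mulr_ge0// mulr_ge0// sqr_ge0.
  by have := ler_wpM2l w0 h; congr (_ <= _); ring.
- have nf : nice (fun w => t * (Num.sqrt q2 * n%:R) * tr_sigma2_hat n (xs w)).
    by apply: polyZ; exact: nice_tr_sigma2_hat.
  have tq0 : 0 <= t * (Num.sqrt q2 * n%:R) by rewrite mulr_ge0// mulr_ge0 ?sqrtr_ge0 ?(ltW n0).
  rewrite (_ : [set w | th / 2 <= _] = [set w | th / 2 <=
      t * (Num.sqrt q2 * n%:R) * tr_sigma2_hat n (xs w)]); last first.
    have e w : t * sigma2_hat n (xs w) = t * (Num.sqrt q2 * n%:R) * tr_sigma2_hat n (xs w).
      by rewrite s2E; ring.
    by apply/seteqP; split => w /=; rewrite -/(xs w) e.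
  apply: le_trans (Ex_markov X8 nf _ _) _.
  + by move=> w; rewrite mulr_ge0.
  + by rewrite divr_gt0.
  apply: (markov_ratio a0 n0 u0 N0 _ thE).
    by rewrite mulr_ge0// mulr_ge0// mulr_ge0// ltW.
  rewrite (ExZ X8); last exact: nice_tr_sigma2_hat.
  have n4 : (4 <= n)%N by exact: leq_trans n128.
  have ET := Ex_tr_sigma2_hat indX X8 mean_cp cov_cp S1_sym S2_sym n4.
  apply: (@le_trans _ _ (t * (Num.sqrt q2 * n%:R) * (32 * ((1 + B) * kappa2)) * N)).
    rewrite ler_wpM2r ?(ltW N0)// ler_wpM2l//; apply: le_trans ET _.
    by rewrite ler_wpM2l.
  have -> : t * (Num.sqrt q2 * n%:R) * (32 * ((1 + B) * kappa2)) * N =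
    t * (Num.sqrt q2 * n%:R) * (32 * (1 + B)) * (N * kappa2) by ring.
  have -> : t * Num.sqrt q2 * 32 * (1 + B) * (n%:R * u) =
    t * (Num.sqrt q2 * n%:R) * (32 * (1 + B)) * u by ring.
  by rewrite ler_wpM2l// mulr_ge0// mulr_ge0.
Qed.

End FixedSampleBounds.

(** * Convergence in probability *)

Section PvalueEvents.
Variable R : realType.

Lemma pval_large (eps : R) : 0 < eps ->
  exists2 t, 0 <= t & forall x, eps <= 1 - std_normal_cdf x -> x <= t.
Proof.
move=> e0; have [t ht] := std_normal_cdf_cvg1 e0.
exists (Num.max 0 t); first by rewrite le_max lexx.
move=> x ex; rewrite le_max; apply/orP; right; rewrite leNgt; apply/negP => tx.
by have := std_normal_cdf_nd (ltW tx); lra.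
Qed.

Lemma pval_in01 (x : R) : 0 < 1 - std_normal_cdf x <= 1.
Proof. by have := std_normal_cdf_lt1 x; have := std_normal_cdf_ge0 x; lra. Qed.

(** P-values lie in ]0, 1], so both logarithmic terms are nonnegative and a bound on their sum
    bounds each. Hence one p-value tending to 0 is enough for the combined statistic to diverge. *)
Lemma combined_stat_le p n (x : nat -> 'cV[R]_p) A : combined_stat n x <= A ->
  expR (- A / 2) <= pval_mean n x /\ expR (- A / 2) <= pval_cov n x.
Proof.
rewrite /combined_stat /pval_mean /pval_cov.
set u := 1 - _; set v := 1 - _ => uvA.
have /andP[u0 u1] : 0 < u <= 1 by exact: pval_in01.
have /andP[v0 v1] : 0 < v <= 1 by exact: pval_in01.
have lu := ln_le0 u1; have lv := ln_le0 v1.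
by split; rewrite -[leRHS]lnK ?posrE// ler_expR; lra.
Qed.

End PvalueEvents.

Lemma cvg_prob0 (R : realType) (d : nat -> measure_display)
    (T : forall n, measurableType (d n)) (P : forall n, probability (T n) R)
    (A : forall n, set (T n)) : (forall n, measurable (A n)) ->
  (forall eps : R, 0 < eps -> \forall n \near \oo, fine (P n (A n)) <= eps) ->
  P n (A n) @[n --> \oo] --> 0%E.
Proof.
move=> mA small; apply/fine_cvgP; split.
  by apply: nearW => n; rewrite fin_num_measure.
apply/cvgrPdist_le => eps /small; apply: filterS => n h /=.
by rewrite sub0r normrN ger0_norm// fine_ge0.
Qed.

Section StudentizedLimits.
Variables (R : realType) (d : nat -> measure_display)
  (T : forall n, measurableType (d n)) (P : forall n, probability (T n) R)
  (q : forall n, T n -> R).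
Hypothesis mq : forall n, measurable_fun setT (q (n := n)).
Hypothesis q_large : forall t eps : R, 0 <= t -> 0 < eps ->
  \forall n \near \oo, fine (P n [set w | q w <= t]) <= eps.

(** Serves both conclusions: each concerns events on which the p-value stays above a fixed positive
    level, and there the studentized statistic is bounded. *)
Lemma prob_pval_ge (eps : R) (A : forall n, set (T n)) : 0 < eps ->
  (forall n, measurable (A n)) -> (forall n w, A n w -> eps <= 1 - std_normal_cdf (q w)) ->
  P n (A n) @[n --> \oo] --> 0%E.
Proof.
move=> e0 mA Ap; have [t t0 ht] := pval_large e0.
apply: cvg_prob0 => // e /(q_large t0); apply: filterS => n; apply: le_trans.
apply: fine_prob_le => //; first exact: measurable_leC.
by move=> w /Ap /ht.
Qed.

Lemma cvg_pval : cvg_in_probability P (fun n w => 1 - std_normal_cdf (q w)) 0.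
Proof.
move=> eps e0; apply: (prob_pval_ge e0) => [n|n w /=].
  apply: measurable_geC; apply: measurableT_comp => //; apply: measurable_funB => //.
  exact: measurable_pval.
by rewrite subr0 ger0_norm//; have /andP[/ltW] := pval_in01 (q w).
Qed.

Lemma cvg_pinfty_combined (Y : forall n, T n -> R) :
  (forall n, measurable_fun setT (Y n)) ->
  (forall A n w, Y n w <= A -> expR (- A / 2) <= 1 - std_normal_cdf (q w)) ->
  cvg_pinfty_in_probability P Y.
Proof.
move=> mY YA A; apply: (prob_pval_ge (expR_gt0 (- A / 2))) => [n|n w /= /YA//].
exact: measurable_leC.
Qed.

End StudentizedLimits.

Section SignalRatios.
Variables (R : rcfType) (x tau K N : R).
Hypotheses (tauK : K <= tau <= 2 * K) (N1 : 1 <= N).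

(** A vanishing denominator would make the ratio 0 by convention, against 1 <= N. In this way a
    large signal ratio itself provides nondegenerate covariances. *)
Lemma ratio_sqrt_ge : N <= x / Num.sqrt tau -> 0 < K /\ N * Num.sqrt K <= x.
Proof.
move: tauK => /andP[t1 t2] h; have s0 : 0 < Num.sqrt tau.
  rewrite lt_neqAle sqrtr_ge0 andbT eq_sym; apply: contraTneq h => ->.
  by rewrite invr0 mulr0 -ltNge; exact: lt_le_trans N1.
split; first by move: s0; rewrite sqrtr_gt0; lra.
apply: (@le_trans _ _ (N * Num.sqrt tau)); last by rewrite -ler_pdivlMr.
by rewrite ler_wpM2l ?ler_wsqrtr//; exact: le_trans N1.
Qed.

Lemma ratio_ge : 0 <= K -> N <= x / tau -> 0 < K /\ N * K <= x.
Proof.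
move: tauK => /andP[t1 t2] K0 h; have t0 : 0 < tau.
  rewrite lt_neqAle (le_trans K0 t1) andbT eq_sym; apply: contraTneq h => ->.
  by rewrite invr0 mulr0 -ltNge; exact: lt_le_trans N1.
split; first by lra.
apply: (@le_trans _ _ (N * tau)); last by rewrite -ler_pdivlMr.
by rewrite ler_wpM2l//; exact: le_trans N1.
Qed.

Lemma ratio_sqrt_bounded k : 0 < K -> `|x / Num.sqrt tau| <= k -> x ^+ 2 <= 2 * k ^+ 2 * K.
Proof.
move: tauK => /andP[t1 t2] K0 h; have t0 : 0 < tau by lra.
have k0 : 0 <= k by exact: le_trans h.
rewrite -[leLHS]real_normK ?num_real//.
move: h; rewrite normrM normfV [X in _ / X]ger0_norm ?sqrtr_ge0// ler_pdivrMr ?sqrtr_gt0// => h.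
apply: (@le_trans _ _ ((k * Num.sqrt tau) ^+ 2)).
  by rewrite ler_sqr ?nnegrE// mulr_ge0// sqrtr_ge0.
rewrite exprMn sqr_sqrtr ?(ltW t0)//.
by have := ler_wpM2l (sqr_ge0 k) t2; lra.
Qed.

End SignalRatios.

Section ChangePoint.
Variables (R : realType) (rho : R).
Hypothesis rho01 : 0 < rho < 1.

(** The half leaves room for the rounding of rho n to an integer. *)
Definition cp_margin : R := Num.min rho (1 - rho) / 2.

Lemma cp_margin_gt0 : 0 < cp_margin.
Proof. by rewrite divr_gt0// lt_min; move: rho01; lra. Qed.

Lemma changepoint_near (N : nat) : \forall n \near \oo,
  let ts := Num.truncn (rho * n%:R) in
  [/\ (N <= ts)%N, (N <= n - ts)%N, cp_margin * n%:R <= ts%:R &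
      cp_margin * n%:R <= (n - ts)%N%:R].
Proof.
have c0 := cp_margin_gt0; have /andP[r0 r1] := rho01.
have [c1 c2] : 2 * cp_margin <= rho /\ 2 * cp_margin <= 1 - rho.
  by rewrite /cp_margin; split; rewrite mulrC divfK// ge_min lexx ?orbT.
near=> n.
(* Both rho n and (1 - rho) n are at least twice [cp_margin * n]: one copy is the bound to be
   proved, the other pays for [N] and for the rounding. *)
have hN : (N.+1)%:R <= cp_margin * n%:R.
  rewrite mulrC -ler_pdivrMr//; near: n; exact: nbhs_infty_ger.
have n0 : 0 <= n%:R :> R by [].
have rn0 : 0 <= rho * n%:R by rewrite mulr_ge0// ltW.
have /andP[t1 t2] := truncn_itv rn0.
set ts := Num.truncn _ in t1 t2 *.
have hr := ler_wpM2r n0 c1; have hr2 := ler_wpM2r n0 c2.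
rewrite -natr1 in t2; rewrite -natr1 in hN.
have tsn : (ts <= n)%N.
  rewrite -(ler_nat R); apply: le_trans t1 _; rewrite ler_piMl// ltW//.
have N0 : 0 <= N%:R :> R by [].
have e : (n - ts)%N%:R = n%:R - ts%:R :> R by rewrite natrB.
split.
- by rewrite -(ler_nat R); lra.
- by rewrite -(ler_nat R) e; lra.
- lra.
- by rewrite e; lra.
Unshelve. all: by end_near. Qed.

End ChangePoint.

(** Each segment has to hold [m] disjoint blocks of four; the extra 128 covers the thresholds of the
    counting and weight bounds. *)
Lemma margin_bounds m ts n : (4 * m + 128 <= ts)%N -> (4 * m + 128 <= n - ts)%N ->
  [/\ (128 <= n)%N, (1 <= n)%N & (m <= n)%N] /\
  [/\ (32 <= ts)%N, (32 <= n - ts)%N, (4 * m <= ts)%N & (4 * m <= n - ts)%N].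
Proof. by move=> h1 h2; do 2!split; lia. Qed.

Theorem theorem2 (R : realType) (d : nat -> measure_display)
    (T : forall n, measurableType (d n)) (P : forall n, probability (T n) R)
    (p : nat -> nat) (X : forall n, nat -> 'I_(p n) -> {RV (P n) >-> R})
    (rho : R) :
  let mu n i := mean_vec (X n i) in
  let Sigma n i := cov_mx (X n i) in
  p n @[n --> \oo] --> \oo ->
  (forall n, independent_vectors n (X n)) ->
  (* existence of the cumulants of order at most 8 *)
  (forall n i l, (1 <= i <= n)%N -> (X n i l : T n -> R) \in Lfun (P n) 8%:E) ->
  (* changepoint *)
  0 < rho < 1 ->
  (\forall n \near \oo,
     (forall i, (1 <= i <= n)%N ->
        (mu n i, Sigma n i) =
        if (i <= Num.truncn (rho * n%:R))%N then (mu n 1%N, Sigma n 1%N)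
        else (mu n n, Sigma n n)) /\
     (mu n 1%N, Sigma n 1%N) <> (mu n n, Sigma n n)) ->
  (* condition (1) *)
  (forall eps : R, 0 < eps -> \forall n \near \oo,
     forall i, (1 <= i <= n)%N ->
     \tr (Sigma n i ^+ 4) <= eps * \tr (Sigma n i ^+ 2) ^+ 2) ->
  (* condition (2) *)
  (exists C : R, forall n i h, (1 <= i <= n)%N -> (2 <= h <= 4)%N ->
     sum_cumulant2 h (X n i) <= C * \tr (Sigma n i ^+ 2) `^ (h%:R / 2)) ->
  (* condition (3) *)
  (exists C : R, forall n i h, (1 <= i <= n)%N -> (5 <= h <= 8)%N ->
     sum_cumulant2 h (X n i) <= C * \tr (Sigma n i ^+ 2) `^ (h%:R / 2)) ->
  (forall eps : R, 0 < eps -> \forall n \near \oo,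
     forall i, (1 <= i <= n)%N ->
     sum_cumulant2 4 (X n i) <= eps * \tr (Sigma n i ^+ 2) ^+ 2) ->
  let ratio_mean n :=
    mean_signal n (mu n 1%N) (mu n n) (Sigma n 1%N) (Sigma n n) in
  let ratio_cov n := cov_signal n (Sigma n 1%N) (Sigma n n) in
  let pM n w := pval_mean n (realized_sample (X n) w) in
  let pV n w := pval_cov n (realized_sample (X n) w) in
  let Tstat n w := combined_stat n (realized_sample (X n) w) in
  (ratio_mean n @[n --> \oo] --> +oo ->
     cvg_in_probability P pM 0 /\ cvg_pinfty_in_probability P Tstat) /\
  ((ratio_mean : nat -> R^o) =O_\oo (fun=> 1 : R^o) ->
   ratio_cov n @[n --> \oo] --> +oo ->
     cvg_in_probability P pV 0 /\ cvg_pinfty_in_probability P Tstat).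
Proof.
move=> mu Sigma _ indX X8 rho01 cp _ [C cum] _ _ ratio_mean ratio_cov pM pV Tstat.
pose C4 : R := 2 * (`|C| + npart R ^+ 2).
have C40 : 0 <= C4 by rewrite mulr_ge0// addr_ge0// sqr_ge0.
have Ssym n i k l : Sigma n i k l = Sigma n i l k by exact: cov_mx_sym.
have fourth n i : (1 <= i <= n)%N ->
    gram_norm2 (P n) (outer (centered (X n i)) (centered (X n i))) <=
    C4 * \tr (Sigma n i ^+ 2) ^+ 2.
  move=> ri; apply: (fourth_moment_le (X8 n) ri).
  have t0 : 0 <= \tr (Sigma n i ^+ 2) by exact: tr_sqr_ge0.
  (* At order four the real exponent h / 2 is 2, so the power becomes a square. *)
  have := cum n i 4 ri isT; rewrite (_ : 4%:R / 2 = 2%:R); last lra.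
  by rewrite powR_mulrn.
pose cc := cp_margin rho; have cc0 : 0 < cc := cp_margin_gt0 rho01.
pose ts n := Num.truncn (rho * n%:R).
have cp_split n : (forall i, (1 <= i <= n)%N -> (mu n i, Sigma n i) =
    if (i <= ts n)%N then (mu n 1%N, Sigma n 1%N) else (mu n n, Sigma n n)) ->
  (forall i, (1 <= i <= n)%N -> mu n i = if (i <= ts n)%N then mu n 1%N else mu n n) /\
  (forall i, (1 <= i <= n)%N -> Sigma n i = if (i <= ts n)%N then Sigma n 1%N else Sigma n n).
  by move=> h; split=> i /h; case: ifP => _ [].
have trB n : (1 <= n)%N ->
    let K := kappa2 (Sigma n 1%N) (Sigma n n) in
    K <= \tr ((Sigma n 1%N + Sigma n n) ^+ 2) <= 2 * K.
  move=> n1; have [||c c0 [-> hc]] := @tr_sqr_sumE _ _ _ (P n) n (p n) (X n) (X8 n) 1 n.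
  - by rewrite n1.
  - by rewrite n1 leqnn.
  by rewrite /kappa2/=; apply/andP; split; lra.
have d2E n : enorm (mu n 1%N - mu n n) ^+ 2 = delta2 (mu n 1%N) (mu n n).
  by rewrite sqr_sqrtr//; exact: delta2_ge0.
have mT n : measurable_fun setT (Tstat n) by exact: measurable_combined_stat.
split=> [rM|rO rC].
- pose q n w := (sigma1_hat n (realized_sample (X n) w))^-1 * mean_stat n (realized_sample (X n) w).
  have mq n : measurable_fun setT (q n) by exact: measurable_mean_ratio.
  suff qL (t eps : R) : 0 <= t -> 0 < eps ->
      \forall n \near \oo, fine (P n [set w | q n w <= t]) <= eps.
    split; first exact: (cvg_pval mq qL).
    by apply: (cvg_pinfty_combined mq qL mT) => A n w /combined_stat_le[].
  move=> t0 e0; set K := mean_const C4 cc t.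
  (* The final bound is [K / N], hence N >= K / eps; taking at least N blocks makes the vanishing of
     the trace estimator as unlikely. *)
  pose N : R := Num.max 1 (K / eps); pose m := (Num.truncn N).+1.
  have N1 : 1 <= N by rewrite le_max lexx.
  have Nm : N <= m%:R by rewrite ltW// truncnS_gt.
  near=> n.
  have [] : [/\ (4 * m + 128 <= ts n)%N, (4 * m + 128 <= n - ts n)%N, cc * n%:R <= (ts n)%:R &
      cc * n%:R <= (n - ts n)%N%:R] by near: n; exact: changepoint_near.
  move=> ts1 ts2 c1 c2.
  have [/cp_split[cpm cps] _] : (forall i, (1 <= i <= n)%N -> (mu n i, Sigma n i) =
    if (i <= ts n)%N then (mu n 1%N, Sigma n 1%N) else (mu n n, Sigma n n)) /\
     (mu n 1%N, Sigma n 1%N) <> (mu n n, Sigma n n) by near: n; exact: cp.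
  have rN : N <= ratio_mean n by near: n; move/cvgryPge : rM; exact.
  have [[n128 n1 mn] [ts32 nts32 mts mnts]] := margin_bounds ts1 ts2.
  have [k0 Nk] : 0 < kappa2 (Sigma n 1%N) (Sigma n n) /\
      N * Num.sqrt (kappa2 (Sigma n 1%N) (Sigma n n)) <= n%:R * delta2 (mu n 1%N) (mu n n).
    by rewrite -d2E; exact: (ratio_sqrt_ge (trB n n1) N1 rN).
  have Nn : N <= n%:R by apply: le_trans Nm _; rewrite ler_nat.
  apply: le_trans (prob_mean_stat_le (indX n) (X8 n) cpm cps C40 (fourth n) (Ssym n 1%N) (Ssym n n)
    cc0 c1 c2 n128 ts32 nts32 (ltn0Sn _) mts mnts N1 Nm Nn t0 k0 Nk) _.
  rewrite ler_pdivrMr; last exact: lt_le_trans N1.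
  by rewrite [leRHS]mulrC -ler_pdivrMr// le_max lexx orbT.
- pose q n w := (sigma2_hat n (realized_sample (X n) w))^-1 * cov_stat n (realized_sample (X n) w).
  have mq n : measurable_fun setT (q n) by exact: measurable_cov_ratio.
  suff qL (t eps : R) : 0 <= t -> 0 < eps ->
      \forall n \near \oo, fine (P n [set w | q n w <= t]) <= eps.
    split; first exact: (cvg_pval mq qL).
    by apply: (cvg_pinfty_combined mq qL mT) => A n w /combined_stat_le[].
  move=> t0 e0.
  have [k k0 rk] : exists2 k, 0 < k & \forall n \near \oo, `|ratio_mean n| <= k.
    move/eqO_exP : rO => [k k0 rk]; exists k => //; apply: filterS rk => n.
    by rewrite normr1 mulr1.
  pose B := 2 * k ^+ 2; have B0 : 0 <= B by rewrite mulr_ge0// sqr_ge0.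
  pose a := cc ^+ 4 / 128; have a0 : 0 < a by rewrite divr_gt0// exprn_gt0.
  set K := cov_const C4 cc t B.
  (* The additional entry yields [BN], by which the covariance signal outweighs the negative mean
     contribution. *)
  pose N : R := Num.max 1 (Num.max (K / eps) (3 / 2 * B / a)); pose m := (Num.truncn N).+1.
  have N1 : 1 <= N by rewrite le_max lexx.
  have BN : 3 / 2 * B <= a * N.
    by rewrite [leRHS]mulrC -ler_pdivrMr// !le_max lexx !orbT.
  have Nm : N <= m%:R by rewrite ltW// truncnS_gt.
  near=> n.
  have [] : [/\ (4 * m + 128 <= ts n)%N, (4 * m + 128 <= n - ts n)%N, cc * n%:R <= (ts n)%:R &
      cc * n%:R <= (n - ts n)%N%:R] by near: n; exact: changepoint_near.
  move=> ts1 ts2 c1 c2.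
  have [/cp_split[cpm cps] _] : (forall i, (1 <= i <= n)%N -> (mu n i, Sigma n i) =
    if (i <= ts n)%N then (mu n 1%N, Sigma n 1%N) else (mu n n, Sigma n n)) /\
     (mu n 1%N, Sigma n 1%N) <> (mu n n, Sigma n n) by near: n; exact: cp.
  have rN : N <= ratio_cov n by near: n; move/cvgryPge : rC; exact.
  have rk' : `|ratio_mean n| <= k by near: n.
  have [[n128 n1 mn] [ts32 nts32 mts mnts]] := margin_bounds ts1 ts2.
  have [K0 Nk] := ratio_ge (trB n n1) N1 (kappa2_ge0 (Ssym n 1%N) (Ssym n n)) rN.
  have meanB : (n%:R * delta2 (mu n 1%N) (mu n n)) ^+ 2 <= B * kappa2 (Sigma n 1%N) (Sigma n n).
    by rewrite -d2E; exact: (ratio_sqrt_bounded (trB n n1) K0 rk').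
  have Nn : N <= n%:R by apply: le_trans Nm _; rewrite ler_nat.
  apply: le_trans (prob_cov_stat_le (indX n) (X8 n) cpm cps C40 (fourth n) (Ssym n 1%N) (Ssym n n)
    cc0 c1 c2 n128 ts32 nts32 (ltn0Sn _) mts mnts N1 Nm Nn t0 K0 B0 meanB Nk BN) _.
  rewrite ler_pdivrMr; last exact: lt_le_trans N1.
  by rewrite [leRHS]mulrC -ler_pdivrMr// !le_max lexx !orbT.
Unshelve. all: by end_near. Qed.
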